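(* For any $\bar X=(\bar y,\bar U,\bar\nu,\bar r)\in\mathcal F$, the system $$\zeta_t=U,\quad U_t=-Q,\quad \nu_t=-2QUy_\xi+(3U^2-2P)U_\xi,\quad r_t=0\qquad(y(t,\xi)=\xi+\zeta(t,\xi))$$ admits a unique global solution $X(t)=(y(t),U(t),\nu(t),r(t))$ in $C^1(\mathbb R_+,E)$ with initial data $X(0)=\bar X$, and $X(t)\in\mathcal F$ for all $t\ge 0$. Define $S:\mathcal F\times\mathbb R_+\to\mathcal F$ by $S_t(\bar X)=X(t)$. Given $M>0$ and $T>0$, let $$B_M=\{X=(y,U,\nu,r)\in E:\ \|U\|_{W^{1,1}_{\rm per}}+\|y_\xi\|_{L^1_{\rm per}}+\|\nu\|_{L^1_{\rm per}}\le M\}.$$ Then there exists a constant $C_M$, depending only on $M$ and $T$, such that for any two elements $X_\alpha,X_\beta\in B_M\cap\mathcal F$, $$\|S_tX_\alpha-S_tX_\beta\|_E\le C_M\|X_\alpha-X_\beta\|_E\quad\text{for all }t\in[0,T].$$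
   Context: $\mathbb R_+=[0,\infty)$. $W^{1,1}_{\rm per}$ and $L^1_{\rm per}$ are the spaces of 1-periodic functions in $W^{1,1}_{\rm loc}(\mathbb R)$ and $L^1_{\rm loc}(\mathbb R)$, with norms $\|f\|_{W^{1,1}_{\rm per}}=\|f\|_{L^\infty([0,1])}+\|f_\xi\|_{L^1([0,1])}$ and $\|f\|_{L^1_{\rm per}}=\|f\|_{L^1([0,1])}$. $E$ is the set of $X=(y,U,\nu,r)$ with $(\zeta,U,\nu,r)\in W^{1,1}_{\rm per}\times W^{1,1}_{\rm per}\times L^1_{\rm per}\times L^1_{\rm per}$, where $\zeta=y-\mathrm{id}$; it is identified with this Banach space via $X\leftrightarrow(\zeta,U,\nu,r)$, so $\|X\|_E=\|y-\mathrm{id}\|_{W^{1,1}_{\rm per}}+\|U\|_{W^{1,1}_{\rm per}}+\|\nu\|_{L^1_{\rm per}}+\|r\|_{L^1_{\rm per}}$ and $\|X-\tilde X\|_E=\|y-\tilde y\|_{W^{1,1}_{\rm per}}+\|U-\tilde U\|_{W^{1,1}_{\rm per}}+\|\nu-\tilde\nu\|_{L^1_{\rm per}}+\|r-\tilde r\|_{L^1_{\rm per}}$. $\mathcal F$ is the set of $(y,U,\nu,r)\in E$ with $y,U\in W^{1,\infty}_{\rm loc}(\mathbb R)$, $\nu,r\in L^\infty(\mathbb R)$, $y_\xi\ge0$, $\nu\ge0$, $y_\xi+\nu\ge c$ a.e. for some constant $c>0$, and $y_\xi\nu=y_\xi^2U^2+U_\xi^2+r^2$ a.e. In the system, for $\xi\in[0,1]$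 (extended 1-periodically in $\xi$), $$P(t,\xi)=\frac1{2(e-1)}\int_0^1\cosh(y(t,\xi)-y(t,\theta))(U^2y_\xi+\nu)(t,\theta)\,d\theta+\frac14\int_0^1e^{-\mathrm{sgn}(\xi-\theta)(y(t,\xi)-y(t,\theta))}(U^2y_\xi+\nu)(t,\theta)\,d\theta,$$ $$Q(t,\xi)=\frac1{2(e-1)}\int_0^1\sinh(y(t,\xi)-y(t,\theta))(U^2y_\xi+\nu)(t,\theta)\,d\theta-\frac14\int_0^1\mathrm{sgn}(\xi-\theta)e^{-\mathrm{sgn}(\xi-\theta)(y(t,\xi)-y(t,\theta))}(U^2y_\xi+\nu)(t,\theta)\,d\theta.$$ *)

(* Defs.v *)
From mathcomp Require Import all_boot all_order all_algebra.
From mathcomp Require Import all_classical all_reals all_analysis.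

Set Implicit Arguments.
Unset Strict Implicit.
Unset Printing Implicit Defensive.

Import Order.TTheory GRing.Theory Num.Theory.
Import numFieldNormedType.Exports.

Local Open Scope classical_set_scope.
Local Open Scope ring_scope.

Section FunctionSpaces.
Variable R : realType.
Local Notation mu := (@lebesgue_measure R).
Implicit Types (p : \bar R) (f g phi : R -> R).

(* Elements of L^p-type spaces are represented by (Borel) measurable functions;
   equality in these spaces is almost everywhere equality. *)

Definition LnormI p (a b : R) f : \bar R :=
  'N[mu]_p [EFin \o (f \_ `[a, b])].

Definition Lploc p f : Prop :=
  measurable_fun [set: R] f /\ forall a b : R, (LnormI p a b f < +oo)%E.

Definition Linfty f : Prop :=
  measurable_fun [set: R] f /\ ('N[mu]_+oo [EFin \o f] < +oo)%E.

Definition test_function phi : Prop :=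
  [/\ forall x : R, derivable phi x 1,
      continuous (derive1 phi)
    & exists a b : R, forall x, x \notin `[a, b] -> phi x = 0].

Definition weak_derivative f g : Prop := forall phi, test_function phi ->
  \int[mu]_x (f x * derive1 phi x) = - \int[mu]_x (g x * phi x).

Definition W1ploc p f : Prop :=
  Lploc p f /\ exists2 g, Lploc p g & weak_derivative f g.

(* The weak derivative f_xi (a representative of its a.e. class), and 0 when
   f has no locally integrable weak derivative. *)
Definition wderiv f : R -> R :=
  xget (cst 0) [set g | Lploc 1%E g /\ weak_derivative f g].

(* Elements of W^{1,1}_per are represented by their continuous
   representatives, so that equality there is pointwise equality. *)
Definition W11per f : Prop :=
  [/\ W1ploc 1%E f, continuous f & periodic f 1].

Definition L1per f : Prop :=
  Lploc 1%E f /\ {ae mu, forall x, f (x + 1) = f x}.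

Definition normL1per f : \bar R := LnormI 1%E 0 1 f.

Definition normW11per f : \bar R :=
  (LnormI +oo%E 0 1 f + LnormI 1%E 0 1 (wderiv f))%E.

End FunctionSpaces.

Section BanachSpace.
Variable R : realType.
Local Notation mu := (@lebesgue_measure R).

(* The Banach space W^{1,1}_per x W^{1,1}_per x L^1_per x L^1_per is cut out
   of this vector space of quadruples of functions by in_B, with norm normB
   and equality eqB. *)
Local Notation quad := ((R -> R) * (R -> R) * (R -> R) * (R -> R))%type.

Definition in_B (v : quad) : Prop := let: (z, U, nu, r) := v in
  [/\ W11per z, W11per U, L1per nu & L1per r].

Definition normB (v : quad) : \bar R := let: (z, U, nu, r) := v in
  (normW11per z + normW11per U + normL1per nu + normL1per r)%E.

Definition eqB (v w : quad) : Prop :=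
  let: (z, U, nu, r) := v in let: (z', U', nu', r') := w in
  [/\ z = z', U = U', {ae mu, forall x, nu x = nu' x}
    & {ae mu, forall x, r x = r' x}].

(* u is in C^1(R_+, B) with derivative du (one-sided at t = 0). *)
Definition C1_curve (u du : R -> quad) : Prop :=
  [/\ forall t : R, 0 <= t -> in_B (u t) /\ in_B (du t),
      forall t : R, 0 <= t ->
        normB (h^-1 *: (u (t + h) - u t) - du t)
          @[h --> within [set h : R | 0 <= t + h] 0^'] --> 0%E
    & forall t : R, 0 <= t ->
        normB (du s - du t) @[s --> within [set s : R | 0 <= s] (nbhs t)] --> 0%E].

End BanachSpace.

Section System.
Variable R : realType.
Local Notation mu := (@lebesgue_measure R).
Local Notation quad := ((R -> R) * (R -> R) * (R -> R) * (R -> R))%type.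

Record state : Type :=
  State { sy : R -> R; sU : R -> R; snu : R -> R; sr : R -> R }.
Implicit Types X Y : state.

Definition coordE X : quad := (fun x => sy X x - x, sU X, snu X, sr X).

Definition in_E X : Prop := in_B (coordE X).

Definition eq_state X Y : Prop := eqB (coordE X) (coordE Y).

Definition distE X Y : \bar R := normB (coordE X - coordE Y).

Definition calF X : Prop :=
  [/\ in_E X,
      W1ploc +oo%E (sy X) /\ W1ploc +oo%E (sU X),
      Linfty (snu X) /\ Linfty (sr X),
      [/\ {ae mu, forall x, 0 <= wderiv (sy X) x},
          {ae mu, forall x, 0 <= snu X x}
        & exists2 c : R, 0 < c &
            {ae mu, forall x, c <= wderiv (sy X) x + snu X x}]
    & {ae mu, forall x, wderiv (sy X) x * snu X x =
        wderiv (sy X) x ^+ 2 * sU X x ^+ 2 + wderiv (sU X) x ^+ 2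
          + sr X x ^+ 2}].

Definition ball_B (M : R) X : Prop :=
  in_E X /\
  (normW11per (sU X) + normL1per (wderiv (sy X)) + normL1per (snu X)
     <= M%:E)%E.

Definition cosh (x : R) : R := (expR x + expR (- x)) / 2.
Definition sinh (x : R) : R := (expR x - expR (- x)) / 2.

Definition density X (x : R) : R := sU X x ^+ 2 * wderiv (sy X) x + snu X x.

Definition P01 X (xi : R) : R :=
  (2 * (expR 1 - 1))^-1 *
    \int[mu]_(theta in `[0, 1]) (cosh (sy X xi - sy X theta) * density X theta)
  + 4^-1 *
    \int[mu]_(theta in `[0, 1])
      (expR (- Num.sg (xi - theta) * (sy X xi - sy X theta))
         * density X theta).

Definition Q01 X (xi : R) : R :=
  (2 * (expR 1 - 1))^-1 *
    \int[mu]_(theta in `[0, 1]) (sinh (sy X xi - sy X theta) * density X theta)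
  - 4^-1 *
    \int[mu]_(theta in `[0, 1])
      (Num.sg (xi - theta)
         * expR (- Num.sg (xi - theta) * (sy X xi - sy X theta))
         * density X theta).

(* P01 and Q01 give P and Q on [0, 1] only and take equal values at 0 and 1
   when X is in E. *)
Definition periodic_extension (f : R -> R) (x : R) : R :=
  f (x - (Num.floor x)%:~R).

Definition P X : R -> R := periodic_extension (P01 X).
Definition Q X : R -> R := periodic_extension (Q01 X).

Definition rhs X : quad :=
  (sU X,
   fun x => - Q X x,
   fun x => - 2 * Q X x * sU X x * wderiv (sy X) x
            + (3 * sU X x ^+ 2 - 2 * P X x) * wderiv (sU X) x,
   fun _ => 0).

(* Only the values of X at times t >= 0 matter. *)
Definition global_solution (Xbar : state) (X : R -> state) : Prop :=
  eq_state (X 0) Xbar /\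
  exists2 dX : R -> quad, C1_curve (fun t => coordE (X t)) dX
    & forall t : R, 0 <= t -> eqB (dX t) (rhs (X t)).

End System.

(* Main.v *)
Require Import Defs.
From HB Require Import structures.
From mathcomp Require Import all_boot all_order all_algebra.
From mathcomp Require Import all_classical all_reals all_analysis.
From mathcomp Require Import measurable_realfun ess_sup_inf ring lra.

Set Implicit Arguments.
Unset Strict Implicit.
Unset Printing Implicit Defensive.

Import Order.TTheory GRing.Theory Num.Theory.
Import numFieldNormedType.Exports.

Local Open Scope classical_set_scope.
Local Open Scope ring_scope.

(* Estimates in E depend only on H = int_0^1 nu and on the L^1 norms over one
   period: cosh and sinh of y(xi) - y(theta) are controlled by the oscillation
   int y_xi = 1, so X -> rhs X is Lipschitz in E on sets where U, y_xi, U_xi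
   and nu are bounded, and a Gronwall argument gives uniqueness and the
   Lipschitz estimate as soon as such bounds hold along solutions.  For data in
   F they do: the relation y_xi nu = y_xi^2 U^2 + U_xi^2 + r^2 is preserved,
   y_xi and nu stay nonnegative, nu_t = (U^3 - 2 P U)_xi makes H constant, and
   the relation bounds U, U_xi and y_xi by H.

   Existence.  After choosing representatives for which the relation holds at
   every xi, the system for (y, U, y_xi, U_xi, nu) is an ordinary differential
   equation in the sup norm over xi: P_xi = Q y_xi and
   Q_xi = P y_xi - (U^2 y_xi + nu) / 2 show that the derivatives y_xi and U_xi
   satisfy equations of their own.  Its cut-off is globally Lipschitz and is
   solved by dyadic Euler steps.  The growth of y_xi + nu is at most exponential
   with a rate depending only on H, which gives the positivity and a sup bound
   that removes the cut-off. *)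

(** * Integrals and primitives on intervals *)

(** The relation that defines F is quadratic in [y_xi], [U_xi] and [r], which the topology of E sees
    only as L^1 classes, so it is hard to follow along a curve in E. This is why existence uses
    functions given at every xi and returns to classes at the end. Uniqueness concerns arbitrary C^1
    curves in E and therefore rests on estimates in E alone. Calculus is done with remainders.
    Derivatives in xi are integral identities ([prim]), derivatives in time are two-point estimates
    of order two, uniform in xi; product rules then become elementary inequalities. Removing the
    cut-off seems circular: the bounds need the signs and the conservation of H, but at first only
    the cut-off flow exists. The way out is that the cut-off is a single scalar, common to all xi
    and all components. The quadratic relation and the conservation of H thus hold for the cut-off
    flow itself, and the level of the cut-off can be fixed in advance from H, the sup norm of the
    data and the time horizon. *)

Section IntervalIntegral.
Variable R : realType.
Local Notation mu := (@lebesgue_measure R).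
Implicit Types (a b c d x : R) (f g h : R -> R).

Definition integ a b f := mu.-integrable `[a, b] (EFin \o f).
Definition itg a b f : R := \int[mu]_(x in `[a, b]) f x.

Lemma itvcc_measurable a b : measurable (`[a, b]%classic : set (measurableTypeR R)).
Proof. exact: measurable_itv. Qed.
Hint Resolve itvcc_measurable : core.

Lemma ae_imp (P Q : R -> Prop) : {ae mu, forall x, P x} ->
  (forall x, P x -> Q x) -> {ae mu, forall x, Q x}.
Proof. by move=> H PQ; exact: (@filterS _ _ (ae_filter_ringOfSetsType mu) _ _ PQ H). Qed.

Lemma ae_imp2 (P1 P2 Q : R -> Prop) : {ae mu, forall x, P1 x} ->
  {ae mu, forall x, P2 x} ->
  (forall x, P1 x -> P2 x -> Q x) -> {ae mu, forall x, Q x}.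
Proof.
by move=> H1 H2 PQ;
  exact: (@filterS2 _ _ (ae_filter_ringOfSetsType mu) _ _ _ PQ H1 H2).
Qed.

Lemma integS a b c d f : a <= c -> d <= b -> integ a b f -> integ c d f.
Proof.
move=> ac db; apply: integrableS => // x /=.
by rewrite !in_itv/= => /andP[cx xd]; rewrite (le_trans ac)//= (le_trans xd).
Qed.

Lemma itgs a f : itg a a f = 0.
Proof. by rewrite /itg set_itv1 Rintegral_set1. Qed.

Lemma itg_cat c a b f : a <= c -> c <= b -> integ a b f ->
  itg a b f = itg a c f + itg c b f.
Proof.
move=> ac cb fi; rewrite /itg.
have := @Rintegral_itvB R f (BLeft a) (BRight b) c fi.
rewrite !bnd_simp => /(_ ac cb) H.
rewrite -(@Rintegral_itv_obnd_cbnd R c) ?H.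
  by rewrite -H addrC subrK.
apply: (@integrableS _ _ _ mu `[a, b]) => // x /=.
by rewrite !in_itv/= => /andP[cx ->]; rewrite (le_trans ac)//= ltW.
Qed.

Lemma eq_itg a b f g : (forall x, a <= x <= b -> f x = g x) ->
  itg a b f = itg a b g.
Proof.
move=> fg; apply: eq_Rintegral => x; rewrite inE/= in_itv/= => xab.
exact: fg.
Qed.

Lemma eq_integ a b f g : (forall x, a <= x <= b -> f x = g x) ->
  integ a b f -> integ a b g.
Proof.
move=> fg; apply: eq_integrable => // x; rewrite inE/= in_itv/= => xab.
by rewrite fg.
Qed.

Lemma integD a b f g : integ a b f -> integ a b g ->
  integ a b (fun x => f x + g x).
Proof. by move=> fi gi; have := integrableD (itvcc_measurable a b) fi gi. Qed.

Lemma integZ a b k f : integ a b f -> integ a b (fun x => k * f x).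
Proof. by move=> fi; have := integrableZl (itvcc_measurable a b) k fi. Qed.

Lemma integN a b f : integ a b f -> integ a b (fun x => - f x).
Proof.
move/(@integZ _ _ (-1)); apply: eq_integ => x _; by rewrite mulN1r.
Qed.

Lemma integB a b f g : integ a b f -> integ a b g ->
  integ a b (fun x => f x - g x).
Proof. by move=> fi gi; apply: integD => //; exact: integN. Qed.

Lemma integ_norm a b f : integ a b f -> integ a b (fun x => `|f x|).
Proof. exact: integrable_norm. Qed.

Lemma itgD a b f g : integ a b f -> integ a b g ->
  itg a b (fun x => f x + g x) = itg a b f + itg a b g.
Proof. by move=> fi gi; rewrite /itg RintegralD. Qed.

Lemma itgB a b f g : integ a b f -> integ a b g ->
  itg a b (fun x => f x - g x) = itg a b f - itg a b g.
Proof. by move=> fi gi; rewrite /itg RintegralB. Qed.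

Lemma itgZ a b k f : integ a b f ->
  itg a b (fun x => k * f x) = k * itg a b f.
Proof. by move=> fi; rewrite /itg RintegralZl. Qed.

Lemma itgN a b f : integ a b f -> itg a b (fun x => - f x) = - itg a b f.
Proof.
move=> fi; rewrite -mulN1r -itgZ//; apply: eq_itg => x _; by rewrite mulN1r.
Qed.

Lemma itg_le a b f g : integ a b f -> integ a b g ->
  (forall x, a <= x <= b -> f x <= g x) -> itg a b f <= itg a b g.
Proof.
move=> fi gi fg; apply: le_Rintegral => // x /=; rewrite in_itv/=; exact: fg.
Qed.

Lemma itg_ge0 a b f : (forall x, a <= x <= b -> 0 <= f x) -> 0 <= itg a b f.
Proof.
move=> f0; apply: Rintegral_ge0 => x /=; rewrite in_itv/=; exact: f0.
Qed.

Lemma le_norm_itg a b f : integ a b f -> `|itg a b f| <= itg a b (fun x => `|f x|).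
Proof. by move=> fi; apply: le_normr_Rintegral. Qed.

Lemma itg_norm_le a b f g : integ a b f -> integ a b g ->
  (forall x, a <= x <= b -> `|f x| <= g x) -> `|itg a b f| <= itg a b g.
Proof.
move=> fi gi fg; apply: (le_trans (le_norm_itg fi)).
by apply: itg_le => //; exact: integ_norm.
Qed.

Lemma integ_cst a b k : integ a b (fun=> k).
Proof.
apply: measurable_bounded_integrable => //.
  rewrite /= lebesgue_measure_itv/=; case: ifP => // _; exact: ltry.
apply: (@bounded_cst _ R^o).
Qed.

Lemma itg_cst a b k : a <= b -> itg a b (fun=> k) = k * (b - a).
Proof.
move=> ab; rewrite /itg Rintegral_cst//= lebesgue_measure_itv/= lte_fin.
case: ltP => // ba.
by rewrite (_ : b = a) ?subrr//; apply/eqP; rewrite eq_le ab ba.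
Qed.

Lemma integ_bndM a b M f g : measurable_fun `[a, b] f ->
  (forall x, a <= x <= b -> `|f x| <= M) -> integ a b g ->
  integ a b (fun x => f x * g x).
Proof.
move=> mf fM gi.
suff bf : [bounded f x | x in `[a, b]%classic].
  exact: (@integrableMr _ _ _ mu _ (itvcc_measurable a b) f (EFin \o g) mf bf gi).
exists M; split; first exact: num_real.
move=> N MN x /=; rewrite in_itv/= => xab.
by apply: (le_trans (fM _ xab)); exact: ltW.
Qed.

Lemma integ_bnd a b M f : measurable_fun `[a, b] f ->
  (forall x, a <= x <= b -> `|f x| <= M) -> integ a b f.
Proof.
move=> mf fM; have := integ_bndM mf fM (integ_cst a b 1).
apply: eq_integ => x _; by rewrite mulr1.
Qed.

Lemma within_cont_bnd a b f : a <= b -> {within `[a, b], continuous f} ->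
  exists M, forall x, a <= x <= b -> `|f x| <= M.
Proof.
move=> ab cf.
have /(EVT_max ab)[c _ H] : {within `[a, b], continuous (fun x => `|f x|)}.
  by move=> x; apply: cvg_norm; exact: cf.
by exists `|f c| => x xab; apply: H; rewrite in_itv.
Qed.

Lemma within_cont_mfun a b f : {within `[a, b], continuous f} ->
  measurable_fun `[a, b] f.
Proof. by move=> cf; apply: subspace_continuous_measurable_fun. Qed.

Lemma integ_cM a b f g : a <= b -> {within `[a, b], continuous f} ->
  integ a b g -> integ a b (fun x => f x * g x).
Proof.
move=> ab cf gi; have [M fM] := within_cont_bnd ab cf.
exact: (integ_bndM (within_cont_mfun cf) fM gi).
Qed.

Lemma integ_cont a b f : a <= b -> {within `[a, b], continuous f} -> integ a b f.
Proof.
move=> ab cf; have [M fM] := within_cont_bnd ab cf.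
exact: (integ_bnd (within_cont_mfun cf) fM).
Qed.

Lemma itg_ae a b f g : integ a b f -> integ a b g ->
  {ae mu, forall x, a <= x <= b -> f x = g x} -> itg a b f = itg a b g.
Proof.
move=> fi gi fg; rewrite /itg /Rintegral; congr fine.
apply: ae_eq_integral => //.
- by case/integrableP : fi.
- by case/integrableP : gi.
- by apply: (ae_imp fg) => x /= fgx; rewrite in_itv/= => /fgx ->.
Qed.

Lemma integ_ae a b f g : measurable_fun `[a, b] g -> integ a b f ->
  {ae mu, forall x, a <= x <= b -> f x = g x} -> integ a b g.
Proof.
move=> mg /integrableP[mf fi] fg; apply/integrableP; split.
  exact/measurable_EFinP.
rewrite (_ : (\int[mu]_(x in `[a, b]) `|(EFin \o g) x| =
   \int[mu]_(x in `[a, b]) `|(EFin \o f) x|)%E) //.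
apply: ae_eq_integral => //.
- by apply/measurableT_comp => //; exact/measurable_EFinP.
- exact/measurableT_comp.
- by apply: (ae_imp fg) => x /= fgx; rewrite in_itv/= => /fgx ->.
Qed.

Lemma itg_monotone a b x y g : a <= x -> x <= y -> y <= b -> integ a b g ->
  (forall x, a <= x <= b -> 0 <= g x) -> itg a x g <= itg a y g.
Proof.
move=> ax xy yb gi g0; rewrite [leRHS](@itg_cat x)//; last exact: integS gi.
rewrite lerDl; apply: itg_ge0 => z /andP[xz zy]; apply: g0.
by rewrite (le_trans ax)//= (le_trans zy).
Qed.

Lemma itg_sub_le a b c d g : a <= c -> c <= d -> d <= b -> integ a b g ->
  (forall x, a <= x <= b -> 0 <= g x) -> itg c d g <= itg a b g.
Proof.
move=> ac cd db gi g0; apply: (@le_trans _ _ (itg a d g)); last first.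
  exact: itg_monotone (le_trans ac cd) db _ gi g0.
rewrite [leRHS](@itg_cat c)//; last exact: integS gi.
rewrite lerDr; apply: itg_ge0 => z /andP[az zc]; apply: g0.
by rewrite az (le_trans zc)// (le_trans cd).
Qed.

End IntervalIntegral.
#[global] Hint Resolve itvcc_measurable : core.

Section Primitives.
Variable R : realType.
Local Notation mu := (@lebesgue_measure R).
Implicit Types (a b c d x y : R) (f g h k G : R -> R).

(** Absolute continuity on [[a, b]] with density [g], in integrated form: product and chain rules
    can then be proved without differentiating at points, and changing [g] on a null set is
    harmless. *)
Definition prim a b f g :=
  integ a b g /\ forall x, a <= x <= b -> f x = f a + itg a x g.

Lemma prim_diff a b f g x y : prim a b f g -> a <= x -> x <= y -> y <= b ->
  f y - f x = itg x y g.
Proof.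
move=> [gi fg] ax xy yb.
rewrite fg; last by rewrite (le_trans ax xy) yb.
rewrite (fg x); last by rewrite ax (le_trans xy yb).
rewrite (@itg_cat _ x)//; last exact: integS gi.
by rewrite opprD addrACA subrr add0r addrAC subrr add0r.
Qed.

Lemma primP a b f g : integ a b g ->
  (forall x y, a <= x -> x <= y -> y <= b -> f y - f x = itg x y g) ->
  prim a b f g.
Proof.
by move=> gi fg; split=> // x /andP[ax xb]; rewrite -fg// addrC subrK.
Qed.

Lemma primS a b c d f g : a <= c -> d <= b -> prim a b f g -> prim c d f g.
Proof.
move=> ac db fg; apply: primP; first exact: integS fg.1.
move=> x y cx xy yd; apply: (prim_diff fg) => //.
  exact: le_trans cx.
exact: le_trans db.
Qed.

Lemma prim_cont a b f g : a <= b -> prim a b f g ->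
  {within `[a, b], continuous f}.
Proof.
move=> ab [gi fg].
have H := parameterized_integral_continuous ab gi.
apply: (@subspace_eq_continuous _ _ _ (fun x => f a + itg a x g)).
  by move=> x /=; rewrite inE/= in_itv/= => xab; apply/esym/fg.
by move=> x; apply: cvgD; [exact: cvg_cst|exact: H].
Qed.

Lemma eq_prim a b f f' g g' : (forall x, a <= x <= b -> f x = f' x) ->
  (forall x, a <= x <= b -> g x = g' x) -> prim a b f g -> prim a b f' g'.
Proof.
move=> ff' gg' fg; apply: primP; first exact: eq_integ gg' fg.1.
move=> x y ax xy yb.
rewrite -!ff' ?ax ?yb ?(le_trans xy yb) ?(le_trans ax xy)//.
rewrite (prim_diff fg)//; apply: eq_itg => z /andP[xz zy].
by rewrite gg'// (le_trans ax xz) (le_trans zy yb).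
Qed.

Lemma prim_ae a b f g g' : measurable_fun `[a, b] g' ->
  {ae mu, forall x, a <= x <= b -> g x = g' x} ->
  prim a b f g -> prim a b f g'.
Proof.
move=> mg' gg' fg; have ig' := integ_ae mg' fg.1 gg'.
apply: primP => // x y ax xy yb.
rewrite (prim_diff fg)//; apply: itg_ae.
- exact: integS fg.1.
- exact: integS ig'.
- apply: (ae_imp gg') => z H /andP[xz zy]; apply: H.
  by rewrite (le_trans ax xz) (le_trans zy yb).
Qed.

Lemma prim_cst a b (k : R) : prim a b (fun=> k) (fun=> 0).
Proof.
apply: primP; first exact: integ_cst.
by move=> x y _ xy _; rewrite itg_cst// mul0r subrr.
Qed.

Lemma prim_id a b : prim a b (fun x => x) (fun=> 1).
Proof.
apply: primP; first exact: integ_cst.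
by move=> x y _ xy _; rewrite itg_cst// mul1r.
Qed.

Lemma primD a b f f' g g' : prim a b f g -> prim a b f' g' ->
  prim a b (fun x => f x + f' x) (fun x => g x + g' x).
Proof.
move=> fg fg'; apply: primP; first exact: integD fg.1 fg'.1.
move=> x y ax xy yb; rewrite itgD; [|exact: integS fg.1|exact: integS fg'.1].
by rewrite -(prim_diff fg)// -(prim_diff fg')//; ring.
Qed.

Lemma primZ a b f g (k : R) : prim a b f g ->
  prim a b (fun x => k * f x) (fun x => k * g x).
Proof.
move=> fg; apply: primP; first exact: integZ fg.1.
move=> x y ax xy yb; rewrite itgZ; last exact: integS fg.1.
by rewrite -(prim_diff fg)//; ring.
Qed.

Lemma primN a b f g : prim a b f g -> prim a b (fun x => - f x) (fun x => - g x).
Proof.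
move/(@primZ _ _ _ _ (-1)); apply: eq_prim => x _; by rewrite mulN1r.
Qed.

Lemma primB a b f f' g g' : prim a b f g -> prim a b f' g' ->
  prim a b (fun x => f x - f' x) (fun x => g x - g' x).
Proof. by move=> fg fg'; apply: primD => //; exact: primN. Qed.

Lemma prim_itg a b g : a <= b -> integ a b g -> prim a b (fun x => itg a x g) g.
Proof. by move=> ab gi; split=> // x _; rewrite itgs add0r. Qed.

(* Cutting [a, x] at points where G takes n equidistant values makes the total
   error at most C (G x - G a)^2 / n. *)
Lemma prim_of_quadratic a b h k G C : a <= b -> integ a b k ->
  {within `[a, b], continuous G} ->
  (forall x y, a <= x -> x <= y -> y <= b -> G x <= G y) ->
  (forall x y, a <= x -> x <= y -> y <= b ->
    `|h y - h x - itg x y k| <= C * (G y - G x) ^+ 2) ->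
  prim a b h k.
Proof.
move=> ab ki cG mG H; split=> // b' /andP[ab' b'b].
(* The increments of [z] are quadratic in those of [G], so [z] has to be constant. *)
pose z x := h x - itg a x k.
have zE x y : a <= x -> x <= y -> y <= b ->
    `|z y - z x| <= C * (G y - G x) ^+ 2.
  move=> ax xy yb; rewrite (_ : z y - z x = h y - h x - itg x y k) ?H//.
  by rewrite /z (@itg_cat _ x a y)//; [ring|exact: integS ki].
suff -> : h b' = z b' + itg a b' k.
  suff -> : z b' = h a by [].
  set D := G b' - G a.
  have D0 : 0 <= D by rewrite subr_ge0 mG.
  suff zn n : `|z b' - z a| <= C * D ^+ 2 / n.+1%:R.
    have za : z a = h a by rewrite /z itgs subr0.
    rewrite -za; apply/eqP; rewrite -subr_eq0 -normr_le0 leNgt; apply/negP => p.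
    set e := `|z b' - z a| in p zn.
    have e0 : 0 < C * D ^+ 2 + 1.
      have := zn 0%N; rewrite divr1 => le1.
      by rewrite (lt_le_trans p)// (le_trans le1)// lerDl.
    have [n nlt] : exists n : nat, (C * D ^+ 2 + 1) / e < n.+1%:R.
      exists (Num.bound ((C * D ^+ 2 + 1) / e)).
      apply: lt_le_trans (archi_boundP _) _; first by rewrite divr_ge0// ltW.
      by rewrite ler_nat.
    have := zn n; rewrite ler_pdivlMr ?ltr0n// leNgt => /negP; apply.
    by move: nlt; rewrite ltr_pdivrMr// mulrC; lra.
  have N0 : (0 : R) < n.+1%:R by rewrite ltr0n.
  have step i : (i <= n.+1)%N -> exists x, [/\ a <= x, x <= b',
      G x = G a + i%:R / n.+1%:R * D &
      `|z x - z a| <= i%:R * (C * (D / n.+1%:R) ^+ 2)].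
    elim: i => [_|i IH iN].
      by exists a; rewrite lexx ab' mul0r mul0r addr0 subrr normr0 mul0r.
    have [x [ax xb' Gx zx]] := IH (ltnW iN).
    have cG' : {within `[x, b'], continuous G}.
      apply: continuous_subspaceW cG => u /=; rewrite !in_itv/= => /andP[? ?].
      by rewrite (le_trans ax)//= (le_trans _ b'b).
    have GG : G x <= G b' by apply: mG.
    have [|c] := @IVT R G x b' (G a + i.+1%:R / n.+1%:R * D) xb' cG'.
      rewrite (min_idPl GG) (max_idPr GG) Gx lerD2l ler_wpM2r//=; last first.
        by rewrite ler_wpM2r// ?invr_ge0// ler_nat.
      by rewrite -lerBrDl -/D ler_piMl// ler_pdivrMr// mul1r ler_nat.
    rewrite in_itv/= => /andP[xc cb'] Gc; exists c; split => //.
      exact: le_trans xc.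
    have xcz := zE _ _ ax xc (le_trans cb' b'b).
    rewrite -addn1 natrD mulrDl mul1r.
    have -> : z c - z a = (z x - z a) + (z c - z x) by ring.
    apply: (le_trans (ler_normD _ _)); apply: lerD => //.
    apply: (le_trans xcz); rewrite Gc Gx.
    suff -> : G a + i.+1%:R / n.+1%:R * D - (G a + i%:R / n.+1%:R * D)
       = D / n.+1%:R by [].
    by rewrite -addn1 natrD; field; rewrite gt_eqF.
  have [x [ax xb' Gx zx]] := step _ (leqnn _).
  (* The last cut point [x] need not be [b'], but [G] takes the same value at both, so the quadratic
     bound gives [z x = z b']. *)
  have zb : `|z b' - z x| <= 0.
    apply: (le_trans (zE _ _ ax xb' b'b)); rewrite Gx divff ?gt_eqF// mul1r.
    by rewrite (_ : _ - _ = 0) ?expr0n ?mulr0// /D; ring.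
  have -> : z b' - z a = (z x - z a) + (z b' - z x) by ring.
  apply: (le_trans (ler_normD _ _)); rewrite -[leRHS]addr0; apply: lerD => //.
  apply: (le_trans zx); rewrite le_eqVlt; apply/orP; left; apply/eqP; field; by rewrite gt_eqF.
by rewrite /z subrK.
Qed.

End Primitives.

(** * Product rule and exponential chain rule for absolutely continuous functions *)

Section ProductChain.
Variable R : realType.
Local Notation mu := (@lebesgue_measure R).
Implicit Types (a b c d x y : R) (f g h k G : R -> R).

Lemma prim_norm_le a b f g x y : prim a b f g -> a <= x -> x <= y -> y <= b ->
  `|f y - f x| <= itg x y (fun t => `|g t|).
Proof.
move=> fg ax xy yb; rewrite (prim_diff fg)//; apply: le_norm_itg.
exact: integS fg.1.
Qed.

Lemma prim_bnd a b f g x : prim a b f g -> a <= x <= b ->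
  `|f x| <= `|f a| + itg a b (fun t => `|g t|).
Proof.
move=> fg /andP[ax xb]; have ng := integ_norm fg.1.
have -> : f x = f a + (f x - f a) by ring.
apply: (le_trans (ler_normD _ _)); rewrite lerD2l.
apply: (le_trans (prim_norm_le fg _ ax xb)) => //.
by apply: (itg_monotone ax xb _ ng).
Qed.

(** Freezing [f] at the left end point costs at most its oscillation times the mass of [g]. As both
    are of first order in the length, the error is of second order, which is what
    [prim_of_quadratic] asks for. *)
Let quad_itg a b f f' g x y D : a <= b -> a <= x -> x <= y -> y <= b ->
  prim a b f f' -> integ a b g ->
  (forall z, x <= z <= y -> `|f z - f x| <= D) ->
  `|itg x y (fun t => f t * g t) - f x * itg x y g|
     <= D * itg x y (fun t => `|g t|).
Proof.
move=> ab ax xy yb ff' ig HD; have ig' := integS ax yb ig.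
have cf := prim_cont xy (primS ax yb ff').
have ifg := integ_cM xy cf ig'.
rewrite -itgZ// -itgB//; last exact: integZ.
have -> : itg x y (fun t => f t * g t - f x * g t) =
          itg x y (fun t => (f t - f x) * g t).
  by apply: eq_itg => t _; ring.
rewrite -itgZ//; last exact: integ_norm.
apply: itg_norm_le.
- by apply: eq_integ (integB ifg (integZ (f x) ig')) => t _; ring.
- exact/integZ/integ_norm.
- by move=> t xt; rewrite normrM ler_wpM2r// HD.
Qed.

(** The control function [G] is the joint variation of [f] and [g]. The error splits into the
    product of the two increments and two integrals with a frozen factor; each is at most the
    product of the variations, whence the constant 3. *)
Lemma primM a b f f' g g' : a <= b -> prim a b f f' -> prim a b g g' ->
  prim a b (fun x => f x * g x) (fun x => f' x * g x + f x * g' x).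
Proof.
move=> ab ff' gg'.
have cf := prim_cont ab ff'; have cg := prim_cont ab gg'.
have if1 : integ a b (fun x => f' x * g x).
  by apply: eq_integ (integ_cM ab cg ff'.1) => t _; ring.
have if2 := integ_cM ab cf gg'.1.
have nf := integ_norm ff'.1; have ng := integ_norm gg'.1.
have nfg := integD nf ng.
pose G x := itg a x (fun t => `|f' t| + `|g' t|).
have GE x y : a <= x -> x <= y -> y <= b ->
    G y - G x = itg x y (fun t => `|f' t|) + itg x y (fun t => `|g' t|).
  move=> ax xy yb; rewrite -itgD; [|exact: integS nf|exact: integS ng].
  exact: (prim_diff (prim_itg ab nfg)).
apply: (@prim_of_quadratic _ a b _ _ G 3) => //.
- exact: integD.
- exact: prim_cont (prim_itg ab nfg).
- move=> x y ax xy yb; rewrite -subr_ge0 GE// addr_ge0//; exact: itg_ge0.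
move=> x y ax xy yb; rewrite GE//.
set Df := itg x y (fun t => `|f' t|); set Dg := itg x y (fun t => `|g' t|).
have Df0 : 0 <= Df by exact: itg_ge0.
have Dg0 : 0 <= Dg by exact: itg_ge0.
have HD u u' : prim a b u u' ->
    forall z, x <= z <= y -> `|u z - u x| <= itg x y (fun t => `|u' t|).
  move=> uu' z /andP[xz zy].
  apply: (le_trans (prim_norm_le uu' ax xz (le_trans zy yb))).
  have nu := integ_norm uu'.1.
  by apply: (itg_monotone xz zy _ (integS ax yb nu)).
have H1 := quad_itg ab ax xy yb ff' gg'.1 (HD _ _ ff').
have H2 := quad_itg ab ax xy yb gg' ff'.1 (HD _ _ gg').
have -> : itg x y (fun t => f' t * g t + f t * g' t) =
    itg x y (fun t => g t * f' t) + itg x y (fun t => f t * g' t).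
  rewrite itgD; [|exact: integS if1|exact: integS if2].
  by congr (_ + _); apply: eq_itg => t _; ring.
move: H1 H2; rewrite -(prim_diff ff')// -(prim_diff gg')// -/Df -/Dg.
have := HD _ _ ff' y; rewrite lexx xy -/Df => /(_ isT).
have := HD _ _ gg' y; rewrite lexx xy -/Dg => /(_ isT).
set A := itg x y (fun t => g t * f' t); set B := itg x y (fun t => f t * g' t).
move=> hg hf H1 H2.
have -> : f y * g y - f x * g x - (A + B) =
  (f y - f x) * (g y - g x) - (B - f x * (g y - g x)) - (A - g x * (f y - f x)).
  by ring.
apply: (le_trans (ler_normB _ _)).
have h0 : `|(f y - f x) * (g y - g x)| <= Df * Dg by rewrite normrM ler_pM.
have := ler_normB ((f y - f x) * (g y - g x)) (B - f x * (g y - g x)).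
nra.
Qed.

Lemma expR_tangent (s t : R) : expR t * (1 + (s - t)) <= expR s.
Proof.
have -> : expR s = expR t * expR (s - t) by rewrite -expRD; congr expR; ring.
by rewrite ler_wpM2l ?expR_ge0// expR_ge1Dx.
Qed.

Lemma expR_lip (M u v : R) : u <= M -> v <= M ->
  `|expR u - expR v| <= expR M * `|u - v|.
Proof.
wlog uv : u v / v <= u => [H uM vM|uM vM].
  have [/H|/ltW /H] := leP v u; first exact.
  by rewrite distrC (distrC u); exact.
rewrite !ger0_norm ?subr_ge0 ?ler_expR//.
have h := expR_tangent v u.
have := ler_expR u M; rewrite uM => hM.
have := expR_gt0 u. nra.
Qed.

Lemma expR_quad (M u v : R) : u <= M -> v <= M ->
  `|expR u - expR v - expR v * (u - v)| <= expR M * (u - v) ^+ 2.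
Proof.
move=> uM vM.
have h1 := expR_tangent u v; have h2 := expR_tangent v u.
rewrite ger0_norm; last by nra.
have h3 : (expR u - expR v) * (u - v) <= expR M * (u - v) ^+ 2.
  apply: (le_trans (ler_norm _)); rewrite normrM -real_normK ?num_real// expr2.
  by rewrite mulrA ler_wpM2r// expR_lip.
apply: le_trans h3.
by lra.
Qed.

(** The control function is the variation of [f]. One [expR M] in the constant pays for the Taylor
    remainder of the exponential, the other for freezing [expR (f t)] at the left end point. *)
Lemma prim_expR a b f f' : a <= b -> prim a b f f' ->
  prim a b (fun x => expR (f x)) (fun x => f' x * expR (f x)).
Proof.
move=> ab ff'; have cf := prim_cont ab ff'.
have nf := integ_norm ff'.1.
set M := `|f a| + itg a b (fun t => `|f' t|).
have fM x : a <= x <= b -> f x <= M.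
  move=> xab; exact: le_trans (ler_norm _) (prim_bnd ff' xab).
have ce : {within `[a, b], continuous (fun x => expR (f x))}.
  by move=> x; apply: continuous_comp; [exact: cf|exact: continuous_expR].
have ie : integ a b (fun x => f' x * expR (f x)).
  by apply: eq_integ (integ_cM ab ce ff'.1) => t _; rewrite mulrC.
pose G x := itg a x (fun t => `|f' t|).
have GE x y : a <= x -> x <= y -> y <= b ->
    G y - G x = itg x y (fun t => `|f' t|).
  exact: (prim_diff (prim_itg ab nf)).
apply: (@prim_of_quadratic _ a b _ _ G (2 * expR M)) => //.
- exact: prim_cont (prim_itg ab nf).
- move=> x y ax xy yb; rewrite -subr_ge0 GE//; exact: itg_ge0.
move=> x y ax xy yb; rewrite GE//.
have ixy := integS ax yb ff'.1.
set D := itg x y (fun t => `|f' t|).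
have D0 : 0 <= D by exact: itg_ge0.
have hD z : x <= z -> z <= y -> `|f z - f x| <= D.
  move=> xz zy.
  apply: (le_trans (prim_norm_le ff' ax xz (le_trans zy yb))).
  by apply: (itg_monotone xz zy _ (integS ax yb nf)).
have fz z : x <= z -> z <= y -> f z <= M.
  by move=> xz zy; apply: fM; rewrite (le_trans ax xz) (le_trans zy yb).
have -> : expR (f y) - expR (f x) - itg x y (fun t => f' t * expR (f t)) =
  (expR (f y) - expR (f x) - expR (f x) * (f y - f x)) -
  (itg x y (fun t => (expR (f t) - expR (f x)) * f' t)).
  rewrite (prim_diff ff')// -itgZ//.
  have -> : itg x y (fun t => (expR (f t) - expR (f x)) * f' t) =
      itg x y (fun t => f' t * expR (f t) - expR (f x) * f' t).
    by apply: eq_itg => t _; ring.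
  by rewrite itgB; [ring|exact: integS ie|exact: integZ].
apply: (le_trans (ler_normB _ _)).
have h1 := expR_quad (fz y xy (lexx _)) (fz x (lexx _) xy).
have h2 : `|itg x y (fun t => (expR (f t) - expR (f x)) * f' t)| <=
    itg x y (fun t => (expR M * D) * `|f' t|).
  apply: itg_norm_le.
  - apply: eq_integ (integB (integS ax yb ie) (integZ (expR (f x)) ixy)) => t _.
    by ring.
  - exact/integZ/integ_norm.
  - move=> t /andP[xt ty]; rewrite normrM ler_wpM2r//.
    apply: (le_trans (expR_lip (fz t xt ty) (fz x (lexx _) xy))).
    by rewrite ler_wpM2l ?expR_ge0 ?hD.
rewrite itgZ in h2; last exact: integ_norm.
have h3 : expR M * (f y - f x) ^+ 2 <= expR M * D ^+ 2.
  rewrite ler_wpM2l ?expR_ge0// -real_normK ?num_real//.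
  by rewrite ler_pXn2r ?nnegrE// hD.
rewrite -/D in h2; lra.
Qed.

End ProductChain.

(** * Differential inequalities and the Euler scheme *)

Section Gronwall.
Variable R : realType.

(* The hypothesis bounds the upper right Dini derivative of f by L f, so f
   never crosses the strict supersolution f 0 exp(L t) + e exp((L + 1) t). *)
Lemma gronwall_dini (f : R -> R) (L T : R) : 0 <= L -> 0 <= f 0 ->
  (forall t e, 0 <= t <= T -> 0 < e -> exists2 d : R, 0 < d &
     forall s, 0 <= s <= T -> `|s - t| < d -> `|f s - f t| <= e /\
       (t <= s -> f s <= f t + (L * f t + e) * (s - t))) ->
  forall t, 0 <= t <= T -> f t <= f 0 * expR (L * t).
Proof.
move=> L0 f0 H t /andP[t0 tT].
apply/ler_addgt0Pr => e e0.
(* Scaled so that the term added to the supersolution equals exactly [e] at the target time [t]. *)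
pose e' := e / expR ((L + 1) * t).
have e'0 : 0 < e' by rewrite divr_gt0// expR_gt0.
pose b s := f 0 * expR (L * s) + e' * expR ((L + 1) * s).
have -> : f 0 * expR (L * t) + e = b t.
  by rewrite /b /e' divfK// gt_eqF// expR_gt0.
have bmono x y : x <= y -> b x <= b y.
  move=> xy; apply: lerD; rewrite ler_wpM2l// ?(ltW e'0)// ler_expR ler_wpM2l//.
  by rewrite addr_ge0.
have btan x y : 0 <= x -> x <= y -> b x + (L * b x + e') * (y - x) <= b y.
  move=> x0 xy.
  have h1 := expR_tangent (L * y) (L * x).
  have h2 := expR_tangent ((L + 1) * y) ((L + 1) * x).
  have h3 : 1 <= expR ((L + 1) * x).
    by rewrite -[leLHS]expR0 ler_expR mulr_ge0// addr_ge0.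
  apply: (@le_trans _ _ (f 0 * (expR (L * x) * (1 + (L * y - L * x))) +
    e' * (expR ((L + 1) * x) * (1 + ((L + 1) * y - (L + 1) * x))))).
    rewrite /b -subr_ge0.
    rewrite (_ : _ - _ = e' * (expR ((L + 1) * x) - 1) * (y - x)); last by ring.
    by rewrite !mulr_ge0 ?subr_ge0// ltW.
  by apply: lerD; rewrite ler_wpM2l// ltW.
(* Continuous induction. At the supremum [T0] of the times up to which [f] stays below [b], the
   bound persists by continuity. If [T0 < t], the one-sided estimate with error [e'] carries it
   further, because by [btan] the supersolution grows at least at the rate [L * b + e']. *)
pose A := [set x | 0 <= x <= t /\ forall s, 0 <= s <= x -> f s <= b s].
have A0 : A 0.
  split; first by rewrite lexx t0.
  move=> s; rewrite -eq_le => /eqP <-; rewrite /b !mulr0 expR0 !mulr1.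
  by rewrite lerDl ltW.
have supA : has_sup A by split; [exists 0|exists t => x [/andP[]]].
set T0 := sup A.
have T00 : 0 <= T0 by apply: (ub_le_sup supA.2 A0).
have T0t : T0 <= t by apply: ge_sup; [exists 0|move=> x [/andP[]]].
have T0T : T0 <= T := le_trans T0t tT.
have below s : 0 <= s -> s < T0 -> f s <= b s.
  move=> s0 sT0; have [x [/andP[x0 xt] xA] sx] := sup_gt (ex_intro _ 0 A0) sT0.
  by apply: xA; rewrite s0 ltW.
have atT0 : f T0 <= b T0.
  have [->|T0n] := eqVneq T0 0; first by apply: A0.2; rewrite !lexx.
  have T0p : 0 < T0 by rewrite lt_neqAle eq_sym T0n.
  apply/ler_addgt0Pr => k k0.
  have [|d d0 Hd] := H T0 k _ k0; first by rewrite T00.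
  pose s := Num.max 0 (T0 - d / 2).
  have s0 : 0 <= s by rewrite le_max lexx.
  have sT0 : s < T0 by rewrite gt_max T0p/= ltrBlDr ltrDl divr_gt0.
  have [|| + _] := Hd s.
  - by rewrite s0 (le_trans (ltW sT0)).
  - rewrite ltr0_norm ?subr_lt0// opprB ltrBlDr.
    have : T0 - d / 2 <= s by rewrite le_max lexx orbT.
    by lra.
  rewrite distrC => /(le_trans (ler_norm _)) hk.
  have := below s s0 sT0; have := bmono s T0 (ltW sT0); lra.
have AT0 s : 0 <= s <= T0 -> f s <= b s.
  by move=> /andP[s0]; rewrite le_eqVlt => /predU1P[->//|]; exact: below.
have [T0lt|] := ltP T0 t; last first.
  by move=> tT0; apply: AT0; rewrite t0.
have [|d d0 Hd] := H T0 e' _ e'0; first by rewrite T00.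
pose x := Num.min t (T0 + d / 2).
have T0x : T0 < x by rewrite lt_min T0lt ltrDl divr_gt0.
have xt : x <= t by rewrite ge_min lexx.
have xd : x <= T0 + d / 2 by rewrite ge_min lexx orbT.
have : A x.
  split; first by rewrite xt (le_trans T00 (ltW T0x)).
  move=> s /andP[s0 sx]; have [sT0|sT0] := leP s T0.
    by apply: AT0; rewrite s0.
  have [|| _ +] := Hd s.
  - by rewrite s0 (le_trans sx)// (le_trans xt).
  - by rewrite gtr0_norm ?subr_gt0//; lra.
  move=> /(_ (ltW sT0)) fs; apply: (le_trans fs).
  apply: le_trans (btan _ _ T00 (ltW sT0)).
  by apply: lerD => //; rewrite ler_wpM2r ?subr_ge0 ?(ltW sT0)// lerD2r ler_wpM2l.
by move=> /(ub_le_sup supA.2); rewrite leNgt T0x.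
Qed.

End Gronwall.

Section Dyadic.
Variable R : realType.

Definition hstep (n : nat) : R := (2^-1) ^+ n.

Lemma hstep_gt0 n : 0 < hstep n.
Proof. by rewrite exprn_gt0. Qed.

Lemma hstepS n : hstep n.+1 = hstep n / 2.
Proof. by rewrite /hstep exprSr. Qed.

Lemma hstep_le1 n : hstep n <= 1.
Proof. by rewrite exprn_ile1// invf_le1// ler1n. Qed.

Lemma hstep_decr n m : (n <= m)%N -> hstep m <= hstep n.
Proof. by move=> nm; rewrite /hstep ler_wiXn2l// invf_le1// ler1n. Qed.

Lemma le_hstep (x y C : R) : (forall n, x <= y + C * hstep n) -> x <= y.
Proof.
move=> H; rewrite leNgt; apply/negP => yx.
have C0 : 0 < C by have := H 0%N; rewrite /hstep expr0 mulr1; lra.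
have e0 : 0 < (x - y) / C by rewrite divr_gt0// subr_gt0.
pose n := Num.bound ((x - y) / C)^-1.
have n2 : (x - y)/C * 2 ^+ n > 1.
  rewrite -ltr_pdivrMl// mulr1.
  apply: lt_le_trans (archi_boundP _) _; first by rewrite invr_ge0 ltW.
  by rewrite -natrX ler_nat ltnW// ltn_expl.
have := H n; rewrite /hstep exprVn.
move: n2; rewrite mulrAC ltr_pdivlMr// mul1r => n2.
rewrite -lerBlDl ler_pdivlMr ?exprn_gt0//; lra.
Qed.

(** The tail of the series after [n] sums to [2 * C * hstep n], so the intervals of this radius
    around [a n] are nested; the supremum of their lower ends lies in all of them. *)
Lemma geometric_limit (a : nat -> R) (C : R) :
  (forall n, `|a n - a n.+1| <= C * hstep n) ->
  exists l, forall n, `|a n - l| <= 2 * C * hstep n.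
Proof.
move=> H.
have C0 : 0 <= C.
  by have := le_trans (normr_ge0 _) (H 0%N); rewrite /hstep expr0 mulr1.
have h0 n := ltW (hstep_gt0 n).
have Ch n : 0 <= C * hstep n by rewrite mulr_ge0.
pose b n := a n - 2 * C * hstep n; pose c n := a n + 2 * C * hstep n.
have bS n : b n <= b n.+1.
  by have := H n; rewrite ler_norml => /andP[_]; rewrite /b hstepS; lra.
have cS n : c n.+1 <= c n.
  by have := H n; rewrite ler_norml => /andP[+ _]; rewrite /c hstepS; lra.
have bm : {homo b : n m / (n <= m)%N >-> n <= m}.
  by apply: homo_leq => // x y z; exact: le_trans.
have cm : forall n m, (n <= m)%N -> c m <= c n.
  move=> n m /subnK <-; elim: (m - n)%N => // k IH.
  by rewrite addSn; exact: le_trans (cS _) IH.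
have bc m n : b m <= c n.
  apply: (@le_trans _ _ (b (maxn m n))); first by rewrite bm// leq_maxl.
  apply: (@le_trans _ _ (c (maxn m n))); last by rewrite cm// leq_maxr.
  by rewrite /b /c; have := Ch (maxn m n); lra.
pose A := range b.
have hA : has_sup A by split; [exists (b 0%N), 0%N|exists (c 0%N) => _ [m _ <-]].
exists (sup A) => n.
have h1 : b n <= sup A by apply: (ub_le_sup hA.2); exists n.
have h2 : sup A <= c n by apply: ge_sup hA.1 _ => _ [m _ <-].
by rewrite ler_norml; move: h1 h2; rewrite /b /c; lra.
Qed.

End Dyadic.

(** * Dyadic Euler scheme for Lipschitz fields on functions over an arbitrary index set *)

Section Euler.
Variables (R : realType) (I : Type) (W : (I -> R) -> Prop).
Variables (F : (I -> R) -> (I -> R)) (K L : R).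
Hypotheses (K0 : 0 <= K) (L0 : 0 <= L).
Hypothesis FK : forall v, W v -> forall i, `|F v i| <= K.
Hypothesis FL : forall v w (d : R), W v -> W w -> 0 <= d ->
  (forall i, `|v i - w i| <= d) -> forall i, `|F v i - F w i| <= L * d.
Hypothesis WS : forall v (h : R), W v -> 0 <= h -> W (fun i => v i + h * F v i).
Hypothesis WC : forall (vn : nat -> I -> R) v C, (forall n, W (vn n)) ->
  (forall n i, `|vn n i - v i| <= C * hstep R n) -> W v.

Section Scheme.
Variable u0 : I -> R.
Hypothesis W0 : W u0.

Let h n := hstep R n.

Let E n k := iter k (fun v i => v i + h n * F v i) u0.

Let h_ge0 n : 0 <= h n. Proof. exact/ltW/hstep_gt0. Qed.

Let E_W n k : W (E n k).
Proof. by elim: k => //= k IH; apply: WS. Qed.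

Let E_lip n k m i : `|E n (k + m) i - E n k i| <= m%:R * h n * K.
Proof.
elim: m => [|m IH]; first by rewrite addn0 subrr normr0 !mul0r.
rewrite addnS /= -/(E n (k + m)).
have -> : E n (k + m) i + h n * F (E n (k + m)) i - E n k i =
  (E n (k + m) i - E n k i) + h n * F (E n (k + m)) i by ring.
apply: (le_trans (ler_normD _ _)).
have : `|h n * F (E n (k + m)) i| <= h n * K.
  by rewrite normrM ger0_norm// ler_wpM2l// FK.
by rewrite -natr1; lra.
Qed.

(** During [m] steps the iterate moves by at most [m h K], so the field changes by at most [L] times
    that. The bound does not depend on [h] separately, hence survives the limit and becomes the
    differentiability of the solution. *)
Let E_quad n k m i :
  `|E n (k + m) i - E n k i - m%:R * h n * F (E n k) i|
    <= L * K * (m%:R * h n) ^+ 2.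
Proof.
elim: m => [|m IH].
  by rewrite addn0 subrr !mul0r subrr normr0 expr0n mulr0.
rewrite addnS /= -/(E n (k + m)).
have -> : E n (k + m) i + h n * F (E n (k + m)) i - E n k i -
    m.+1%:R * h n * F (E n k) i =
  (E n (k + m) i - E n k i - m%:R * h n * F (E n k) i) +
    h n * (F (E n (k + m)) i - F (E n k) i) by rewrite -natr1; ring.
apply: (le_trans (ler_normD _ _)).
have mK : 0 <= m%:R * h n * K by rewrite !mulr_ge0.
have := FL (E_W n (k + m)) (E_W n k) mK (E_lip n k m) i.
move=> /(ler_wpM2l (h_ge0 n)) HH.
have : `|h n * (F (E n (k + m)) i - F (E n k) i)| <= h n * (L * (m%:R * h n * K)).
  by rewrite normrM (ger0_norm (h_ge0 n)).
move: IH => /[swap] H1 IH; apply: (le_trans (lerD IH H1)).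
rewrite -natr1 -subr_ge0.
rewrite (_ : _ - _ = L * K * (h n) ^+ 2 * (m%:R + 1)); last by ring.
by rewrite !mulr_ge0 ?sqr_ge0.
Qed.

(** A discrete Gronwall argument: by [E_quad] with [m = 2], two half-steps differ from one full step
    by [L * K * h ^ 2], and every later step multiplies the accumulated difference by at most
    [1 + L * h]. *)
Let E_cmp n k i : `|E n k i - E n.+1 (k.*2) i|
  <= L * K * h n ^+ 2 * k%:R * (1 + L * h n) ^+ k.
Proof.
elim: k i => [|k IH] i; first by rewrite subrr normr0 mulr0 mul0r.
rewrite doubleS -addn2.
set w := E n.+1 k.*2.
have h2 : 2%:R * h n.+1 = h n by rewrite /h hstepS; field.
have := E_quad n.+1 k.*2 2 i; rewrite h2 -/w => H1.
set d := L * K * h n ^+ 2 * k%:R * (1 + L * h n) ^+ k in IH.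
have Lh0 : 0 <= L * h n by rewrite mulr_ge0.
have d0 : 0 <= d by rewrite !mulr_ge0 ?sqr_ge0// exprn_ge0// addr_ge0.
have H2 := FL (E_W n k) (E_W n.+1 k.*2) d0 IH i.
rewrite /= -/(E n k).
have -> : E n k i + h n * F (E n k) i - E n.+1 (k.*2 + 2) i =
  (E n k i - w i) + h n * (F (E n k) i - F w i)
  - (E n.+1 (k.*2 + 2) i - w i - h n * F w i) by ring.
apply: (le_trans (ler_normB _ _)).
apply: (@le_trans _ _ (d + h n * (L * d) + L * K * h n ^+ 2)).
  apply: lerD => //; apply: (le_trans (ler_normD _ _)).
  apply: lerD; first exact: IH.
  by rewrite normrM (ger0_norm (h_ge0 n)) ler_wpM2l.
rewrite (exprSr _ k) -natr1.
have p1 : 1 <= (1 + L * h n) ^+ k * (1 + L * h n).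
  by rewrite -exprSr exprn_ege1// lerDl.
have c0 : 0 <= L * K * h n ^+ 2 by rewrite !mulr_ge0 ?sqr_ge0.
rewrite /d; set c := L * K * h n ^+ 2 in c0 *; set p := (1 + L * h n) ^+ k in p1 *.
rewrite -subr_ge0 (_ : _ - _ = c * (p * (1 + L * h n) - 1)); last by ring.
by rewrite mulr_ge0// subr_ge0.
Qed.

Variable T : R.
Hypothesis T0 : 0 <= T.

Let N n (t : R) : nat := Num.truncn (t * 2 ^+ n).

Let N_itv n (t : R) : 0 <= t -> (N n t)%:R * h n <= t < (N n t)%:R * h n + h n.
Proof.
move=> t0; have := @truncn_itv R (t * 2 ^+ n).
rewrite -/(N n t) mulr_ge0 ?exprn_ge0// => /(_ isT).
rewrite -[X in _ < X]natr1 -ler_pdivrMr ?exprn_gt0// -ltr_pdivlMr ?exprn_gt0//.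
by rewrite /h /hstep exprVn mulrDl mul1r.
Qed.

Let N_mono n (s t : R) : 0 <= s -> s <= t -> (N n s <= N n t)%N.
Proof. by move=> s0 st; apply: le_truncn; rewrite ler_pM2r ?exprn_gt0. Qed.

Let N_double n (t : R) : 0 <= t -> (N n.+1 t = (N n t).*2 \/ N n.+1 t = (N n t).*2 + 1)%N.
Proof.
move=> t0.
have /andP[h1 h2] := N_itv n t0; have /andP[h3 h4] := N_itv n.+1 t0.
have hh : h n = h n.+1 * 2 by rewrite /h hstepS; field.
have hp : 0 < h n.+1 by exact: hstep_gt0.
have l1 : ((N n t).*2 < (N n.+1 t) + 1)%N.
  rewrite -(ltr_nat R) -muln2 natrM natrD -(ltr_pM2r hp).
  by move: h1 h2; rewrite hh; lra.
have l2 : (N n.+1 t < (N n t).*2 + 2)%N.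
  rewrite -(ltr_nat R) natrD -muln2 natrM -(ltr_pM2r hp).
  by move: h1 h2; rewrite hh; lra.
move: l1 l2; rewrite addn1 ltnS addn2 ltnS => l1.
rewrite leq_eqVlt ltnS => /predU1P[->|l2]; first by right; rewrite addn1.
by left; apply/eqP; rewrite eqn_leq l1 l2.
Qed.

(** The first summand bounds the accumulated difference of [E_cmp] for [k h <= T]; the summand [K]
    pays for the odd half-step that may fit before [t] when the step is halved ([N_double]). *)
Let C2 := L * K * T * expR (L * T) + K.

Let C20 : 0 <= C2.
Proof. by rewrite addr_ge0// !mulr_ge0// expR_ge0. Qed.

Let E_step n (t : R) i : 0 <= t <= T ->
  `|E n (N n t) i - E n.+1 (N n.+1 t) i| <= C2 * h n.
Proof.
move=> /andP[t0 tT]; set k := N n t.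
have kT : k%:R * h n <= T.
  by have /andP[+ _] := N_itv n t0; rewrite -/k => /le_trans; apply.
have H1 : `|E n k i - E n.+1 k.*2 i| <= L * K * T * expR (L * T) * h n.
  apply: (le_trans (E_cmp n k i)).
  have -> : L * K * h n ^+ 2 * k%:R * (1 + L * h n) ^+ k =
    (L * K * h n) * (k%:R * h n * (1 + L * h n) ^+ k) by ring.
  have -> : L * K * T * expR (L * T) * h n = (L * K * h n) * (T * expR (L * T)).
    by ring.
  rewrite ler_wpM2l ?mulr_ge0//.
  rewrite ler_pM ?mulr_ge0 ?exprn_ge0 ?addr_ge0 ?mulr_ge0//.
  apply: (@le_trans _ _ (expR (L * h n) ^+ k)).
    by rewrite lerXn2r ?nnegrE ?expR_ge0 ?expR_ge1Dx// addr_ge0 ?mulr_ge0.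
  by rewrite -expRM_natl ler_expR mulrCA ler_wpM2l// mulrC.
have H2 : `|E n.+1 k.*2 i - E n.+1 (N n.+1 t) i| <= K * h n.
  have Kh : 0 <= K * h n by rewrite mulr_ge0.
  have [->|->] := N_double n t0; first by rewrite subrr normr0.
  rewrite distrC; apply: (le_trans (E_lip _ _ _ _)); rewrite mul1r.
  by rewrite /h hstepS mulrC ler_wpM2l// ler_pdivrMr// ler_peMr ?h_ge0// ler1n.
have -> : E n k i - E n.+1 (N n.+1 t) i =
  (E n k i - E n.+1 k.*2 i) + (E n.+1 k.*2 i - E n.+1 (N n.+1 t) i) by ring.
by rewrite /C2 mulrDl; apply: (le_trans (ler_normD _ _)); apply: lerD.
Qed.

Let u (t : R) i : R := xget 0 [set l | forall n, `|E n (N n t) i - l| <= 2 * C2 * h n].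

Let u_near n (t : R) i : 0 <= t <= T -> `|E n (N n t) i - u t i| <= 2 * C2 * h n.
Proof.
move=> tT.
have [l Hl] := geometric_limit (fun n => E_step n i tT).
exact: (xgetI (P := [set l | forall n, `|E n (N n t) i - l| <= 2 * C2 * h n]) 0 Hl).
Qed.

Let u_W (t : R) : 0 <= t <= T -> W (u t).
Proof.
move=> tT; apply: (WC (vn := fun n => E n (N n t)) (C := 2 * C2)) => // n i.
exact: u_near.
Qed.

Let u_fwd (t s : R) i : 0 <= t -> t <= s -> s <= T ->
  `|u s i - u t i - (s - t) * F (u t) i| <= L * K * (s - t) ^+ 2.
Proof.
move=> t0 ts sT.
have s0 := le_trans t0 ts; have tT := le_trans ts sT.
have tt : 0 <= t <= T by rewrite t0.
have ss : 0 <= s <= T by rewrite s0.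
(* The errors of first order in [h n], collected: [L * K * (2 * T + 1)] for replacing [(m h) ^ 2] by
   [(s - t) ^ 2], [4 * C2] for the two limits, [K] for replacing [m h] by [s - t] in front of the
   field, and [2 * L * C2 * T] for evaluating the field at the limit. *)
apply: (@le_hstep R _ _ (L * K * (2 * T + 1) + 4 * C2 + K + 2 * L * C2 * T)) => n.
rewrite -/(h n).
have hn1 : h n <= 1 := hstep_le1 R n.
have NN := N_mono n t0 ts.
set m := (N n s - N n t)%N.
have NE : (N n t + m = N n s)%N by rewrite subnKC.
have := E_quad n (N n t) m i; rewrite NE.
have := u_near n i tt; have := u_near n i ss.
have FF : `|F (E n (N n t)) i - F (u t) i| <= L * (2 * C2 * h n).
  apply: FL => //; first exact: u_W.
    by rewrite !mulr_ge0.
  by move=> j; exact: u_near.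
have FKn := FK (E_W n (N n t)) i.
have mh1 : `|m%:R * h n - (s - t)| <= h n.
  have /andP[h1 h2] := N_itv n t0; have /andP[h3 h4] := N_itv n s0.
  have : (N n t)%:R + m%:R = (N n s)%:R :> R by rewrite -natrD NE.
  move=> /(congr1 (fun z => z * h n)); rewrite mulrDl ler_norml => e.
  lra.
set mh := m%:R * h n in mh1 *.
set a := E n (N n s) i; set b := E n (N n t) i; set f := F (E n (N n t)) i in FF FKn *.
move=> H1 H2 H3.
have -> : u s i - u t i - (s - t) * F (u t) i =
  (a - b - mh * f) - (a - u s i) + (b - u t i)
  + ((mh - (s - t)) * f) + (s - t) * (f - F (u t) i) by ring.
have n1 : `|(mh - (s - t)) * f| <= h n * K by rewrite normrM ler_pM.
have n2 : `|(s - t) * (f - F (u t) i)| <= T * (L * (2 * C2 * h n)).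
  rewrite normrM ger0_norm ?subr_ge0// ler_pM ?subr_ge0//.
  by rewrite lerBlDr ler_wpDr.
have n3 : L * K * mh ^+ 2 <= L * K * ((s - t) ^+ 2 + (2 * T + 1) * h n).
  rewrite ler_wpM2l ?mulr_ge0//.
  have mh0 : 0 <= mh by rewrite /mh mulr_ge0.
  move: mh1; rewrite ler_norml => /andP[_ q].
  have : mh ^+ 2 <= (s - t + h n) ^+ 2.
    have q' : mh <= s - t + h n by lra.
    by rewrite !expr2 ler_pM.
  move/le_trans; apply.
  have := h_ge0 n; nra.
apply: (le_trans (ler_normD _ _)); apply: (le_trans (lerD (ler_normD _ _) n2)).
have n4 := ler_normB (a - b - mh * f) (a - u s i).
have n5 := ler_normD (a - b - mh * f - (a - u s i)) (b - u t i).
lra.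
Qed.

Lemma euler : exists u : R -> I -> R,
  [/\ u 0 = u0, forall t, 0 <= t <= T -> W (u t),
      forall t s i, 0 <= t <= T -> 0 <= s <= T ->
        `|u s i - u t i| <= (K + L * K * T) * `|s - t|
    & forall t s i, 0 <= t <= T -> 0 <= s <= T ->
        `|u s i - u t i - (s - t) * F (u t) i|
          <= (2 + L * T) * L * K * (s - t) ^+ 2].
Proof.
have lip t s i : 0 <= t -> t <= s -> s <= T ->
    `|u s i - u t i| <= (K + L * K * T) * (s - t).
  move=> t0 ts sT; have := u_fwd i t0 ts sT.
  have tt : 0 <= t <= T by rewrite t0 (le_trans ts).
  have := FK (u_W tt) i => h1 h2.
  have -> : u s i - u t i =
    (u s i - u t i - (s - t) * F (u t) i) + (s - t) * F (u t) i by ring.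
  have h3 : `|(s - t) * F (u t) i| <= (s - t) * K.
    by rewrite normrM ger0_norm ?subr_ge0// ler_wpM2l ?subr_ge0.
  apply: (le_trans (ler_normD _ _)); apply: (le_trans (lerD h2 h3)).
  have h4 : L * K * (s - t) * (s - t) <= L * K * (s - t) * T.
    by rewrite ler_wpM2l ?mulr_ge0 ?subr_ge0//; lra.
  by move: h4; rewrite expr2; lra.
exists u; split => //.
- apply/funext => i; apply/eqP; rewrite -subr_eq0 -normr_le0.
  apply: (@le_hstep R _ _ (2 * C2)) => n; rewrite add0r distrC.
  have := u_near n i (t := 0); rewrite lexx T0 => /(_ isT).
  by rewrite /N mul0r truncn0.
- move=> t s i /andP[t0 tT] /andP[s0 sT]; have [ts|/ltW st] := leP t s.
    by rewrite (@ger0_norm _ (s - t)) ?subr_ge0// lip.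
  by rewrite distrC (distrC s) (@ger0_norm _ (t - s)) ?subr_ge0// lip.
- move=> t s i /andP[t0 tT] /andP[s0 sT]; have [ts|/ltW st] := leP t s.
    apply: (le_trans (u_fwd i t0 ts sT)).
    have -> : (2 + L * T) * L * K * (s - t) ^+ 2 = L * K * (s - t) ^+ 2 +
      (1 + L * T) * (L * K * (s - t) ^+ 2) by ring.
    rewrite lerDl; apply: mulr_ge0; first by rewrite addr_ge0// mulr_ge0.
    by apply: mulr_ge0; [exact: mulr_ge0|exact: sqr_ge0].
  (* Backward in time the expansion is available at [s]. Moving the field from [u s] to [u t] costs
     [L] times the Lipschitz constant [K + L * K * T] of the curve, which gives the factor
     [2 + L * T]. *)
  have h1 := u_fwd i s0 st tT.
  have KT0 : 0 <= K + L * K * T by rewrite addr_ge0// !mulr_ge0.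
  have h2 : `|F (u s) i - F (u t) i| <= L * ((K + L * K * T) * (t - s)).
    apply: FL; [by apply: u_W; rewrite s0|by apply: u_W; rewrite t0| |].
      by rewrite mulr_ge0 ?subr_ge0.
    by move=> j; rewrite distrC lip.
  have -> : u s i - u t i - (s - t) * F (u t) i =
    - (u t i - u s i - (t - s) * F (u s) i) - (t - s) * (F (u s) i - F (u t) i).
    by ring.
  apply: (le_trans (ler_normB _ _)); rewrite normrN normrM.
  rewrite (@ger0_norm _ (t - s)) ?subr_ge0//.
  have h3 : 0 <= t - s by rewrite subr_ge0.
  have h4 := ler_wpM2l h3 h2.
  apply: (le_trans (lerD h1 h4)); rewrite le_eqVlt; apply/orP; left; apply/eqP; ring.
Qed.

End Scheme.
End Euler.

(** * The kernels of P and Q *)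

Section Kernels.
Variable R : realType.
Local Notation mu := (@lebesgue_measure R).
Implicit Types (y d p : R -> R) (a b xi : R).

Definition Jint y d xi a b : R := itg a b (fun t => expR (y xi - y t) * d t).

(** Half of the factor in front of the [cosh] and [sinh] integrals, since each of these functions
    carries a division by 2. *)
Definition kap : R := (4 * (expR 1 - 1))^-1.

(* kP and kQ are P and Q with the cosh, sinh and sgn kernels resolved into
   the two exponentials exp(y xi - y t) and exp(y t - y xi). *)
Definition kP y d xi : R :=
  kap * (Jint y d xi 0 1 + Jint (fun t : R => - y t) d xi 0 1) +
  4^-1 * (Jint (fun t : R => - y t) d xi 0 xi + Jint y d xi xi 1).
Definition kQ y d xi : R :=
  kap * (Jint y d xi 0 1 - Jint (fun t : R => - y t) d xi 0 1) -
  4^-1 * (Jint (fun t : R => - y t) d xi 0 xi - Jint y d xi xi 1).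

Lemma expR1_ge2 : 2 <= expR 1 :> R.
Proof. by have := expR_ge1Dx (1 : R); rewrite -natr1. Qed.

Lemma kap_itv : 0 <= kap <= 4^-1.
Proof.
have e2 := expR1_ge2.
rewrite /kap invr_ge0 mulr_ge0 ?subr_ge0//=; last by apply: le_trans e2; rewrite ler1n.
by rewrite lef_pV2 ?posrE//; lra.
Qed.

(** The four weights sum to at most 1, because [kap <= 1/4]. So [kP] and [kQ] inherit any bound
    valid for the single integrals [Jint], for sizes as well as for differences. *)
Lemma abs_comb (k X a b c d : R) : 0 <= k <= 4^-1 ->
  `|a| <= X -> `|b| <= X -> `|c| <= X -> `|d| <= X ->
  `|k * (a + b) + 4^-1 * (c + d)| <= X.
Proof.
move=> /andP[k0 k4] aX bX cX dX.
have ab := le_trans (ler_normD a b) (lerD aX bX).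
have cd := le_trans (ler_normD c d) (lerD cX dX).
apply: (le_trans (ler_normD _ _)); rewrite !normrM (ger0_norm k0).
rewrite (@ger0_norm _ 4^-1) ?invr_ge0//.
have X0 := le_trans (normr_ge0 _) aX.
have : k * `|a + b| <= 4^-1 * (X + X) by rewrite ler_pM.
by lra.
Qed.

Lemma integ_expM y d : {within `[0, 1], continuous y} -> integ 0 1 d ->
  integ 0 1 (fun t => expR (y t) * d t).
Proof.
move=> cy di; apply: integ_cM => //.
by move=> x; apply: continuous_comp; [exact: cy|exact: continuous_expR].
Qed.

Lemma within_contN y : {within `[0, 1], continuous y} ->
  {within `[0, 1], continuous (fun t : R => - y t)}.
Proof. by move=> cy x; apply: cvgN; exact: cy. Qed.

Lemma integ_Jint y d xi : {within `[0, 1], continuous y} -> integ 0 1 d ->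
  integ 0 1 (fun t => expR (y xi - y t) * d t).
Proof.
move=> /within_contN cy di.
by apply: eq_integ (integZ (expR (y xi)) (integ_expM cy di)) => t _;
  rewrite expRD mulrA.
Qed.

Lemma JintE y d xi a b : {within `[0, 1], continuous y} -> integ 0 1 d ->
  0 <= a -> b <= 1 ->
  Jint y d xi a b = expR (y xi) * itg a b (fun t => expR (- y t) * d t).
Proof.
move=> /within_contN cy di a0 b1.
rewrite -itgZ; last exact: integS (integ_expM cy di).
by apply: eq_itg => t _; rewrite expRD mulrA.
Qed.

Section Fixed.
Variables y d : R -> R.
Hypothesis cy : {within `[0, 1], continuous y}.
Hypothesis di : integ 0 1 d.

Let cyN := within_contN cy.
Let iE := integ_expM cy di.
Let iEN := integ_expM cyN di.

Let A x := itg 0 x (fun t => expR (y t) * d t).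
Let B x := itg 0 x (fun t => expR (- y t) * d t).

Let BE x : 0 <= x <= 1 -> itg x 1 (fun t => expR (- y t) * d t) = B 1 - B x.
Proof.
by move=> /andP[x0 x1]; rewrite /B (@itg_cat _ x 0 1)//; ring.
Qed.

Let JNE xi a b : 0 <= a -> b <= 1 -> Jint (fun t : R => - y t) d xi a b =
  expR (- y xi) * itg a b (fun t => expR (y t) * d t).
Proof.
move=> a0 b1; rewrite (JintE xi cyN di a0 b1); congr (_ * _).
by apply: eq_itg => t _; rewrite opprK.
Qed.

Let kPE x : 0 <= x <= 1 -> kP y d x =
  kap * (expR (y x) * B 1 + expR (- y x) * A 1) +
  4^-1 * (expR (- y x) * A x + expR (y x) * (B 1 - B x)).
Proof.
by move=> x01; have /andP[x0 x1] := x01; rewrite /kP !JNE// !(JintE _ cy)// -BE.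
Qed.

Let kQE x : 0 <= x <= 1 -> kQ y d x =
  kap * (expR (y x) * B 1 - expR (- y x) * A 1) -
  4^-1 * (expR (- y x) * A x - expR (y x) * (B 1 - B x)).
Proof.
by move=> x01; have /andP[x0 x1] := x01; rewrite /kQ !JNE// !(JintE _ cy)// -BE.
Qed.

(** From 0 to 1 the factor [exp y] gains e, while the quarter-weighted part passes from
    [exp y * B 1] to [exp (- y) * A 1]. The two effects cancel because [kap * (e - 1) = 1/4]; the
    same identity closes [kP_per]. *)
Lemma kQ_per : y 1 = y 0 + 1 -> kQ y d 1 = kQ y d 0.
Proof.
move=> y1; rewrite !kQE ?lexx ?ler01//.
have -> : A 0 = 0 by rewrite /A itgs.
have -> : B 0 = 0 by rewrite /B itgs.
rewrite y1 opprD !expRD !(expRN 1) /kap; have e2 := expR1_ge2.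
have e0 : expR 1 != 0 :> R by rewrite gt_eqF ?expR_gt0.
have e1 : expR 1 - 1 != 0 :> R by rewrite gt_eqF//; lra.
by field; rewrite ?e0 ?e1.
Qed.

Lemma kP_per : y 1 = y 0 + 1 -> kP y d 1 = kP y d 0.
Proof.
move=> y1; rewrite !kPE ?lexx ?ler01//.
have -> : A 0 = 0 by rewrite /A itgs.
have -> : B 0 = 0 by rewrite /B itgs.
rewrite y1 opprD !expRD !(expRN 1) /kap; have e2 := expR1_ge2.
have e0 : expR 1 != 0 :> R by rewrite gt_eqF ?expR_gt0.
have e1 : expR 1 - 1 != 0 :> R by rewrite gt_eqF//; lra.
by field; rewrite ?e0 ?e1.
Qed.

(** Differentiating the exponentials exchanges [kP] and [kQ] and produces the factor [p]. The two
    integrals with a moving end point also produce the local terms [d] and [- d]: they cancel in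
    [kP], and in [kQ] they add up to [- d / 2]. *)
Lemma prim_kP_kQ p : prim 0 1 y p ->
  prim 0 1 (kP y d) (fun x => kQ y d x * p x) /\
  prim 0 1 (kQ y d) (fun x => kP y d x * p x - 2^-1 * d x).
Proof.
move=> yp.
have pE := prim_expR ler01 yp.
have pEN := prim_expR ler01 (primN yp).
have pA : prim 0 1 A (fun t => expR (y t) * d t) by exact: prim_itg.
have pB : prim 0 1 B (fun t => expR (- y t) * d t) by exact: prim_itg.
have pB' := primB (prim_cst 0 1 (B 1)) pB.
have q1 := primM ler01 pEN pA.
have q2 := primM ler01 pE pB'.
have EE x : expR (- y x) * (expR (y x) * d x) = d x.
  by rewrite mulrA -expRD addNr expR0 mul1r.
have EE' x : expR (y x) * (0 - expR (- y x) * d x) = - d x.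
  by rewrite sub0r mulrN mulrA -expRD addrN expR0 mul1r.
split.
- apply: eq_prim (primD (primD (primZ (kap * B 1) pE) (primZ (kap * A 1) pEN))
    (primZ 4^-1 (primD q1 q2))).
    by move=> x x01 /=; rewrite kPE//; ring.
  by move=> x x01 /=; rewrite kQE// EE EE'; field.
- apply: eq_prim (primB (primB (primZ (kap * B 1) pE) (primZ (kap * A 1) pEN))
    (primZ 4^-1 (primB q1 q2))).
    by move=> x x01 /=; rewrite kQE//; ring.
  by move=> x x01 /=; rewrite kPE// EE EE'; field.
Qed.

End Fixed.

Lemma Jint_bnd (M : R) y d xi a b : {within `[0, 1], continuous y} -> integ 0 1 d ->
  (forall x t : R, 0 <= x <= 1 -> 0 <= t <= 1 -> `|y x - y t| <= M) ->
  0 <= xi <= 1 -> 0 <= a -> a <= b -> b <= 1 ->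
  `|Jint y d xi a b| <= expR M * itg 0 1 (fun t => `|d t|).
Proof.
move=> cy di My xi1 a0 ab b1; have nd := integ_norm di.
rewrite -itgZ//; apply: (@le_trans _ _ (itg a b (fun t => expR M * `|d t|))).
  apply: itg_norm_le.
  - by apply: integS (integ_Jint xi cy di).
  - by apply/integZ/(integS a0 b1 nd).
  - move=> t /andP[at' tb]; rewrite normrM ger0_norm ?expR_ge0// ler_wpM2r//.
    rewrite ler_expR (le_trans (ler_norm _))// My//.
    by rewrite (le_trans a0 at') (le_trans tb b1).
by apply: itg_sub_le => //; exact: integZ.
Qed.

Lemma Jint_lip (M D : R) y d y' d' xi a b : {within `[0, 1], continuous y} ->
  {within `[0, 1], continuous y'} -> integ 0 1 d -> integ 0 1 d' ->
  (forall x t : R, 0 <= x <= 1 -> 0 <= t <= 1 -> `|y x - y t| <= M) ->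
  (forall x t : R, 0 <= x <= 1 -> 0 <= t <= 1 -> `|y' x - y' t| <= M) ->
  (forall x : R, 0 <= x <= 1 -> `|y x - y' x| <= D) ->
  0 <= xi <= 1 -> 0 <= a -> a <= b -> b <= 1 ->
  `|Jint y d xi a b - Jint y' d' xi a b| <=
    expR M * (2 * D * itg 0 1 (fun t => `|d t|) +
              itg 0 1 (fun t => `|d t - d' t|)).
Proof.
move=> cy cy' di di' My My' yD xi1 a0 ab b1.
have nd := integ_norm di; have ndd := integ_norm (integB di di').
have D0 : 0 <= D.
  by apply: le_trans (yD 0 _) => //; rewrite lexx ler01.
pose g t := expR M * (2 * D * `|d t| + `|d t - d' t|).
have ig : integ 0 1 g by apply/integZ/integD => //; exact: integZ.
have g0 t : 0 <= g t by rewrite mulr_ge0 ?expR_ge0// addr_ge0// !mulr_ge0.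
have -> : expR M * (2 * D * itg 0 1 (fun t => `|d t|) +
    itg 0 1 (fun t => `|d t - d' t|)) = itg 0 1 g.
  rewrite /g itgZ; last by apply: integD => //; exact: integZ.
  by rewrite itgD ?itgZ//; exact: integZ.
have iJ := integ_Jint xi cy di; have iJ' := integ_Jint xi cy' di'.
rewrite /Jint -itgB; [|exact: integS iJ|exact: integS iJ'].
apply: (@le_trans _ _ (itg a b g)); last exact: itg_sub_le.
apply: itg_norm_le.
- by apply: integS (integB iJ iJ').
- exact: integS ig.
move=> t /andP[at' tb].
have t1 : 0 <= t <= 1 by rewrite (le_trans a0 at') (le_trans tb b1).
have -> : expR (y xi - y t) * d t - expR (y' xi - y' t) * d' t =
  (expR (y xi - y t) - expR (y' xi - y' t)) * d t +
  expR (y' xi - y' t) * (d t - d' t) by ring.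
apply: (le_trans (ler_normD _ _)); rewrite /g [leRHS]mulrDr; apply: lerD.
  rewrite normrM mulrA ler_wpM2r//.
  have h1 := le_trans (ler_norm _) (My xi t xi1 t1).
  have h2 := le_trans (ler_norm _) (My' xi t xi1 t1).
  apply: (le_trans (expR_lip h1 h2)); rewrite ler_wpM2l ?expR_ge0//.
  have -> : y xi - y t - (y' xi - y' t) = (y xi - y' xi) - (y t - y' t) by ring.
  apply: (le_trans (ler_normB _ _)).
  by have := yD _ xi1; have := yD _ t1; lra.
rewrite normrM ler_wpM2r// ger0_norm ?expR_ge0// ler_expR.
exact: le_trans (ler_norm _) (My' xi t xi1 t1).
Qed.

Lemma kPQ_bnd (M : R) y d xi : {within `[0, 1], continuous y} -> integ 0 1 d ->
  (forall x t : R, 0 <= x <= 1 -> 0 <= t <= 1 -> `|y x - y t| <= M) ->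
  0 <= xi <= 1 ->
  `|kP y d xi| <= expR M * itg 0 1 (fun t => `|d t|) /\
  `|kQ y d xi| <= expR M * itg 0 1 (fun t => `|d t|).
Proof.
move=> cy di My xi1.
have cyN := within_contN cy.
have MyN (x t : R) : 0 <= x <= 1 -> 0 <= t <= 1 -> `|- y x - - y t| <= M.
  by move=> x1 t1; rewrite -opprD normrN; exact: My.
have /andP[xi0 xi_1] := xi1.
have := Jint_bnd cyN di MyN xi1 (lexx 0) xi0 xi_1.
have := Jint_bnd cy di My xi1 xi0 xi_1 (lexx 1).
have := Jint_bnd cyN di MyN xi1 (lexx 0) ler01 (lexx 1).
have := Jint_bnd cy di My xi1 (lexx 0) ler01 (lexx 1).
rewrite /kP /kQ; set X := expR M * _.
set j1 := Jint y _ _ 0 _; set j2 := Jint _ _ _ 0 1; set j3 := Jint y _ _ _ _.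
set j4 := Jint _ _ _ 0 _ => h1 h2 h3 h4.
split; first exact: abs_comb kap_itv h1 h2 h4 h3.
rewrite (_ : _ - _ = kap * (j1 + - j2) + 4^-1 * (- j4 + j3)); last by ring.
by rewrite -normrN in h2; rewrite -normrN in h4; exact: abs_comb kap_itv h1 h2 h4 h3.
Qed.

Lemma kPQ_lip (M D : R) y d y' d' xi : {within `[0, 1], continuous y} ->
  {within `[0, 1], continuous y'} -> integ 0 1 d -> integ 0 1 d' ->
  (forall x t : R, 0 <= x <= 1 -> 0 <= t <= 1 -> `|y x - y t| <= M) ->
  (forall x t : R, 0 <= x <= 1 -> 0 <= t <= 1 -> `|y' x - y' t| <= M) ->
  (forall x : R, 0 <= x <= 1 -> `|y x - y' x| <= D) -> 0 <= xi <= 1 ->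
  `|kP y d xi - kP y' d' xi| <=
     expR M * (2 * D * itg 0 1 (fun t => `|d t|) +
              itg 0 1 (fun t => `|d t - d' t|)) /\
  `|kQ y d xi - kQ y' d' xi| <=
     expR M * (2 * D * itg 0 1 (fun t => `|d t|) +
              itg 0 1 (fun t => `|d t - d' t|)).
Proof.
move=> cy cy' di di' My My' yD xi1.
have cyN := within_contN cy; have cyN' := within_contN cy'.
have MyN (x t : R) : 0 <= x <= 1 -> 0 <= t <= 1 -> `|- y x - - y t| <= M.
  by move=> x1 t1; rewrite -opprD normrN; exact: My.
have MyN' (x t : R) : 0 <= x <= 1 -> 0 <= t <= 1 -> `|- y' x - - y' t| <= M.
  by move=> x1 t1; rewrite -opprD normrN; exact: My'.
have yDN (x : R) : 0 <= x <= 1 -> `|- y x - - y' x| <= D.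
  by move=> x1; rewrite -opprD normrN; exact: yD.
have /andP[xi0 xi_1] := xi1.
have := Jint_lip cyN cyN' di di' MyN MyN' yDN xi1 (lexx 0) xi0 xi_1.
have := Jint_lip cy cy' di di' My My' yD xi1 xi0 xi_1 (lexx 1).
have := Jint_lip cyN cyN' di di' MyN MyN' yDN xi1 (lexx 0) ler01 (lexx 1).
have := Jint_lip cy cy' di di' My My' yD xi1 (lexx 0) ler01 (lexx 1).
rewrite /kP /kQ; set X := expR M * _.
set j1 := Jint y _ _ 0 _; set j2 := Jint _ d _ 0 1; set j3 := Jint y _ _ _ _.
set j4 := Jint _ d _ 0 _.
set i1 := Jint y' _ _ 0 _; set i2 := Jint _ d' _ 0 1; set i3 := Jint y' _ _ _ _.
set i4 := Jint _ d' _ 0 _ => h1 h2 h3 h4.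
split.
  have -> : kap * (j1 + j2) + 4^-1 * (j4 + j3) - (kap * (i1 + i2) + 4^-1 * (i4 + i3))
    = kap * ((j1 - i1) + (j2 - i2)) + 4^-1 * ((j4 - i4) + (j3 - i3)) by ring.
  exact: abs_comb kap_itv h1 h2 h4 h3.
have -> : kap * (j1 - j2) - 4^-1 * (j4 - j3) - (kap * (i1 - i2) - 4^-1 * (i4 - i3))
  = kap * ((j1 - i1) + - (j2 - i2)) + 4^-1 * (- (j4 - i4) + (j3 - i3)) by ring.
by rewrite -normrN in h2; rewrite -normrN in h4; exact: abs_comb kap_itv h1 h2 h4 h3.
Qed.

End Kernels.

Section KernelsDefs.
Variable R : realType.
Local Notation mu := (@lebesgue_measure R).

Lemma ae_neq (a : R) : {ae mu, forall x, x != a}.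
Proof.
exists [set a]; split => //; first exact: lebesgue_measure_set1.
by move=> x /= /negP; rewrite negbK => /eqP.
Qed.

Lemma eq_itg_open (a b : R) f g : integ a b f -> integ a b g ->
  (forall x, a < x < b -> f x = g x) -> itg a b f = itg a b g.
Proof.
move=> fi gi fg; apply: itg_ae => //.
apply: (ae_imp2 (ae_neq a) (ae_neq b)) => x xa xb /andP[ax bx].
by apply: fg; rewrite !lt_neqAle eq_sym xa xb ax bx.
Qed.

Lemma measurable_sg (xi : R) (D : set R) :
  measurable_fun D (fun t : R => Num.sg (xi - t)).
Proof.
have -> : (fun t : R => Num.sg (xi - t)) =
    (fun t => if t == xi then 0 else if xi < t then -1 else 1).
  apply/funext => t; rewrite -[RHS]/(if _ then _ else _).
  case: eqVneq => [->|txi]; first by rewrite subrr sgr0.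
  by case: ltP => h; [rewrite ltr0_sg ?subr_lt0|
    rewrite gtr0_sg ?subr_gt0// lt_neqAle txi].
apply: (@measurable_funS _ _ _ _ setT) => //.
apply: measurable_fun_ifT => //; first exact: measurable_fun_eqr.
apply: measurable_fun_ifT => //; exact: measurable_fun_ltr.
Qed.

Lemma P01_kP (X : state R) xi : {within `[0, 1], continuous (sy X)} ->
  integ 0 1 (density X) -> 0 <= xi <= 1 ->
  P01 X xi = kP (sy X) (density X) xi.
Proof.
move=> cy di /andP[xi0 xi1]; rewrite /P01 /kP.
have cyN := within_contN cy.
set y := sy X in cy cyN *; set d := density X in di *.
have J1 := integ_Jint xi cy di; have J2 := integ_Jint xi cyN di.
congr (_ + _).
  have -> : \int[mu]_(theta in `[0, 1]) (cosh (y xi - y theta) * d theta) =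
    itg 0 1 (fun t => 2^-1 * (expR (y xi - y t) * d t + expR (- y xi - - y t) * d t)).
    by apply: eq_itg => t _; rewrite /cosh opprD; field.
  rewrite itgZ; last exact: integD.
  rewrite itgD// /kap /Jint; have := expR1_ge2 R.
  move: (itg 0 1 _) (itg 0 1 _) (expR 1) => I1 I2 E e2; clear -e2.
  by field; rewrite gt_eqF//; lra.
congr (_ * _).
have E1 t : xi < t -> expR (- Num.sg (xi - t) * (y xi - y t)) = expR (y xi - y t).
  by move=> h; rewrite ltr0_sg ?subr_lt0// opprK mul1r.
have E2 t : t < xi -> expR (- Num.sg (xi - t) * (y xi - y t)) = expR (- y xi - - y t).
  by move=> h; rewrite gtr0_sg ?subr_gt0// mulN1r opprD.
have E3 : expR (- Num.sg (xi - xi) * (y xi - y xi)) = expR (- y xi - - y xi).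
  by rewrite !subrr mulr0.
have sg1 t : `|Num.sg (xi - t)| <= 1 by rewrite normr_sg; case: (_ != _).
set f := fun t => expR (- Num.sg (xi - t) * (y xi - y t)) * d t.
have fi : integ 0 1 f.
  (* These are the indicators of [t < xi] and [t > xi], with value 1/2 at [t = xi], where both
     exponentials are 1. They write the [sgn] kernel as a bounded measurable combination of the two
     integrable ones. *)
  pose c1 t := 2^-1 * (1 + Num.sg (xi - t)); pose c2 t := 2^-1 * (1 - Num.sg (xi - t)).
  have mc1 : measurable_fun (`[0, 1] : set R) c1.
    by apply: measurable_funM => //; apply: measurable_funD => //; exact: measurable_sg.
  have mc2 : measurable_fun (`[0, 1] : set R) c2.
    by apply: measurable_funM => //; apply: measurable_funB => //; exact: measurable_sg.
  have bc1 t : 0 <= t <= 1 -> `|c1 t| <= 1.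
    move=> _; have := sg1 t; rewrite /c1 !ler_norml; lra.
  have bc2 t : 0 <= t <= 1 -> `|c2 t| <= 1.
    move=> _; have := sg1 t; rewrite /c2 !ler_norml; lra.
  apply: eq_integ (integD (integ_bndM mc1 bc1 J2) (integ_bndM mc2 bc2 J1)) => t _.
  rewrite /f /c1 /c2; case: (ltgtP t xi) => [h|h|->].
  - by rewrite E2// gtr0_sg ?subr_gt0//; field.
  - by rewrite E1// ltr0_sg ?subr_lt0//; field.
  - by rewrite E3 !subrr sgr0; field.
transitivity (itg 0 1 f); first by [].
rewrite (itg_cat xi0 xi1 fi).
apply: (f_equal2 +%R).
  apply: eq_itg_open; [exact: integS fi|exact: integS J2|].
  by move=> t /andP[_ h]; rewrite /f E2.
apply: eq_itg_open; [exact: integS fi|exact: integS J1|].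
by move=> t /andP[h _]; rewrite /f E1.
Qed.

Lemma Q01_kQ (X : state R) xi : {within `[0, 1], continuous (sy X)} ->
  integ 0 1 (density X) -> 0 <= xi <= 1 ->
  Q01 X xi = kQ (sy X) (density X) xi.
Proof.
move=> cy di /andP[xi0 xi1]; rewrite /Q01 /kQ.
have cyN := within_contN cy.
set y := sy X in cy cyN *; set d := density X in di *.
have J1 := integ_Jint xi cy di; have J2 := integ_Jint xi cyN di.
congr (_ - _).
  have -> : \int[mu]_(theta in `[0, 1]) (sinh (y xi - y theta) * d theta) =
    itg 0 1 (fun t => 2^-1 * (expR (y xi - y t) * d t - expR (- y xi - - y t) * d t)).
    by apply: eq_itg => t _; rewrite /sinh opprD; field.
  rewrite itgZ; last exact: integB.
  rewrite itgB// /kap /Jint; have := expR1_ge2 R.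
  move: (itg 0 1 _) (itg 0 1 _) (expR 1) => I1 I2 E e2; clear -e2.
  by field; rewrite gt_eqF//; lra.
congr (_ * _).
have E1 t : xi < t -> Num.sg (xi - t) * expR (- Num.sg (xi - t) * (y xi - y t)) = - expR (y xi - y t).
  by move=> h; rewrite ltr0_sg ?subr_lt0// opprK mul1r mulN1r.
have E2 t : t < xi -> Num.sg (xi - t) * expR (- Num.sg (xi - t) * (y xi - y t)) = expR (- y xi - - y t).
  by move=> h; rewrite gtr0_sg ?subr_gt0// mulN1r opprD mul1r.
have sg1 t : `|Num.sg (xi - t)| <= 1 by rewrite normr_sg; case: (_ != _).
set f := fun t => Num.sg (xi - t) * expR (- Num.sg (xi - t) * (y xi - y t)) * d t.
have fi : integ 0 1 f.
  pose s t := Num.sg (xi - t).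
  have ms : measurable_fun (`[0, 1] : set R) s by exact: measurable_sg.
  (* With the sign factor in front, the coefficients become 1 for [t < xi] and -1 for [t > xi], and
     both vanish at [t = xi]. *)
  pose c1 t := 2^-1 * (s t * (1 + s t)); pose c2 t := 2^-1 * (s t * (1 - s t)).
  have mc1 : measurable_fun (`[0, 1] : set R) c1.
    by do 2 apply: measurable_funM => //; exact: measurable_funD.
  have mc2 : measurable_fun (`[0, 1] : set R) c2.
    by do 2 apply: measurable_funM => //; exact: measurable_funB.
  have bc1 t : 0 <= t <= 1 -> `|c1 t| <= 1.
    by move=> _; have := sg1 t; rewrite -/(s t) /c1 !ler_norml; nra.
  have bc2 t : 0 <= t <= 1 -> `|c2 t| <= 1.
    by move=> _; have := sg1 t; rewrite -/(s t) /c2 !ler_norml; nra.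
  apply: eq_integ (integD (integ_bndM mc1 bc1 J2) (integ_bndM mc2 bc2 J1)) => t _.
  rewrite /f /c1 /c2 /s; case: (ltgtP t xi) => [h|h|->].
  - by rewrite E2// gtr0_sg ?subr_gt0//; field.
  - by rewrite E1// ltr0_sg ?subr_lt0//; field.
  - by rewrite !subrr sgr0; field.
transitivity (itg 0 1 f) => //; rewrite (itg_cat xi0 xi1 fi); congr (_ + _).
  apply: eq_itg_open; [exact: integS fi|exact: integS J2|].
  by move=> t /andP[_ h]; rewrite /f E2.
rewrite -itgN; last by apply: integS J1.
apply: eq_itg_open; [exact: integS fi|exact/integN/(integS _ _ J1)|].
by move=> t /andP[h _]; rewrite /f E1// mulNr.
Qed.

Lemma eq_kPQ (y y' d d' : R -> R) (xi : R) : {within `[0, 1], continuous y} -> integ 0 1 d ->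
  integ 0 1 d' -> {ae mu, forall x, 0 <= x <= 1 -> d x = d' x} -> 0 <= xi <= 1 ->
  (forall x : R, 0 <= x <= 1 -> y x = y' x) ->
  kP y d xi = kP y' d' xi /\ kQ y d xi = kQ y' d' xi.
Proof.
move=> cy di di' dd' xi01 yy'; have /andP[xi0 xi1] := xi01.
have cyN := within_contN cy.
have H (z z' : R -> R) (a b : R) : {within `[0, 1], continuous z} ->
    (forall x : R, 0 <= x <= 1 -> z x = z' x) -> 0 <= a -> b <= 1 ->
    Jint z d xi a b = Jint z' d' xi a b.
  move=> cz zz' a0 b1.
  have cz' : {within `[0, 1], continuous z'}.
    apply: subspace_eq_continuous cz => x; rewrite inE/= in_itv/=; exact: zz'.
  apply: itg_ae.
  - by apply: integS (integ_Jint xi cz di).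
  - by apply: integS (integ_Jint xi cz' di').
  apply: (ae_imp dd') => x dx /andP[ax xb].
  have x01 : 0 <= x <= 1 by rewrite (le_trans a0 ax) (le_trans xb b1).
  by rewrite dx// !zz'.
have yyN (x : R) : 0 <= x <= 1 -> - y x = - y' x by move=> h; rewrite yy'.
by rewrite /kP /kQ !(H _ _ _ _ cy yy')// !(H _ _ _ _ cyN yyN).
Qed.

End KernelsDefs.

(** * Bounds and Lipschitz estimates for P and Q in terms of norms over one period *)

Section KernelEstimates.
Variable R : realType.
Implicit Types (M D B : R) (a f y p U w n : R -> R).

Lemma itg_abs_mul B a f : integ 0 1 f -> integ 0 1 (fun x => a x * f x) ->
  (forall x : R, 0 <= x <= 1 -> `|a x| <= B) ->
  itg 0 1 (fun x => `|a x * f x|) <= B * itg 0 1 (fun x => `|f x|).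
Proof.
move=> fi afi aB; rewrite -itgZ; last exact: integ_norm.
apply: itg_le; [exact: integ_norm|exact/integZ/integ_norm|].
by move=> x x01; rewrite normrM ler_wpM2r// aB.
Qed.

Lemma itg_absD f f' : integ 0 1 f -> integ 0 1 f' ->
  itg 0 1 (fun x => `|f x + f' x|) <=
  itg 0 1 (fun x => `|f x|) + itg 0 1 (fun x => `|f' x|).
Proof.
move=> fi gi; rewrite -itgD; [|exact: integ_norm|exact: integ_norm].
apply: itg_le; [exact/integ_norm/integD|exact: integD (integ_norm fi) (integ_norm gi)|].
by move=> x _; exact: ler_normD.
Qed.

Lemma mul_diff_le (a b a' b' D B : R) : `|a - a'| <= D -> `|a'| <= B ->
  `|a * b - a' * b'| <= D * `|b| + B * `|b - b'|.
Proof.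
move=> h1 h2; have -> : a * b - a' * b' = (a - a') * b + a' * (b - b') by ring.
by apply: (le_trans (ler_normD _ _)); rewrite !normrM lerD// ler_wpM2r.
Qed.

Lemma itg_mul_diff B D a f a' f' : integ 0 1 f -> integ 0 1 f' ->
  integ 0 1 (fun x => a x * f x) -> integ 0 1 (fun x => a' x * f' x) ->
  (forall x : R, 0 <= x <= 1 -> `|a x - a' x| <= D) ->
  (forall x : R, 0 <= x <= 1 -> `|a' x| <= B) ->
  itg 0 1 (fun x => `|a x * f x - a' x * f' x|) <=
    D * itg 0 1 (fun x => `|f x|) + B * itg 0 1 (fun x => `|f x - f' x|).
Proof.
move=> fi fi' afi afi' aD aB.
have nf := integ_norm fi; have nff := integ_norm (integB fi fi').
rewrite -[X in X + _]itgZ// -[X in _ + X]itgZ// -itgD; [|exact: integZ|exact: integZ].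
apply: itg_le.
- exact/integ_norm/integB.
- exact: integD (integZ _ nf) (integZ _ nff).
- by move=> x x01; apply: mul_diff_le; [exact: aD|exact: aB].
Qed.

Lemma itg_abs_ge0 f : 0 <= itg 0 1 (fun x => `|f x|).
Proof. by apply: itg_ge0 => x _. Qed.

Definition dens U p n (x : R) : R := U x ^+ 2 * p x + n x.

(** The sets on which the system is Lipschitz. There is no bound on [y] itself, since the kernels
    see only [y x - y t], which the mass of [p] controls ([b_yM]). *)
Record bounded01 (M : R) y p U w n : Prop := Bounded01 {
  b_y : prim 0 1 y p;
  b_U : prim 0 1 U w;
  b_n : integ 0 1 n;
  b_UM : forall x : R, 0 <= x <= 1 -> `|U x| <= M;
  b_pM : itg 0 1 (fun x => `|p x|) <= M;
  b_wM : itg 0 1 (fun x => `|w x|) <= M;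
  b_nM : itg 0 1 (fun x => `|n x|) <= M }.

Lemma integ_sqrM U w p : prim 0 1 U w -> integ 0 1 p ->
  integ 0 1 (fun x => U x ^+ 2 * p x).
Proof.
by move=> pU ip; apply: integ_cM => //; exact: prim_cont ler01 (primM ler01 pU pU).
Qed.

Lemma b_d M y p U w n : bounded01 M y p U w n -> integ 0 1 (dens U p n).
Proof. by move=> b; apply: integD (integ_sqrM (b_U b) (b_y b).1) (b_n b). Qed.

Lemma b_M0 M y p U w n : bounded01 M y p U w n -> 0 <= M.
Proof. by move=> b; exact: le_trans (itg_abs_ge0 _) (b_pM b). Qed.

Lemma b_yM M y p U w n : bounded01 M y p U w n -> forall x t : R,
  0 <= x <= 1 -> 0 <= t <= 1 -> `|y x - y t| <= M.
Proof.
move=> b; have H (x t : R) : 0 <= x -> x <= t -> t <= 1 -> `|y t - y x| <= M.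
  move=> x0 xt t1; apply: (le_trans (prim_norm_le (b_y b) x0 xt t1)).
  apply: le_trans (b_pM b); apply: itg_sub_le => //.
  exact: integ_norm (b_y b).1.
move=> x t /andP[x0 x1] /andP[t0 t1]; have [xt|/ltW tx] := leP x t.
  by rewrite distrC; exact: H.
exact: H.
Qed.

Lemma dens_bnd M y p U w n : bounded01 M y p U w n ->
  itg 0 1 (fun x => `|dens U p n x|) <= M ^+ 3 + M.
Proof.
move=> b; have i1 := integ_sqrM (b_U b) (b_y b).1; have M0 := b_M0 b.
apply: (le_trans (itg_absD i1 (b_n b))); apply: lerD; last exact: b_nM b.
apply: (@le_trans _ _ (M ^+ 2 * itg 0 1 (fun x => `|p x|))).
  apply: itg_abs_mul => //; first exact: (b_y b).1.
  by move=> x x01; rewrite normrX lerXn2r ?nnegrE// (b_UM b).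
by rewrite [leRHS]exprSr ler_wpM2l ?sqr_ge0// (b_pM b).
Qed.

(** [exp M] bounds the kernels and [M ^ 3 + M] the L^1 norm of the density. In [cL], the term
    [2 * (M ^ 3 + M)] comes from perturbing [y] at both arguments of the kernel, and [3 * M ^ 2 + 1]
    is the Lipschitz constant of the density in L^1. *)
Definition cB M : R := expR M * (M ^+ 3 + M).
Definition cL M : R := expR M * (2 * (M ^+ 3 + M) + (3 * M ^+ 2 + 1)).

Lemma kPQ_cB M y p U w n (x : R) : bounded01 M y p U w n -> 0 <= x <= 1 ->
  `|kP y (dens U p n) x| <= cB M /\ `|kQ y (dens U p n) x| <= cB M.
Proof.
move=> b x01; have cy := prim_cont ler01 (b_y b).
have [h1 h2] := kPQ_bnd cy (b_d b) (b_yM b) x01.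
have H := ler_wpM2l (expR_ge0 M) (dens_bnd b).
by split; [exact: le_trans h1 H|exact: le_trans h2 H].
Qed.

Section Difference.
Variables (M D : R) (y p U w n y' p' U' w' n' : R -> R).
Hypotheses (b : bounded01 M y p U w n) (b' : bounded01 M y' p' U' w' n').
Hypothesis D_y : forall x : R, 0 <= x <= 1 -> `|y x - y' x| <= D.
Hypothesis D_U : forall x : R, 0 <= x <= 1 -> `|U x - U' x| <= D.
Hypothesis D_p : itg 0 1 (fun x => `|p x - p' x|) <= D.
Hypothesis D_n : itg 0 1 (fun x => `|n x - n' x|) <= D.

Lemma diff_ge0 : 0 <= D.
Proof. exact: le_trans (itg_abs_ge0 _) D_p. Qed.

Lemma sqr_diff (u u' : R) : `|u| <= M -> `|u'| <= M -> `|u - u'| <= D ->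
  `|u ^+ 2 - u' ^+ 2| <= 2 * M * D.
Proof.
move=> h1 h2 h3; rewrite subr_sqr normrM mulrC ler_pM//.
by rewrite (le_trans (ler_normD _ _))// mulr_natl mulr2n lerD.
Qed.

Lemma dens_lip :
  itg 0 1 (fun x => `|dens U p n x - dens U' p' n' x|) <= (3 * M ^+ 2 + 1) * D.
Proof.
have i1 := integ_sqrM (b_U b) (b_y b).1; have i1' := integ_sqrM (b_U b') (b_y b').1.
have M0 := b_M0 b; have D0 := diff_ge0.
have -> : itg 0 1 (fun x => `|dens U p n x - dens U' p' n' x|) =
  itg 0 1 (fun x => `|(U x ^+ 2 * p x - U' x ^+ 2 * p' x) + (n x - n' x)|).
  by apply: eq_itg => x _; congr (`| _ |); rewrite /dens; ring.
have H0 := itg_absD (integB i1 i1') (integB (b_n b) (b_n b')).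
have H1 : itg 0 1 (fun x => `|U x ^+ 2 * p x - U' x ^+ 2 * p' x|) <=
    2 * M * D * itg 0 1 (fun x => `|p x|) + M ^+ 2 * itg 0 1 (fun x => `|p x - p' x|).
  apply: itg_mul_diff => //; [exact: (b_y b).1|exact: (b_y b').1| |].
    by move=> x x01; apply: sqr_diff; [exact: b_UM b _ x01|exact: b_UM b' _ x01|exact: D_U].
  by move=> x x01; rewrite normrX lerXn2r ?nnegrE// (b_UM b').
have H2 : 2 * M * D * itg 0 1 (fun x => `|p x|) <= 2 * M * D * M.
  by rewrite ler_wpM2l ?(b_pM b)// !mulr_ge0.
have H3 : M ^+ 2 * itg 0 1 (fun x => `|p x - p' x|) <= M ^+ 2 * D.
  by rewrite ler_wpM2l ?sqr_ge0.
apply: (le_trans H0).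
apply: (le_trans (lerD (le_trans H1 (lerD H2 H3)) D_n)).
by rewrite le_eqVlt; apply/orP; left; apply/eqP; ring.
Qed.

Lemma kPQ_cL (x : R) : 0 <= x <= 1 ->
  `|kP y (dens U p n) x - kP y' (dens U' p' n') x| <= cL M * D /\
  `|kQ y (dens U p n) x - kQ y' (dens U' p' n') x| <= cL M * D.
Proof.
move=> x01.
have cy := prim_cont ler01 (b_y b); have cy' := prim_cont ler01 (b_y b').
have [h1 h2] := kPQ_lip cy cy' (b_d b) (b_d b') (b_yM b) (b_yM b') D_y x01.
have H : expR M * (2 * D * itg 0 1 (fun t => `|dens U p n t|) +
    itg 0 1 (fun t => `|dens U p n t - dens U' p' n' t|)) <= cL M * D.
  have D0 := diff_ge0.
  rewrite /cL -[leRHS]mulrA ler_wpM2l ?expR_ge0// [leRHS]mulrDl.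
  apply: lerD dens_lip.
  have -> : 2 * (M ^+ 3 + M) * D = 2 * D * (M ^+ 3 + M) by ring.
  by rewrite ler_wpM2l ?(dens_bnd b)// mulr_ge0.
by split; [exact: le_trans h1 H|exact: le_trans h2 H].
Qed.

End Difference.
End KernelEstimates.

(** * Weak derivatives and periodic functions *)

Section WeakDerivatives.
Variable R : realType.
Local Notation mu := (@lebesgue_measure R).
Implicit Types (f g h phi : R -> R) (a b : R).

Lemma LnormI1E a b f : LnormI 1%E a b f = (\int[mu]_(x in `[a, b]) `|f x|%:E)%E.
Proof.
rewrite /LnormI Lnorm1 [RHS]integral_mkcond; apply: eq_integral => x _ /=.
by rewrite !patchE; case: ifP => //=; rewrite normr0.
Qed.

Lemma LnormI1_itg a b f : integ a b f ->
  LnormI 1%E a b f = (itg a b (fun x => `|f x|))%:E.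
Proof.
move=> fi; rewrite LnormI1E /itg /Rintegral fineK//.
exact: integrable_fin_num (integrable_norm fi).
Qed.

Lemma Lploc1P f :
  Lploc 1%E f <-> measurable_fun [set: R] f /\ forall a b, integ a b f.
Proof.
split=> -[mf H]; split=> // a b; have := H a b.
  rewrite LnormI1E => fi; apply/integrableP; split => //.
  by apply/measurable_EFinP; exact: measurable_funS mf.
by rewrite LnormI1E => /integrableP[_].
Qed.

(** Local absolute continuity on the line. For continuous [f] and locally integrable [g] it is the
    same as [g] being a weak derivative of [f] ([gprim_weak], [weak_gprim]), so it serves as the
    working form of W^{1,1}_loc. *)
Definition gprim f g :=
  measurable_fun [set: R] g /\ forall a b, a <= b -> prim a b f g.

Lemma gprim_Lploc f g : gprim f g -> Lploc 1%E g.
Proof.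
move=> [mg fg]; apply/Lploc1P; split => // a b.
have [ab|ba] := leP a b; first exact: (fg _ _ ab).1.
rewrite /integ set_itv_ge ?bnd_simp -?ltNge//; apply/integrableP; split.
  exact: measurable_fun_set0.
by rewrite integral_set0.
Qed.

Lemma prim_C1 phi a b : a <= b -> (forall x : R, derivable phi x 1) ->
  continuous (derive1 phi) -> prim a b phi (derive1 phi).
Proof.
move=> ab dphi cphi.
have cphi' c d : {within `[c, d], continuous (derive1 phi)}.
  exact: continuous_subspaceT.
have cp : continuous phi.
  by move=> x; apply/differentiable_continuous/derivable1_diffP.
apply: primP; first exact: (integ_cont ab (cphi' a b)).
move=> x y ax xy yb; move: xy; rewrite le_eqVlt => /predU1P[->|xy].
  by rewrite itgs subrr.
have dLR : derivable_oo_LRcontinuous phi x y.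
  split; [by move=> z _; exact: dphi| |].
  - by apply: cvg_at_right_filter; exact: cp.
  - by apply: cvg_at_left_filter; exact: cp.
have := continuous_FTC2 xy (cphi' x y) dLR (fun _ _ => erefl).
by rewrite /itg /Rintegral => ->.
Qed.

Lemma itg_supp a b h : (forall x, ~ (a <= x <= b) -> h x = 0) ->
  \int[mu]_x h x = itg a b h.
Proof.
move=> h0; rewrite /itg [RHS]Rintegral_mkcond; congr (Rintegral mu setT _).
apply/funext => x; rewrite patchE; case: ifPn => //.
by move=> /negP; rewrite inE/= in_itv/=; exact: h0.
Qed.

Lemma test_fun_supp phi : test_function phi -> exists M : R, 0 < M /\
  forall x, ~ (- M < x < M) -> phi x = 0 /\ derive1 phi x = 0.
Proof.
move=> [dphi cphi [a [b phi0]]].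
(* The extra 1 makes [phi] vanish on a whole neighbourhood of every point outside, so that its
   derivative vanishes there too. *)
pose M := `|a| + `|b| + 1; exists M; split.
  by rewrite /M ltr_wpDl// addr_ge0.
have ha := ler_norm a; have hb := ler_norm b.
have ha' := ler_norm (- a); have hb' := ler_norm (- b); rewrite !normrN in ha' hb'.
have out x : ~ (- (`|a| + `|b|) <= x <= `|a| + `|b|) -> phi x = 0.
  move=> /negP; rewrite negb_and -!ltNge => /orP h; apply: phi0.
  have na := normr_ge0 a; have nb := normr_ge0 b.
  by rewrite in_itv/= negb_and -!ltNge; case: h => h; apply/orP; [left|right]; lra.
move=> x xM; have xo : ~ (- (`|a| + `|b|) <= x <= `|a| + `|b|).
  by move=> /andP[h1 h2]; apply: xM; rewrite /M; lra.
split; first exact: out.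
rewrite derive1E; rewrite (@near_eq_derive _ _ _ phi (cst 0) x 1).
  by rewrite derive_cst.
near=> z; apply: out; move=> /andP[z1 z2].
have : `|x - z| < 1 by near: z; apply/nbhs_ballP; exists 1 => //=.
rewrite ltr_norml => /andP[xz zx]; apply: xM; rewrite /M; lra.
Unshelve. all: by end_near. Qed.

Lemma gprim_weak f g : gprim f g -> weak_derivative f g.
Proof.
move=> [mg fg] phi tphi; have [M [M0 out]] := test_fun_supp tphi.
have MM : - M <= M by lra.
have out' (x : R) : ~ (- M <= x <= M) -> phi x = 0 /\ derive1 phi x = 0.
  by move=> h; apply: out => /andP[h1 h2]; apply: h; rewrite !ltW.
have p0 x : x = M \/ x = - M -> phi x = 0.
  by move=> h; apply: (out x _).1 => /andP[]; case: h => ->; rewrite ltxx.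
have pp := primM MM (fg _ _ MM) (prim_C1 MM (let: And3 d _ _ := tphi in d)
  (let: And3 _ c _ := tphi in c)).
have := prim_diff pp (lexx _) MM (lexx _).
rewrite p0; last by left.
rewrite p0; last by right.
rewrite !mulr0 subrr => /esym.
have i1 : integ (- M) M (fun x => g x * phi x).
  have [d c _] := tphi.
  apply: eq_integ (integ_cM MM (prim_cont MM (prim_C1 MM d c)) (fg _ _ MM).1).
  by move=> x _; rewrite mulrC.
have i2 : integ (- M) M (fun x => f x * derive1 phi x).
  have [d c _] := tphi.
  exact: integ_cM (prim_cont MM (fg _ _ MM)) (prim_C1 MM d c).1.
rewrite itgD// => /eqP; rewrite addrC addr_eq0 => /eqP H.
rewrite (@itg_supp (- M) M); last first.
  by move=> x /out'[_ ->]; rewrite mulr0.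
rewrite H (@itg_supp (- M) M)// => x /out'[-> _]; by rewrite mulr0.
Qed.

(** The difference of the densities integrates to 0 over every interval. Lebesgue's differentiation
    theorem, applied to its vanishing primitive from [- n] for each natural [n], makes it 0 almost
    everywhere. *)
Lemma gprim_unique f g g' : gprim f g -> gprim f g' ->
  {ae mu, forall x, g x = g' x}.
Proof.
move=> fg fg'.
have /Lploc1P[mg ig] := gprim_Lploc fg; have /Lploc1P[mg' ig'] := gprim_Lploc fg'.
pose h x := g x - g' x.
have mh : measurable_fun [set: R] h by exact: measurable_funB.
have ih a b : integ a b h by exact: integB.
have h0 a b : itg a b h = 0.
  have [ab|ba] := leP a b.
    rewrite itgB// -(prim_diff (fg.2 _ _ ab))// -(prim_diff (fg'.2 _ _ ab))//.
    by rewrite subrr.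
  by rewrite /itg set_itv_ge ?bnd_simp -?ltNge// Rintegral_set0.
have loch : locally_integrable [set: R] h.
  split => //; first exact: openT.
  move=> K _ cK; have [M [Mr HM]] := compact_bounded cK.
  have KM : K `<=` `[- (M + 1), M + 1].
    move=> x Kx /=; rewrite in_itv/= -ler_norml; apply: HM => //.
    by rewrite ltrDl.
  have /integrableP[_] := ih (- (M + 1)) (M + 1); apply: le_lt_trans.
  apply: ge0_subset_integral => //; first exact: compact_measurable.
  by do 2 apply: measurableT_comp => //; apply: measurable_funS mh.
have H n : {ae mu, forall x, - (n%:R : R) < x -> h x = 0}.
  have := @FTC1 R h (BLeft (- n%:R)) (fun y => ih _ y) loch.
  move=> Hn; apply: (ae_imp Hn) => x Hx nx.
  have [|_ <-] := Hx; first by rewrite /= lte_fin.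
  rewrite (_ : (fun _ => _) = cst 0) ?derive1_cst//.
  by apply/funext => y; exact: h0.
have : {ae mu, forall x, forall n : nat, - (n%:R : R) < x -> h x = 0}.
  exact/ae_foralln.
move=> H'; apply: (ae_imp H') => x Hx.
apply/eqP; rewrite -subr_eq0; apply/eqP; apply: (Hx (Num.bound `|x|)).
rewrite ltrNl; apply: le_lt_trans (archi_boundP (normr_ge0 x)).
by rewrite -normrN ler_norm.
Qed.

End WeakDerivatives.

Section Bump.
Variable R : realType.

Lemma is_derive_quad (F : R -> R) (x l C : R) :
  (forall h, `|F (x + h) - F x - l * h| <= C * h ^+ 2) ->
  is_derive (x : R) (1 : R) F l.
Proof.
move=> H.
have C0 : 0 <= C.
  by have := le_trans (normr_ge0 _) (H 1); rewrite expr1n mulr1.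
have L : h^-1 *: ((F \o shift x) (h *: (1 : R)) - F x) @[h --> (0 : R)^'] --> l.
  apply/cvgrPdist_le => /= e e0.
  exists (e / (C + 1)) => /=; first by rewrite divr_gt0// ltr_wpDl.
  move=> h /=; rewrite sub0r normrN => he h0.
  have h0' : 0 < `|h| by rewrite normr_gt0.
  have := H h; rewrite /= [h *: 1]mulr1 [h + x]addrC /= => Hh.
  have -> : l - h^-1 *: (F (x + h) - F x) = - (h^-1 * (F (x + h) - F x - l * h)).
    by rewrite /GRing.scale/=; field.
  rewrite normrN normrM normfV ler_pdivrMl//; apply: (le_trans Hh).
  rewrite -real_normK ?num_real// expr2 mulrA mulrC ler_wpM2l//.
  move: he; rewrite ltr_pdivlMr ?ltr_wpDl// => he; nra.
by apply: DeriveDef; [apply/cvg_ex; exists l|exact/cvg_lim].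
Qed.

Definition pospart (x : R) : R := (x + `|x|) / 2.

Lemma pospartP x : (0 <= x /\ pospart x = x) \/ (x <= 0 /\ pospart x = 0).
Proof.
have [x0|x0] := leP 0 x; [left|right]; split; rewrite ?(ltW x0)//.
  by rewrite /pospart ger0_norm//; field.
by rewrite /pospart ltr0_norm// subrr mul0r.
Qed.

Lemma pospart_quad x h :
  `|pospart (x + h) ^+ 2 - pospart x ^+ 2 - 2 * pospart x * h| <= h ^+ 2.
Proof.
case: (pospartP x) => -[hx ->]; case: (pospartP (x + h)) => -[hxh ->];
  rewrite ler_norml; nra.
Qed.

Lemma cont_pospart : continuous pospart.
Proof.
move=> x; apply: cvgM; last exact: cvg_cst.
by apply: cvgD; [exact: cvg_id|exact: norm_continuous].
Qed.

Section Fixed.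
Variables (e a : R).
Hypothesis e0 : 0 < e.

(* A C^1 step rising from 0 to 1 on [a, a + 2e], and its derivative. *)
Definition step (x : R) : R := (2 * e ^+ 2)^-1 *
  (pospart (x - a) ^+ 2 - 2 * pospart (x - a - e) ^+ 2
   + pospart (x - a - 2 * e) ^+ 2).
Definition tent (x : R) : R := (e ^+ 2)^-1 *
  (pospart (x - a) - 2 * pospart (x - a - e) + pospart (x - a - 2 * e)).

Lemma is_derive_step (x : R) : is_derive (x : R) (1 : R) step (tent x).
Proof.
apply: (@is_derive_quad _ _ _ ((2 * e ^+ 2)^-1 * 4)) => h.
rewrite /step /tent.
have := pospart_quad (x - a) h; have := pospart_quad (x - a - e) h.
have := pospart_quad (x - a - 2 * e) h.
rewrite (_ : x - a - 2 * e + h = x + h - a - 2 * e); last by ring.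
rewrite (_ : x - a - e + h = x + h - a - e); last by ring.
rewrite (_ : x - a + h = x + h - a); last by ring.
set A1 := pospart (x + h - a) ^+ 2; set A2 := pospart (x + h - a - e) ^+ 2.
set A3 := pospart (x + h - a - 2 * e) ^+ 2.
set B1 := pospart (x - a); set B2 := pospart (x - a - e).
set B3 := pospart (x - a - 2 * e) => h3 h2 h1.
have -> : (2 * e ^+ 2)^-1 * (A1 - 2 * A2 + A3) -
   (2 * e ^+ 2)^-1 * (B1 ^+ 2 - 2 * B2 ^+ 2 + B3 ^+ 2) -
   (e ^+ 2)^-1 * (B1 - 2 * B2 + B3) * h =
   (2 * e ^+ 2)^-1 * ((A1 - B1 ^+ 2 - 2 * B1 * h)
     - 2 * (A2 - B2 ^+ 2 - 2 * B2 * h) + (A3 - B3 ^+ 2 - 2 * B3 * h)).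
  by field; rewrite gt_eqF.
have c0 : 0 <= (2 * e ^+ 2)^-1 by rewrite invr_ge0 mulr_ge0 ?sqr_ge0.
rewrite normrM (ger0_norm c0) -[leRHS]mulrA ler_wpM2l//.
move: h1 h2 h3; rewrite !ler_norml; lra.
Qed.

Lemma tent_ge0 x : 0 <= tent x.
Proof.
rewrite /tent mulr_ge0 ?invr_ge0 ?sqr_ge0//.
case: (pospartP (x - a)) => -[h1 ->]; case: (pospartP (x - a - e)) => -[h2 ->];
case: (pospartP (x - a - 2 * e)) => -[h3 ->]; lra.
Qed.

Lemma tent_out x : x <= a \/ a + 2 * e <= x -> tent x = 0.
Proof.
move=> h; have e0' := e0; rewrite /tent.
case: (pospartP (x - a)) => -[h1 ->]; case: (pospartP (x - a - e)) => -[h2 ->];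
case: (pospartP (x - a - 2 * e)) => -[h3 ->]; apply/eqP;
rewrite mulf_eq0; apply/orP; right; apply/eqP; case: h => h; lra.
Qed.

Lemma step_le x : x <= a -> step x = 0.
Proof.
move=> h; have e0' := e0; rewrite /step.
have pp u : u <= 0 -> pospart u = 0.
  by move=> u0; case: (pospartP u) => -[h1 ->] //; lra.
by rewrite !pp ?expr0n/= ?mulr0 ?subr0 ?addr0 ?mulr0//; lra.
Qed.

Lemma step_ge x : a + 2 * e <= x -> step x = 1.
Proof.
move=> h; have e0' := e0; rewrite /step.
have pp u : 0 <= u -> pospart u = u.
  by move=> u0; case: (pospartP u) => -[h1 ->] //; lra.
by rewrite !pp; [field; rewrite gt_eqF|lra..].
Qed.

Lemma cont_tent : continuous tent.
Proof.
have c d : continuous (fun x : R => pospart (x - d)).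
  move=> x; apply: (@continuous_comp _ _ _ (fun x : R => x - d) pospart).
    by apply: cvgB; [exact: cvg_id|exact: cvg_cst].
  exact: cont_pospart.
have c2 d1 d2 : continuous (fun x : R => pospart (x - d1 - d2)).
  rewrite (_ : (fun _ => _) = (fun x => pospart (x - (d1 + d2)))); first exact: c.
  by apply/funext => x; rewrite opprD addrA.
move=> x; apply: cvgM; first exact: cvg_cst.
apply: cvgD; last exact: c2.
apply: cvgB; first exact: c.
by apply: cvgM; [exact: cvg_cst|exact: c2].
Qed.

Lemma derivable_step x : derivable step x 1.
Proof. by have [] := is_derive_step x. Qed.

Lemma derive1_step : derive1 step = tent.
Proof.
apply/funext => x; rewrite derive1E; have [_] := is_derive_step x; exact.
Qed.

Lemma prim_step A B : A <= B -> prim A B step tent.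
Proof.
move=> AB; have cd : continuous (derive1 step) by rewrite derive1_step; exact: cont_tent.
by have := prim_C1 AB derivable_step cd; rewrite derive1_step.
Qed.

End Fixed.

Lemma cont_right_eps (z : R -> R) (a b e : R) : a < b ->
  {within `[a, b], continuous z} -> 0 < e ->
  exists2 d, 0 < d & forall x, a <= x <= a + d -> `|z x - z a| <= e.
Proof.
move=> ab /(continuous_within_itvP _ ab)[_ + _] e0.
move=> /cvgrPdist_le /(_ e e0) [d /= d0 H]; exists (d / 2); first by rewrite divr_gt0.
move=> x /andP[]; rewrite le_eqVlt => /predU1P[<- _|ax xd].
  by rewrite subrr normr0 ltW.
rewrite distrC; apply: H => //=.
by rewrite distrC gtr0_norm ?subr_gt0//; lra.
Qed.

(** The tent is nonnegative, has mass 1 and is supported in [[a, a + 2 e]]: an approximate identity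
    from the right. *)
Lemma tent_average (A B a b e eta : R) (z : R -> R) : 0 < e ->
  A <= a -> a + 2 * e <= B -> {within `[A, B], continuous z} ->
  (forall x, a <= x <= a + 2 * e -> `|z x - z a| <= eta) ->
  `|itg A B (fun x => z x * tent e a x) - z a| <= eta.
Proof.
move=> e0 Aa aB cz H.
have AB : A <= B by lra.
have pS := prim_step a e0 AB.
have i1 := integ_cM AB cz pS.1.
have one : itg A B (tent e a) = 1.
  by rewrite -(prim_diff pS)// step_ge// step_le// subr0.
have -> : z a = itg A B (fun x => z a * tent e a x).
  by rewrite itgZ ?one ?mulr1//; exact: pS.1.
have i2 := integZ (z a) pS.1.
rewrite -itgB//.
have -> : eta = itg A B (fun x => eta * tent e a x).
  by rewrite itgZ ?one ?mulr1//; exact: pS.1.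
apply: itg_norm_le; [exact: integB|exact: integZ pS.1|].
move=> x _; rewrite -mulrBl normrM (ger0_norm (tent_ge0 e a x)).
have [xa|ax] := leP x a; first by rewrite tent_out ?mulr0//; left.
have [xa'|ax'] := leP (a + 2 * e) x; first by rewrite tent_out ?mulr0//; right.
by rewrite ler_wpM2r ?tent_ge0// H// !ltW.
Qed.

(** The du Bois-Reymond lemma. The function [z], which is [f] minus the primitive of [g], is
    orthogonal to derivatives of test functions. A test function whose derivative is a difference of
    two tents then shows that the averages of [z] near [a] and near [b] agree. *)
Lemma weak_gprim (f g : R -> R) : continuous f -> Lploc 1%E g ->
  weak_derivative f g -> gprim f g.
Proof.
move=> cf /Lploc1P[mg ig] fg; split => // a0 b0 ab0; apply: primP => // a b _ ab _.
move: ab; rewrite le_eqVlt => /predU1P[->|ab]; first by rewrite itgs subrr.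
pose A := a - 1; pose B := b + 1.
have AB : A <= B by rewrite /A /B; lra.
pose F x := itg A x g; pose z x := f x - F x.
have pF : prim A B F g := prim_itg AB (ig A B).
have cz : {within `[A, B], continuous z}.
  move=> x; apply: cvgB; last exact: prim_cont pF x.
  exact: (continuous_subspaceT cf).
suff zab : z a = z b.
  have <- : F b - F a = itg a b g by apply: (prim_diff pF); rewrite /A /B; lra.
  by move: zab; rewrite /z => zab; lra.
apply/eqP; rewrite -subr_eq0 -normr_le0; apply/ler_addgt0Pr => eta' eta0'.
pose eta := eta' / 2; have eta0 : 0 < eta by rewrite divr_gt0.
have czS c d : A <= c -> d <= B -> {within `[c, d], continuous z}.
  move=> Ac dB; apply: continuous_subspaceW cz => x /=; rewrite !in_itv/=.
  by move=> /andP[cx xd]; rewrite (le_trans Ac)// (le_trans xd).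
have [d1 d10 H1] := cont_right_eps (a := a) (b := a + 1) (z := z) (e := eta) ltac:(lra)
  (czS a (a + 1) ltac:(rewrite /A; lra) ltac:(rewrite /B; lra)) eta0.
have [d2 d20 H2] := cont_right_eps (a := b) (b := b + 1) (z := z) (e := eta) ltac:(lra)
  (czS b (b + 1) ltac:(rewrite /A; lra) ltac:(rewrite /B; lra)) eta0.
pose e := Num.min (Num.min d1 d2) 1 / 2.
have e0 : 0 < e by rewrite divr_gt0// !lt_min d10 d20 ltr01.
have e1 : 2 * e <= d1 by rewrite /e mulrC divfK// !ge_min lexx.
have e2 : 2 * e <= d2 by rewrite /e mulrC divfK// !ge_min lexx orbT.
have e3 : 2 * e <= 1 by rewrite /e mulrC divfK// !ge_min lexx !orbT.
(* The two steps cancel to the right of [b + 2 e], which makes the support compact; [2 * e <= 1]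
   keeps it inside [[A, B]]. *)
pose phi x := step e a x - step e b x.
have dphi x : is_derive (x : R) (1 : R) phi (tent e a x - tent e b x).
  by apply: is_deriveB; exact: is_derive_step.
have d1phi : derive1 phi = (fun x => tent e a x - tent e b x).
  by apply/funext => x; rewrite derive1E; have [_] := dphi x.
have tphi : test_function phi.
  split.
  - by move=> x; have [] := dphi x.
  - by rewrite d1phi => x; apply: cvgB; exact: cont_tent.
  - exists A, B => x; rewrite in_itv/= negb_and -!ltNge /phi => /orP[h|h].
      by rewrite !step_le ?subrr//; move: h; rewrite /A; lra.
    by rewrite !step_ge ?subrr//; move: h; rewrite /B; lra.
have phi0 x : ~ (A < x < B) -> phi x = 0 /\ derive1 phi x = 0.
  move=> /negP; rewrite negb_and -!leNgt d1phi /phi => /orP[h|h].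
    have xa : x <= a by move: h; rewrite /A; lra.
    have xb : x <= b by lra.
    by rewrite !step_le// !tent_out ?subrr//; left.
  have xb : b + 2 * e <= x by move: h; rewrite /B; lra.
  have xa : a + 2 * e <= x by lra.
  by rewrite !step_ge// !tent_out ?subrr//; right.
have phi0' x : ~ (A <= x <= B) -> phi x = 0 /\ derive1 phi x = 0.
  by move=> h; apply: phi0 => /andP[h1 h2]; apply: h; rewrite !ltW.
have pphi : prim A B phi (derive1 phi).
  by have [? ? _] := tphi; exact: prim_C1.
have cphi := prim_cont AB pphi.
have i1 : integ A B (fun x => g x * phi x).
  by apply: eq_integ (integ_cM AB cphi pF.1) => x _; rewrite mulrC.
have i2 : integ A B (fun x => F x * derive1 phi x).
  exact: integ_cM AB (prim_cont AB pF) pphi.1.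
have i3 : integ A B (fun x => f x * derive1 phi x).
  exact: integ_cM AB (continuous_subspaceT cf) pphi.1.
have S1 : itg A B (fun x => f x * derive1 phi x) = - itg A B (fun x => g x * phi x).
  have := fg phi tphi.
  rewrite (@itg_supp _ A B); last by move=> x /phi0'[_ ->]; rewrite mulr0.
  by rewrite (@itg_supp _ A B)// => x /phi0'[-> _]; rewrite mulr0.
have S2 : itg A B (fun x => F x * derive1 phi x) = - itg A B (fun x => g x * phi x).
  have := prim_diff (primM AB pF pphi) (lexx _) AB (lexx _).
  rewrite itgD// (phi0 A _).1; last by rewrite ltxx.
  rewrite (phi0 B _).1; last by rewrite ltxx andbF.
  by rewrite !mulr0 subrr; move: (itg A B _) (itg A B _) => I1 I2 H; clear -H; lra.
have S3 : itg A B (fun x => z x * derive1 phi x) = 0.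
  have -> : itg A B (fun x => z x * derive1 phi x) =
      itg A B (fun x => f x * derive1 phi x - F x * derive1 phi x).
    by apply: eq_itg => x _; rewrite /z; ring.
  by rewrite itgB// S1 S2 subrr.
have T1 : `|itg A B (fun x => z x * tent e a x) - z a| <= eta.
  apply: tent_average => //; rewrite /A /B; try lra.
  by move=> x /andP[ax xa]; apply: H1; rewrite ax/=; lra.
have T2 : `|itg A B (fun x => z x * tent e b x) - z b| <= eta.
  apply: tent_average => //; rewrite /A /B; try lra.
  by move=> x /andP[ax xa]; apply: H2; rewrite ax/=; lra.
have S4 : itg A B (fun x => z x * tent e a x) = itg A B (fun x => z x * tent e b x).
  apply/eqP; rewrite -subr_eq0 -itgB.
  - rewrite -S3; apply/eqP/eq_itg => x _; rewrite d1phi; ring.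
  - exact: integ_cM AB cz (prim_step a e0 AB).1.
  - exact: integ_cM AB cz (prim_step b e0 AB).1.
rewrite add0r; move: T1 T2; rewrite S4 !ler_norml; move: (itg A B _) => I1;
  rewrite /eta; move: (z a) (z b) => za zb; clear; lra.
Qed.

Lemma gprim_cont (f g : R -> R) : gprim f g -> continuous f.
Proof.
move=> [_ fg] x; have x1 : x - 1 < x + 1 by lra.
have /(continuous_within_itvP _ x1)[+ _ _] := prim_cont (ltW x1) (fg _ _ (ltW x1)).
by apply; rewrite in_itv/=; lra.
Qed.

(** The choice behind [wderiv] ranges over a set inhabited by [g], so the chosen function is a
    density as well, and densities are unique almost everywhere. *)
Lemma wderiv_gprim (f g : R -> R) : gprim f g ->
  gprim f (wderiv f) /\ {ae (@lebesgue_measure R), forall x, wderiv f x = g x}.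
Proof.
move=> fg; have Lg := gprim_Lploc fg; have wg := gprim_weak fg.
have [Lw ww] := xgetI (P := [set g | Lploc 1%E g /\ weak_derivative f g]) (cst 0)
  (conj Lg wg).
have H : gprim f (wderiv f) by exact: weak_gprim (gprim_cont fg) Lw ww.
by split => //; exact: gprim_unique fg.
Qed.

Lemma W1ploc_gprim (f : R -> R) : continuous f -> W1ploc 1%E f ->
  gprim f (wderiv f).
Proof.
move=> cf [_ [g Lg wg]]; have fg := weak_gprim cf Lg wg.
by have [] := wderiv_gprim fg.
Qed.

Lemma gprim_W1ploc (f g : R -> R) : gprim f g -> W1ploc 1%E f.
Proof.
move=> fg; split; last by exists g; [exact: gprim_Lploc fg|exact: gprim_weak].
have cf := gprim_cont fg; apply/Lploc1P; split.
  exact: continuous_measurable_fun.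
move=> a b; have [ab|ba] := leP a b.
  exact: integ_cont ab (continuous_subspaceT cf).
rewrite /integ set_itv_ge ?bnd_simp -?ltNge//; apply/integrableP; split.
  exact: measurable_fun_set0.
by rewrite integral_set0.
Qed.

End Bump.

(** * Translation invariance and periodic functions *)

Section Translation.
Variable R : realType.
Local Notation mu := (@lebesgue_measure R).
Implicit Types (f g : R -> R) (a b c : R).

Definition addc c : measurableTypeR R -> measurableTypeR R := fun x => (x + c)%R.

Lemma measurable_addc c (D : set (measurableTypeR R)) : measurable_fun D (addc c).
Proof. by apply: (@measurable_funD _ _ R). Qed.

HB.instance Definition _ c := isMeasurableFun.Build _ _ _ _ (addc c)
  (@measurable_addc c [set: R]).

(** The translated measure gives half-open intervals their length, and this property characterizes
    Lebesgue measure. *)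
Lemma lebesgue_measure_shift c (A : set R) : measurable A ->
  pushforward mu (addc c) A = mu A.
Proof.
move=> mA.
apply/esym/(@lebesgue_measure_unique R (pushforward mu (addc c))) => //= _ [[a b]] _ <-.
have H : addc c @^-1` `]a, b] = `]a - c, b - c]%classic.
  apply/seteqP; split=> x /=; rewrite !in_itv/= /addc ltrBlDr lerBrDr //.
rewrite /pushforward H/= !lebesgue_measure_itv/= !lte_fin ltrD2r.
by case: ifP => // _; congr EFin; ring.
Qed.

Lemma ae_shift c (P : R -> Prop) : {ae mu, forall x, P x} ->
  {ae mu, forall x, P (x + c)}.
Proof.
move=> [N [mN N0 PN]]; exists (addc c @^-1` N); split.
- rewrite -[_ @^-1` _]setTI; exact: (@measurable_addc c).
- by have := lebesgue_measure_shift c mN; rewrite /pushforward N0.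
- by move=> x /= nP; exact: PN.
Qed.

Let preimage_cc c a b : addc c @^-1` `[a + c, b + c] = `[a, b]%classic.
Proof.
by apply/seteqP; split=> x /=; rewrite !in_itv/= /addc !lerD2r.
Qed.

Lemma itg_shift c a b g : measurable_fun [set: R] g ->
  integ a b (fun x => g (x + c)) ->
  integ (a + c) (b + c) g /\
  itg (a + c) (b + c) g = itg a b (fun x => g (x + c)).
Proof.
move=> mg ig.
have mg' : measurable_fun [set: R] (EFin \o g) by exact/measurable_EFinP.
have mD : measurable (`[a + c, b + c]%classic : set (measurableTypeR R)) by [].
have ig' : mu.-integrable (addc c @^-1` `[a + c, b + c]) ((EFin \o g) \o addc c).
  by rewrite preimage_cc.
have ip := integrable_pushforward (@measurable_addc c [set: R]) mg' ig' mD.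
have eqI (h : R -> \bar R) :
  (\int[mu]_(x in `[(a + c)%R, (b + c)%R]) h x =
   \int[pushforward mu (addc c)]_(x in `[(a + c)%R, (b + c)%R]) h x)%E.
  exact: (eq_measure_integral (pushforward mu (addc c))
    (fun A mA _ => esym (lebesgue_measure_shift c mA))).
split.
  move/integrableP : ip => [mf fi]; apply/integrableP; split => //.
  by rewrite eqI.
rewrite /itg /Rintegral eqI; congr fine.
by rewrite (integral_pushforward (@measurable_addc c [set: R]) mg' ig' mD) preimage_cc.
Qed.

Lemma prim_cat a b c f g : measurable_fun [set: R] g -> a <= b -> b <= c ->
  prim a b f g -> prim b c f g -> prim a c f g.
Proof.
move=> mg ab bc fg1 fg2.
have mgD (D : set R) : measurable_fun D g by apply: (@measurable_funS _ _ _ _ [set: R]).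
have ig : integ a c g.
  have U : `[a, c]%classic = `[a, b]%classic `|` `]b, c]%classic :> set R.
    by rewrite -itv_bndbnd_setU// bnd_simp.
  apply/integrableP; split; first by apply/measurable_EFinP; exact: mgD.
  rewrite U ge0_integral_setU//=.
  - have /integrableP[_ i1] := fg1.1.
    have /integrableP[_ i2] : mu.-integrable `]b, c] (EFin \o g).
      by apply: integrableS fg2.1 => //; exact: subset_itv_oc_cc.
    exact: lte_add_pinfty.
  - by apply/measurable_EFinP; apply: measurableT_comp => //; exact: mgD.
  - apply/disj_setPS => x [/=]; rewrite !in_itv/= => /andP[_ xb] /andP[].
    by rewrite ltNge xb.
split => // x /andP[ax xc]; have [xb|bx] := leP x b.
  by rewrite fg1.2// ax.
rewrite (@itg_cat _ b)//; last 2 first.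
- exact: ltW.
- by apply: integS ig.
rewrite fg2.2 ?(ltW bx)// (fg1.2 b) ?ab ?lexx//; ring.
Qed.

(** The identity on [[0, 1]] is translated to every [[n, n + 1]] and concatenated. The increment [k]
    covers both cases in use: 1 for [y], and 0 for [U], [P] and [Q]. *)
Lemma periodic_gprim k f g : measurable_fun [set: R] g ->
  (forall x, f (x + 1) = f x + k) ->
  {ae mu, forall x, g (x + 1) = g x} -> prim 0 1 f g -> gprim f g.
Proof.
move=> mg fp gp fg; split => //.
have gm : {ae mu, forall x, g (x + -1) = g x}.
  by apply: (ae_imp (ae_shift (-1) gp)) => x; rewrite subrK => ->.
have mgc c : measurable_fun [set: R] (fun x => g (x + c)).
  by apply: (measurableT_comp mg); exact: (@measurable_addc c).
have shift c k' a b : (forall x, f (x + c) = f x + k') ->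
    {ae mu, forall x, g (x + c) = g x} -> prim a b f g ->
    prim (a + c) (b + c) f g.
  move=> fc gc pab.
  have gc' (D : R -> bool) : {ae mu, forall x, D x -> g x = g (x + c)}.
    by apply: (ae_imp gc) => x ->.
  have igc : integ a b (fun x => g (x + c)).
    by apply: integ_ae pab.1 (gc' _); apply: (@measurable_funS _ _ _ _ [set: R]).
  have [igs _] := itg_shift mg igc.
  apply: primP => // x y ax xy yb.
  have [ax' yb'] : a <= x - c /\ y - c <= b by split; lra.
  have xy' : x - c <= y - c by lra.
  have ig' : integ (x - c) (y - c) (fun x => g (x + c)) by exact: integS igc.
  have := (itg_shift mg ig').2; rewrite !subrK => ->.
  have -> : itg (x - c) (y - c) (fun x => g (x + c)) = itg (x - c) (y - c) g.
    apply/esym/itg_ae => //; first exact: integS pab.1.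
  rewrite -(prim_diff pab)//.
  by have := fc (x - c); have := fc (y - c); rewrite !subrK => -> ->; ring.
have fm x : f (x + -1) = f x + - k.
  by have := fp (x - 1); rewrite subrK => ->; ring.
have up (n : nat) : prim 0 n.+1%:R f g /\ prim n%:R n.+1%:R f g.
  elim: n => [|n [IH1 IH2]]; first by [].
  have H : prim n.+1%:R n.+2%:R f g.
    by rewrite -[n.+2]addn1 -[in n.+1%:R]addn1 !natrD; apply: shift fp gp _.
  by split => //; apply: prim_cat IH1 H => //; rewrite ?ler_nat// ler0n.
have dn (n : nat) : prim (- n.+1%:R) 0 f g /\ prim (- n.+1%:R) (- n%:R) f g.
  elim: n => [|n [IH1 IH2]].
    have := shift _ _ _ _ fm gm fg; rewrite add0r subrr => H.
    by rewrite oppr0.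
  have H : prim (- n.+2%:R) (- n.+1%:R) f g.
    rewrite -[n.+2]addn1 -[in X in prim _ X]addn1 !natrD !opprD.
    exact: shift fm gm IH2.
  by split => //; apply: prim_cat H IH1 => //; rewrite ?lerN2 ?ler_nat// oppr_le0 ler0n.
move=> a b ab.
pose n := Num.bound (Num.max `|a| `|b|).
have hn : Num.max `|a| `|b| < n.+1%:R.
  apply: lt_le_trans (archi_boundP _) _; first by rewrite le_max normr_ge0.
  by rewrite ler_nat.
move: hn; rewrite gt_max !ltr_norml => /andP[/andP[a1 a2] /andP[b1 b2]].
apply: (@primS _ (- n.+1%:R) n.+1%:R); [exact: ltW|exact: ltW|].
by apply: prim_cat (dn n).1 (up n).1 => //; rewrite ?oppr_le0.
Qed.

End Translation.

(** * The norm of E as a real number *)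

Section Norms.
Variable R : realType.
Local Notation mu := (@lebesgue_measure R).
Local Notation quad := ((R -> R) * (R -> R) * (R -> R) * (R -> R))%type.
Implicit Types (z g f : R -> R) (v w : quad).

(** A violation at one point would spread by continuity to a nondegenerate interval, contained in a
    null set. *)
Lemma ae_cont_le z (a b D : R) : a < b -> continuous z ->
  {ae mu, forall x, a <= x <= b -> `|z x| <= D} ->
  forall x, a <= x <= b -> `|z x| <= D.
Proof.
move=> ab cz [N [mN N0 PN]] x /andP[ax xb]; rewrite leNgt; apply/negP => Dz.
have e0 : 0 < `|z x| - D by rewrite subr_gt0.
have /cvgrPdist_lt /(_ _ e0) [d /= d0 Hd] := cz x.
pose c1 := Num.max a (x - d / 2); pose c2 := Num.min b (x + d / 2).
have d2 : 0 < d / 2 by rewrite divr_gt0.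
have c12 : c1 < c2.
  by rewrite /c1 /c2 gt_max !lt_min ab; apply/andP; split; lra.
have sub : `[c1, c2]%classic `<=` N.
  move=> t /=; rewrite in_itv/= /c1 /c2 ge_max le_min.
  move=> /andP[/andP[at' xt] /andP[tb tx]]; apply: PN => /= H.
  have := H; rewrite at' tb => /(_ isT).
  apply/negP; rewrite -ltNge.
  have : `|z x - z t| < `|z x| - D.
    by apply: Hd => /=; rewrite ltr_distlC; apply/andP; split; lra.
  have := ler_normD (z x - z t) (z t); rewrite subrK; lra.
have : (mu `[c1, c2]%classic <= mu N)%E by apply: le_measure => //; rewrite inE.
rewrite N0 lebesgue_measure_itv/= lte_fin c12 leNgt => /negP; apply.
by rewrite -EFinB lte_fin subr_gt0.
Qed.

Lemma mu_setT_gt0 : (0 < mu [set: R])%E.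
Proof.
apply: (@lt_le_trans _ _ (mu `[0, 1]%classic)).
  by rewrite lebesgue_measure_itv/= lte_fin ltr01 -EFinB lte_fin subr0.
by apply: le_measure => //; rewrite inE.
Qed.

Lemma LnormIoo_leP (z : R -> R) (a b D : R) : 0 <= D ->
  (LnormI +oo%E a b z <= D%:E)%E <-> {ae mu, forall x, a <= x <= b -> `|z x| <= D}.
Proof.
move=> D0; rewrite /LnormI unlock mu_setT_gt0; split.
  move=> /ess_supP H; apply: (ae_imp H) => x /=; rewrite patchE mem_setE in_itv/=.
  by move=> + xab; rewrite xab lee_fin.
move=> H; apply/ess_supP; apply: (ae_imp H) => x /=; rewrite patchE mem_setE in_itv/=.
by case: ifPn => [xab /(_ isT)|_ _]; rewrite lee_fin ?normr0.
Qed.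

(** The essential supremum over [[0, 1]] that occurs in the norm, as a real. For continuous [z] it
    is the true supremum, by [supn_ub] and [supn_le]. *)
Definition supn (z : R -> R) : R := fine (LnormI +oo%E 0 1 z).

Lemma LnormIoo_ge0 (z : R -> R) (a b : R) : (0 <= LnormI +oo%E a b z)%E.
Proof. exact: Lnorm_ge0. Qed.

Lemma supn_fin z : continuous z -> LnormI +oo%E 0 1 z = (supn z)%:E.
Proof.
move=> cz; rewrite /supn fineK// ge0_fin_numE ?LnormIoo_ge0//.
have [M HM] := within_cont_bnd ler01 (continuous_subspaceT cz).
have M0 : 0 <= M by apply: le_trans (HM 0 _) => //; rewrite lexx ler01.
apply: (@le_lt_trans _ _ M%:E); last exact: ltry.
by apply/(LnormIoo_leP _ _ _ M0); apply: aeW => x; exact: HM.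
Qed.

Lemma supn_ge0 z : 0 <= supn z.
Proof. by rewrite /supn fine_ge0// LnormIoo_ge0. Qed.

Lemma supn_ub z x : continuous z -> 0 <= x <= 1 -> `|z x| <= supn z.
Proof.
move=> cz; apply: (ae_cont_le ltr01 cz).
by apply/(LnormIoo_leP _ _ _ (supn_ge0 z)); rewrite supn_fin.
Qed.

Lemma supn_le z D : continuous z -> (forall x, 0 <= x <= 1 -> `|z x| <= D) ->
  supn z <= D.
Proof.
move=> cz H; have D0 : 0 <= D by apply: le_trans (H 0 _) => //; rewrite lexx ler01.
rewrite -lee_fin -supn_fin//; apply/(LnormIoo_leP _ _ _ D0).
by apply: aeW => x; exact: H.
Qed.

Lemma gprimD f f' g g' : gprim f g -> gprim f' g' ->
  gprim (fun x => f x + f' x) (fun x => g x + g' x).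
Proof.
move=> [mg fg] [mg' fg']; split; first exact: measurable_funD.
by move=> a b ab; exact: primD (fg _ _ ab) (fg' _ _ ab).
Qed.

Lemma gprimZ (k : R) f g : gprim f g -> gprim (fun x => k * f x) (fun x => k * g x).
Proof.
move=> [mg fg]; split; first exact: measurable_funM.
by move=> a b ab; exact: primZ (fg _ _ ab).
Qed.

Lemma W11perP z : W11per z <-> (exists g, gprim z g) /\ periodic z 1.
Proof.
split=> [[Wz cz pz]|[[g zg] pz]].
  by split => //; exists (wderiv z); exact: W1ploc_gprim.
by split => //; [exact: gprim_W1ploc zg|exact: gprim_cont zg].
Qed.

Lemma W11per_gprim z : W11per z -> gprim z (wderiv z).
Proof. by move=> [Wz cz pz]; exact: W1ploc_gprim. Qed.

Lemma W11per_cont z : W11per z -> continuous z.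
Proof. by move=> []. Qed.

Lemma gprim_integ f g a b : gprim f g -> integ a b g.
Proof. by move=> /gprim_Lploc/Lploc1P[_]. Qed.

Lemma itg_ae_norm (a b : R) f g : integ a b f -> integ a b g ->
  {ae mu, forall x, f x = g x} ->
  itg a b (fun x => `|f x|) = itg a b (fun x => `|g x|).
Proof.
move=> fi gi fg; apply: itg_ae; [exact: integ_norm|exact: integ_norm|].
by apply: (ae_imp fg) => x -> _.
Qed.

Lemma normW11perE z g : gprim z g ->
  normW11per z = (supn z + itg 0 1 (fun x => `|g x|))%:E.
Proof.
move=> zg; have [zw wg] := wderiv_gprim zg.
rewrite /normW11per (supn_fin (gprim_cont zg)) LnormI1_itg; last exact: gprim_integ zw.
rewrite EFinD; congr (_ + _%:E)%E; apply: itg_ae_norm => //.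
  exact: gprim_integ zw.
exact: gprim_integ zg.
Qed.

Lemma L1per_integ f a b : L1per f -> integ a b f.
Proof. by move=> [/Lploc1P[_ H] _]. Qed.

Lemma L1per_mfun f : L1per f -> measurable_fun [set: R] f.
Proof. by move=> [[]]. Qed.

Lemma L1perP f : measurable_fun [set: R] f -> (forall a b, integ a b f) ->
  {ae mu, forall x, f (x + 1) = f x} -> L1per f.
Proof. by move=> mf fi pf; split => //; apply/Lploc1P. Qed.

Lemma L1perD f g : L1per f -> L1per g -> L1per (fun x => f x + g x).
Proof.
move=> Lf Lg; apply: L1perP.
- by apply: measurable_funD; exact: L1per_mfun.
- by move=> a b; apply: integD; exact: L1per_integ.
- by apply: (ae_imp2 Lf.2 Lg.2) => x -> ->.
Qed.

Lemma L1perZ (k : R) f : L1per f -> L1per (fun x => k * f x).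
Proof.
move=> Lf; apply: L1perP.
- by apply: measurable_funM => //; exact: L1per_mfun.
- by move=> a b; apply: integZ; exact: L1per_integ.
- by apply: (ae_imp Lf.2) => x ->.
Qed.

Lemma W11perD f g : W11per f -> W11per g -> W11per (fun x => f x + g x).
Proof.
move=> /W11perP[[f' Hf] pf] /W11perP[[g' Hg] pg]; apply/W11perP; split.
  by exists (fun x => f' x + g' x); exact: gprimD.
by move=> x; rewrite pf pg.
Qed.

Lemma W11perZ (k : R) f : W11per f -> W11per (fun x => k * f x).
Proof.
move=> /W11perP[[f' Hf] pf]; apply/W11perP; split.
  by exists (fun x => k * f' x); exact: gprimZ.
by move=> x; rewrite pf.
Qed.

Lemma in_BD v w : in_B v -> in_B w -> in_B (v + w).
Proof.
case: v => [[[z U] n] r]; case: w => [[[z' U'] n'] r'] [h1 h2 h3 h4] [k1 k2 k3 k4].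
by split; [exact: W11perD|exact: W11perD|exact: L1perD|exact: L1perD].
Qed.

Lemma in_BZ (k : R) v : in_B v -> in_B (k *: v).
Proof.
case: v => [[[z U] n] r] [h1 h2 h3 h4].
by split; [exact: W11perZ|exact: W11perZ|exact: L1perZ|exact: L1perZ].
Qed.

Lemma in_BB v w : in_B v -> in_B w -> in_B (v - w).
Proof. by move=> hv hw; rewrite -scaleN1r; apply: in_BD => //; exact: in_BZ. Qed.

Definition nB v : R := fine (normB v).

Lemma normBE (z U n r gz gU : R -> R) : gprim z gz -> gprim U gU ->
  integ 0 1 n -> integ 0 1 r ->
  normB (z, U, n, r) = (supn z + itg 0 1 (fun x => `|gz x|) +
    (supn U + itg 0 1 (fun x => `|gU x|)) + itg 0 1 (fun x => `|n x|)
    + itg 0 1 (fun x => `|r x|))%:E.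
Proof.
move=> pz pU ni ri; rewrite /normB (normW11perE pz) (normW11perE pU).
by rewrite /normL1per !LnormI1_itg// -!EFinD.
Qed.

Lemma nBE (z U n r gz gU : R -> R) : gprim z gz -> gprim U gU ->
  integ 0 1 n -> integ 0 1 r ->
  nB (z, U, n, r) = supn z + itg 0 1 (fun x => `|gz x|) +
    (supn U + itg 0 1 (fun x => `|gU x|)) + itg 0 1 (fun x => `|n x|)
    + itg 0 1 (fun x => `|r x|).
Proof. by move=> pz pU ni ri; rewrite /nB (normBE pz pU ni ri). Qed.

Lemma normB_fin v : in_B v -> normB v = (nB v)%:E.
Proof.
case: v => [[[z U] n] r] [h1 h2 h3 h4].
have pz := W11per_gprim h1; have pU := W11per_gprim h2.
have ni := L1per_integ 0 1 h3; have ri := L1per_integ 0 1 h4.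
by rewrite (nBE pz pU ni ri) (normBE pz pU ni ri).
Qed.

Lemma nB_ge0 v : 0 <= nB v.
Proof.
case: v => [[[z U] n] r]; rewrite /nB fine_ge0// /normB /normW11per /normL1per.
by rewrite !adde_ge0// Lnorm_ge0.
Qed.

Lemma nBD v w : in_B v -> in_B w -> nB (v + w) <= nB v + nB w.
Proof.
case: v => [[[z U] n] r]; case: w => [[[z' U'] n'] r'] [h1 h2 h3 h4] [k1 k2 k3 k4].
have pz := W11per_gprim h1; have pU := W11per_gprim h2.
have ni := L1per_integ 0 1 h3; have ri := L1per_integ 0 1 h4.
have pz' := W11per_gprim k1; have pU' := W11per_gprim k2.
have ni' := L1per_integ 0 1 k3; have ri' := L1per_integ 0 1 k4.
rewrite (nBE pz pU ni ri) (nBE pz' pU' ni' ri').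
have -> : (z, U, n, r) + (z', U', n', r') = ((fun x => z x + z' x), (fun x => U x + U' x),
   (fun x => n x + n' x), (fun x => r x + r' x)) by [].
rewrite (nBE (gprimD pz pz') (gprimD pU pU') (integD ni ni') (integD ri ri')).
have iD f g : integ 0 1 f -> integ 0 1 g ->
    itg 0 1 (fun x => `|f x + g x|) <= itg 0 1 (fun x => `|f x|) + itg 0 1 (fun x => `|g x|).
  move=> fi gi; rewrite -itgD; [|exact: integ_norm|exact: integ_norm].
  apply: itg_le; [exact/integ_norm/integD|exact: integD (integ_norm fi) (integ_norm gi)|].
  by move=> x _; exact: ler_normD.
have sD f g : continuous f -> continuous g -> continuous (fun x => f x + g x) ->
    supn (fun x => f x + g x) <= supn f + supn g.
  move=> cf cg cfg; apply: supn_le => // x x01; apply: (le_trans (ler_normD _ _)).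
  by apply: lerD; exact: supn_ub.
have s1 := sD _ _ (W11per_cont h1) (W11per_cont k1) (W11per_cont (W11perD h1 k1)).
have s2 := sD _ _ (W11per_cont h2) (W11per_cont k2) (W11per_cont (W11perD h2 k2)).
have i1 := iD _ _ (gprim_integ 0 1 pz) (gprim_integ 0 1 pz').
have i2 := iD _ _ (gprim_integ 0 1 pU) (gprim_integ 0 1 pU').
have i3 := iD _ _ ni ni'; have i4 := iD _ _ ri ri'.
have AC (a b c a' b' c' : R) : a <= b + c -> a' <= b' + c' ->
  a + a' <= b + b' + (c + c') by move=> h h'; rewrite addrACA lerD.
exact: AC (AC _ _ _ _ _ _ (AC _ _ _ _ _ _ (AC _ _ _ _ _ _ s1 i1)
  (AC _ _ _ _ _ _ s2 i2)) i3) i4.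
Qed.

Lemma nBZ (k : R) v : in_B v -> nB (k *: v) <= `|k| * nB v.
Proof.
case: v => [[[z U] n] r] [h1 h2 h3 h4].
have pz := W11per_gprim h1; have pU := W11per_gprim h2.
have ni := L1per_integ 0 1 h3; have ri := L1per_integ 0 1 h4.
rewrite (nBE pz pU ni ri).
have -> : k *: (z, U, n, r) = ((fun x => k * z x), (fun x => k * U x),
   (fun x => k * n x), (fun x => k * r x)) by [].
rewrite (nBE (gprimZ k pz) (gprimZ k pU) (integZ k ni) (integZ k ri)).
have iZ f : integ 0 1 f ->
    itg 0 1 (fun x => `|k * f x|) <= `|k| * itg 0 1 (fun x => `|f x|).
  move=> fi; rewrite -itgZ; last exact: integ_norm.
  by rewrite le_eqVlt; apply/orP; left; apply/eqP/eq_itg => x _; exact: normrM.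
have sZ f : continuous f -> continuous (fun x => k * f x) ->
    supn (fun x => k * f x) <= `|k| * supn f.
  move=> cf ckf; apply: supn_le => // x x01; rewrite normrM ler_wpM2l//.
  exact: supn_ub.
have s1 := sZ _ (W11per_cont h1) (W11per_cont (W11perZ k h1)).
have s2 := sZ _ (W11per_cont h2) (W11per_cont (W11perZ k h2)).
have AM (a b c d : R) : a <= `|k| * b -> c <= `|k| * d -> a + c <= `|k| * (b + d).
  by move=> h h'; rewrite mulrDr lerD.
have i1 := iZ _ (gprim_integ 0 1 pz); have i2 := iZ _ (gprim_integ 0 1 pU).
exact: AM (AM _ _ _ _ (AM _ _ _ _ (AM _ _ _ _ s1 i1) (AM _ _ _ _ s2 i2)) (iZ _ ni))
  (iZ _ ri).
Qed.

Lemma nBB v w : in_B v -> in_B w -> nB (v - w) <= nB v + nB w.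
Proof.
move=> hv hw; rewrite -scaleN1r; apply: (le_trans (nBD hv (in_BZ (-1) hw))).
by rewrite lerD2l; apply: (le_trans (nBZ (-1) hw)); rewrite normrN normr1 mul1r.
Qed.

Lemma eqB_normB v w : in_B v -> in_B w -> eqB v w -> normB v = normB w.
Proof.
case: v => [[[z U] n] r]; case: w => [[[z' U'] n'] r'].
move=> [_ _ h3 h4] [_ _ k3 k4] [-> -> nn rr]; rewrite /normB /normL1per.
have ni := L1per_integ 0 1 h3; have ri := L1per_integ 0 1 h4.
have ni' := L1per_integ 0 1 k3; have ri' := L1per_integ 0 1 k4.
rewrite !LnormI1_itg//; do !congr (_ + _)%E; congr EFin; exact: itg_ae_norm.
Qed.

Lemma periodic_frac (f : R -> R) : periodic f 1 ->
  forall x, f x = f (x - (Num.floor x)%:~R).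
Proof.
move=> pf.
have fn (m : nat) x : f (x + m%:R) = f x.
  by have := periodicn pf m x; rewrite -mulr_natr mul1r.
move=> x; case: (Num.floor x) => m; first by rewrite -{1}(subrK m%:R x) fn.
by rewrite NegzE mulrNz opprK fn.
Qed.

(** Such an [f] is a density of the zero function on [[0, 1]], hence by periodicity on the line, and
    densities are unique almost everywhere. *)
Lemma L1per_eq0 f : L1per f -> itg 0 1 (fun x => `|f x|) <= 0 ->
  {ae mu, forall x, f x = 0}.
Proof.
move=> Lf If; have fi := L1per_integ 0 1 Lf.
have p0 : prim 0 1 (fun=> 0) f.
  apply: primP => // x y x0 xy y1; rewrite subrr; apply/esym/eqP.
  rewrite -normr_le0 (le_trans _ If)// (le_trans (le_norm_itg (integS x0 y1 fi)))//.
  exact: itg_sub_le (integ_norm fi) _.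
have H : gprim (fun=> 0) f.
  by apply: (periodic_gprim (k := 0)) (L1per_mfun Lf) _ Lf.2 p0 => x; rewrite addr0.
apply: gprim_unique H _; split => // a b ab; exact: prim_cst.
Qed.

Lemma nB_eq0 v : in_B v -> nB v <= 0 -> eqB v 0.
Proof.
case: v => [[[z U] n] r] [h1 h2 h3 h4].
have pz := W11per_gprim h1; have pU := W11per_gprim h2.
have ni := L1per_integ 0 1 h3; have ri := L1per_integ 0 1 h4.
have I0 (f : R -> R) : 0 <= itg 0 1 (fun x => `|f x|) by exact: itg_ge0.
rewrite (nBE pz pU ni ri).
have := supn_ge0 z; have := supn_ge0 U.
have := I0 (wderiv z); have := I0 (wderiv U); have := I0 n; have := I0 r.
set a1 := itg 0 1 _; set a2 := itg 0 1 _; set a3 := itg 0 1 _; set a4 := itg 0 1 _.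
move=> i1 i2 i3 i4 s1 s2 H.
have [z0 U0 n0 r0] : [/\ supn z <= 0, supn U <= 0, a2 <= 0 & a1 <= 0].
  by clear -i1 i2 i3 i4 s1 s2 H; split; lra.
have per0 f : W11per f -> supn f <= 0 -> f = 0.
  move=> [_ cf pf] s0.
  have f0 x : 0 <= x <= 1 -> f x = 0.
    move=> x01; apply/eqP; rewrite -normr_le0; apply: le_trans s0.
    exact: supn_ub.
  apply/funext => x; rewrite (periodic_frac pf) f0//.
  have := floor_itv x; rewrite intrD; lra.
by split; [exact: per0|exact: per0|exact: L1per_eq0|exact: L1per_eq0].
Qed.

End Norms.

(** * The right-hand side in E and uniqueness *)

Section PeriodicExtension.
Variable R : realType.
Local Notation mu := (@lebesgue_measure R).

Definition frac (x : R) : R := x - (Num.floor x)%:~R.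

Lemma fracD1 (x : R) : frac (x + 1) = frac x.
Proof. by rewrite /frac floorDrz ?int_num1// floor1 intrD opprD addrACA subrr addr0. Qed.

Lemma frac_itv (x : R) : 0 <= frac x < 1.
Proof. by have := floor_itv x; rewrite /frac intrD; lra. Qed.

Lemma frac01 (x : R) : 0 <= frac x <= 1.
Proof. by have /andP[-> /ltW ->] := frac_itv x. Qed.

Lemma frac_id (x : R) : 0 <= x < 1 -> frac x = x.
Proof.
by move=> x01; rewrite /frac (@floor_def _ x 0) ?subr0.
Qed.

Lemma frac1 : frac 1 = 0.
Proof. by rewrite /frac floor1 subrr. Qed.

Lemma measurable_frac : measurable_fun [set: R] frac.
Proof.
apply: measurable_funB => //; apply: nondecreasing_measurable => // x y xy.
by rewrite ler_int le_floor.
Qed.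

Lemma extE (f : R -> R) x : periodic_extension f x = f (frac x).
Proof. by []. Qed.

(** Agreement of [f] at the two ends matters because [frac] jumps back to 0 at [x = 1]. It is
    supplied by [kP_per] and [kQ_per]. *)
Lemma ext01 (f : R -> R) x : f 1 = f 0 -> 0 <= x <= 1 -> f (frac x) = f x.
Proof.
move=> f10 /andP[x0]; rewrite le_eqVlt => /predU1P[->|x1]; first by rewrite frac1.
by rewrite frac_id ?x0.
Qed.

Lemma measurable_ext (f : R -> R) : measurable_fun (`[0, 1] : set R) f ->
  measurable_fun [set: R] (fun x => f (frac x)).
Proof.
move=> mf.
have -> : (fun x => f (frac x)) = (f \_ (`[0, 1]%classic : set R)) \o frac.
  by apply/funext => x /=; rewrite patchE mem_setE in_itv/= frac01.
apply: measurableT_comp measurable_frac.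
by apply/(measurable_restrictT _ _).1.
Qed.

End PeriodicExtension.

Section StateFacts.
Variable R : realType.
Local Notation mu := (@lebesgue_measure R).
Implicit Types X : state R.

Section One.
Variable X : state R.
Hypothesis EX : in_E X.
Local Notation y := (sy X).
Local Notation U := (sU X).
Local Notation n := (snu X).
Local Notation p := (wderiv (sy X)).
Local Notation w := (wderiv (sU X)).
Local Notation d := (dens U p n).

Lemma E_zeta : W11per (fun x => sy X x - x). Proof. by have [] := EX. Qed.
Lemma E_U : W11per U. Proof. by have [] := EX. Qed.
Lemma E_n : L1per n. Proof. by have [] := EX. Qed.
Lemma E_r : L1per (sr X). Proof. by have [] := EX. Qed.

Lemma gprim_id : gprim (fun x : R => x) (fun=> 1).
Proof. by split => // a b _; exact: prim_id. Qed.

Lemma E_py : gprim y p.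
Proof.
have H := gprimD (W11per_gprim E_zeta) gprim_id.
have Ey : (fun x => y x - x + x) = y by apply/funext => x; rewrite subrK.
by rewrite Ey in H; have [] := wderiv_gprim H.
Qed.

Lemma E_pU : gprim U w. Proof. exact: W11per_gprim E_U. Qed.

Lemma E_pzeta : gprim (fun x => y x - x) (fun x => p x - 1).
Proof.
have H := gprimD E_py (gprimZ (-1) gprim_id).
have -> : (fun x => y x - x) = (fun x => y x + -1 * x).
  by apply/funext => x; rewrite mulN1r.
have -> : (fun x => p x - 1) = (fun x => p x + -1 * 1).
  by apply/funext => x; rewrite mulr1.
exact: H.
Qed.

Lemma E_yper x : y (x + 1) = y x + 1.
Proof. by have [_ _ /(_ x)] := E_zeta; lra. Qed.

Lemma E_y1 : y 1 = y 0 + 1.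
Proof. by have := E_yper 0; rewrite add0r. Qed.

Lemma E_Uper x : U (x + 1) = U x.
Proof. by have [_ _ /(_ x)] := E_U. Qed.

Lemma gprim_periodic (f g : R -> R) (k : R) : gprim f g ->
  (forall x, f (x + 1) = f x + k) -> {ae mu, forall x, g (x + 1) = g x}.
Proof.
move=> [mg fg] fk.
have mg1 : measurable_fun [set: R] (fun x => g (x + 1)).
  by apply: (measurableT_comp mg); exact: (@measurable_addc R 1).
suff H : gprim f (fun x => g (x + 1)) by exact: gprim_unique H (conj mg fg).
have key a b : a <= b -> integ a b (fun x => g (x + 1)) /\
    itg a b (fun x => g (x + 1)) = itg (a + 1) (b + 1) g.
  move=> ab; have ab1 : a + 1 <= b + 1 by rewrite lerD2r.
  have E : (fun x => g (x + -1 + 1)) = g by apply/funext => x; rewrite subrK.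
  have ig : integ (a + 1) (b + 1) (fun x => g (x + -1 + 1)).
    by rewrite E; exact: (fg _ _ ab1).1.
  have [] := itg_shift mg1 ig; rewrite !addrK E => h1 h2; by split.
split => // a b ab; apply: primP; first exact: (key _ _ ab).1.
move=> x y' ax xy yb; rewrite (key _ _ xy).2.
have ab1 : x + 1 <= y' + 1 by rewrite lerD2r.
rewrite -(prim_diff (fg _ _ ab1) (lexx _) ab1 (lexx _)) !fk; ring.
Qed.

Lemma E_pper : {ae mu, forall x, p (x + 1) = p x}.
Proof. exact: gprim_periodic E_py E_yper. Qed.

Lemma E_wper : {ae mu, forall x, w (x + 1) = w x}.
Proof.
by apply: (gprim_periodic (k := 0)) E_pU _ => x; rewrite addr0; exact: E_Uper.
Qed.

Lemma E_cy : {within `[0, 1], continuous y}.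
Proof. exact: continuous_subspaceT (gprim_cont E_py). Qed.

Lemma E_prims : prim 0 1 y p /\ prim 0 1 U w.
Proof. by split; [exact: E_py.2|exact: E_pU.2]. Qed.

Lemma E_id : integ 0 1 d.
Proof.
apply: integD (L1per_integ 0 1 E_n).
by have [py pU] := E_prims; exact: integ_sqrM pU py.1.
Qed.

Lemma E_md : measurable_fun [set: R] d.
Proof.
apply: measurable_funD; last exact: L1per_mfun E_n.
apply: measurable_funM; last exact: E_py.1.
by apply: measurable_funX; apply: continuous_measurable_fun; exact: gprim_cont E_pU.
Qed.

Lemma E_dper : {ae mu, forall x, d (x + 1) = d x}.
Proof.
by apply: (ae_imp2 E_pper E_n.2) => x h1 h2; rewrite /dens h1 h2 E_Uper.
Qed.

Lemma PE x : P X x = kP y d (frac x).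
Proof.
by rewrite /P extE P01_kP ?frac01//; [exact: E_cy|exact: E_id].
Qed.

Lemma QE x : Q X x = kQ y d (frac x).
Proof.
by rewrite /Q extE Q01_kQ ?frac01//; [exact: E_cy|exact: E_id].
Qed.

Lemma P01E x : 0 <= x <= 1 -> P X x = kP y d x.
Proof.
by move=> x01; rewrite PE (ext01 (kP_per E_cy E_id E_y1) x01).
Qed.

Lemma Q01E x : 0 <= x <= 1 -> Q X x = kQ y d x.
Proof.
by move=> x01; rewrite QE (ext01 (kQ_per E_cy E_id E_y1) x01).
Qed.

Lemma P_per x : P X (x + 1) = P X x. Proof. by rewrite !PE fracD1. Qed.
Lemma Q_per x : Q X (x + 1) = Q X x. Proof. by rewrite !QE fracD1. Qed.

Lemma measurable_P : measurable_fun [set: R] (P X).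
Proof.
rewrite (_ : P X = fun x => kP y d (frac x)); last by apply/funext => x; exact: PE.
apply: measurable_ext; apply: within_cont_mfun.
have [py _] := E_prims; exact: prim_cont ler01 (prim_kP_kQ E_cy E_id py).1.
Qed.

Lemma measurable_Q : measurable_fun [set: R] (Q X).
Proof.
rewrite (_ : Q X = fun x => kQ y d (frac x)); last by apply/funext => x; exact: QE.
apply: measurable_ext; apply: within_cont_mfun.
have [py _] := E_prims; exact: prim_cont ler01 (prim_kP_kQ E_cy E_id py).2.
Qed.

Lemma gprim_P : gprim (P X) (fun x => Q X x * p x).
Proof.
apply: (periodic_gprim (k := 0)).
- by apply: measurable_funM; [exact: measurable_Q|exact: E_py.1].
- by move=> x; rewrite addr0 P_per.
- by apply: (ae_imp E_pper) => x ->; rewrite Q_per.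
have [py _] := E_prims; apply: eq_prim (prim_kP_kQ E_cy E_id py).1 => x x01.
  by rewrite P01E.
by rewrite Q01E.
Qed.

Lemma gprim_Q : gprim (Q X) (fun x => P X x * p x - 2^-1 * d x).
Proof.
apply: (periodic_gprim (k := 0)).
- apply: measurable_funB; last by apply: measurable_funM => //; exact: E_md.
  by apply: measurable_funM; [exact: measurable_P|exact: E_py.1].
- by move=> x; rewrite addr0 Q_per.
- by apply: (ae_imp2 E_pper E_dper) => x -> ->; rewrite P_per.
have [py _] := E_prims; apply: eq_prim (prim_kP_kQ E_cy E_id py).2 => x x01.
  by rewrite Q01E.
by rewrite P01E.
Qed.

Definition nu_t (x : R) : R :=
  - 2 * Q X x * U x * p x + (3 * U x ^+ 2 - 2 * P X x) * w x.

Lemma gprim_integ_cM (f g h : R -> R) a b : continuous h -> gprim f g ->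
  integ a b (fun x => h x * g x).
Proof.
move=> ch fg; have [ab|ba] := leP a b.
  exact: integ_cM ab (continuous_subspaceT ch) (gprim_integ a b fg).
rewrite /integ set_itv_ge ?bnd_simp -?ltNge//; apply/integrableP; split.
  exact: measurable_fun_set0.
by rewrite integral_set0.
Qed.

Lemma nu_t_coef : continuous (fun x => - 2 * Q X x * U x) /\
  continuous (fun x => 3 * U x ^+ 2 - 2 * P X x).
Proof.
have cU := gprim_cont E_pU; have cQ := gprim_cont gprim_Q; have cP := gprim_cont gprim_P.
split=> x.
  apply: cvgM; last exact: cU.
  by apply: cvgM; [exact: cvg_cst|exact: cQ].
apply: cvgB.
  by apply: cvgM; [exact: cvg_cst|apply: cvgM; exact: cU].
by apply: cvgM; [exact: cvg_cst|exact: cP].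
Qed.

Lemma L1per_nu_t : L1per nu_t.
Proof.
have [c1 c2] := nu_t_coef.
have i1 a b := gprim_integ_cM a b c1 E_py.
have i2 a b := gprim_integ_cM a b c2 E_pU.
apply: L1perP.
- apply: measurable_funD; apply: measurable_funM.
  + exact: continuous_measurable_fun c1.
  + exact: E_py.1.
  + exact: continuous_measurable_fun c2.
  + exact: E_pU.1.
- by move=> a b; exact: integD (i1 a b) (i2 a b).
- by apply: (ae_imp2 E_pper E_wper) => x h1 h2; rewrite /nu_t h1 h2 Q_per P_per E_Uper.
Qed.

Lemma gprimN (f g : R -> R) : gprim f g -> gprim (fun x => - f x) (fun x => - g x).
Proof.
move=> H; have := gprimZ (-1) H.
rewrite (_ : (fun x => -1 * f x) = (fun x => - f x)); last first.
  by apply/funext => x; rewrite mulN1r.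
by rewrite (_ : (fun x => -1 * g x) = (fun x => - g x))//; apply/funext => x; rewrite mulN1r.
Qed.

Lemma in_B_rhs : in_B (rhs X).
Proof.
split.
- exact: E_U.
- apply/W11perP; split; last by move=> x /=; rewrite Q_per.
  by exists (fun x => - (P X x * p x - 2^-1 * d x)); exact: gprimN gprim_Q.
- exact: L1per_nu_t.
- apply: L1perP => //; last exact: aeW.
  by move=> a b; exact: integ_cst.
Qed.

End One.
End StateFacts.

(** * Lipschitz estimate of the right-hand side in E *)

Section RhsLipschitz.
Variable R : realType.
Local Notation mu := (@lebesgue_measure R).
Implicit Types X Y : state R.

Definition E_bounded (M : R) X :=
  bounded01 M (sy X) (wderiv (sy X)) (sU X) (wderiv (sU X)) (snu X).

Lemma gprimB (f f' g g' : R -> R) : gprim f g -> gprim f' g' ->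
  gprim (fun x => f x - f' x) (fun x => g x - g' x).
Proof. by move=> fg fg'; exact: gprimD fg (gprimN fg'). Qed.

Lemma dist_parts X Y : in_E X -> in_E Y ->
  let D := nB (coordE X - coordE Y) in
  [/\ forall x : R, 0 <= x <= 1 -> `|sy X x - sy Y x| <= D,
      forall x : R, 0 <= x <= 1 -> `|sU X x - sU Y x| <= D,
      itg 0 1 (fun x => `|wderiv (sy X) x - wderiv (sy Y) x|) <= D,
      itg 0 1 (fun x => `|wderiv (sU X) x - wderiv (sU Y) x|) <= D &
      itg 0 1 (fun x => `|snu X x - snu Y x|) <= D].
Proof.
move=> EX EY D.
have pz := gprimB (E_pzeta EX) (E_pzeta EY).
have pU := gprimB (E_pU EX) (E_pU EY).
have ni := integB (L1per_integ 0 1 (E_n EX)) (L1per_integ 0 1 (E_n EY)).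
have ri := integB (L1per_integ 0 1 (E_r EX)) (L1per_integ 0 1 (E_r EY)).
have DE := nBE pz pU ni ri.
have cz := gprim_cont pz; have cU := gprim_cont pU.
have -> : itg 0 1 (fun x => `|wderiv (sy X) x - wderiv (sy Y) x|) =
    itg 0 1 (fun x => `|wderiv (sy X) x - 1 - (wderiv (sy Y) x - 1)|).
  by apply: eq_itg => x _; congr (`| _ |); ring.
have zE x : sy X x - sy Y x = sy X x - x - (sy Y x - x) by ring.
have := itg_abs_ge0 (fun x => wderiv (sy X) x - 1 - (wderiv (sy Y) x - 1)).
have := itg_abs_ge0 (fun x => wderiv (sU X) x - wderiv (sU Y) x).
have := itg_abs_ge0 (fun x => snu X x - snu Y x).
have := itg_abs_ge0 (fun x => sr X x - sr Y x).
have := supn_ge0 (fun x => sy X x - x - (sy Y x - x)).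
have := supn_ge0 (fun x => sU X x - sU Y x).
have Hy (x : R) : 0 <= x <= 1 -> `|sy X x - sy Y x| <= supn (fun x => sy X x - x - (sy Y x - x)).
  by move=> x01; rewrite zE; exact: (supn_ub cz x01).
have HU (x : R) : 0 <= x <= 1 -> `|sU X x - sU Y x| <= supn (fun x => sU X x - sU Y x).
  by move=> x01; exact: (supn_ub cU x01).
move: DE Hy HU; rewrite -/D.
set s1 := supn _; set i1 := itg 0 1 _; set s2 := supn _; set i2 := itg 0 1 _.
set i3 := itg 0 1 _; set i4 := itg 0 1 _ => DE Hy HU h1 h2 h3 h4 h5 h6.
have [k1 k2 k3 k4 k5] : [/\ s1 <= D, s2 <= D, i1 <= D, i2 <= D & i3 <= D].
  by clear -DE h1 h2 h3 h4 h5 h6; split; lra.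
by split => // x x01; [exact: le_trans (Hy x x01) k1|exact: le_trans (HU x x01) k2].
Qed.

(** One summand per piece of the norm: [1 + 1] for [U] and [U_xi], then [Q], then [Q_xi], and last
    [nu_t], split into its [y_xi] term and its [U_xi] term. The constant fourth component
    contributes nothing. *)
Definition rhs_L (M : R) : R :=
  1 + 1 + (cL M + (cL M * M + cB M + 2^-1 * (3 * M ^+ 2 + 1))) +
  ((2 * (cL M * M + cB M) * M + 2 * cB M * M) +
   ((6 * M + 2 * cL M) * M + (3 * M ^+ 2 + 2 * cB M))).

Lemma cB_ge0 (M : R) : 0 <= M -> 0 <= cB M.
Proof. by move=> M0; rewrite mulr_ge0 ?expR_ge0// addr_ge0// exprn_ge0. Qed.

Lemma cL_ge0 (M : R) : 0 <= M -> 0 <= cL M.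
Proof.
move=> M0; rewrite mulr_ge0 ?expR_ge0// addr_ge0//.
  by rewrite mulr_ge0// addr_ge0// exprn_ge0.
by rewrite addr_ge0// mulr_ge0// sqr_ge0.
Qed.

(** The L^1 pieces are handled as products of a uniformly bounded factor with an integrable one, as
    required by [itg_mul_diff]. No derivative is lost, since [Q_xi] is expressed by [P], [y_xi] and
    the density. *)
Lemma rhs_lip (M : R) X Y : in_E X -> in_E Y -> E_bounded M X -> E_bounded M Y ->
  nB (rhs X - rhs Y) <= rhs_L M * nB (coordE X - coordE Y).
Proof.
move=> EX EY bX bY.
have [Dy DU Dp Dw Dn] := dist_parts EX EY.
set D := nB (coordE X - coordE Y) in Dy DU Dp Dw Dn *.
have M0 := b_M0 bX; have cB0 := cB_ge0 M0; have cL0 := cL_ge0 M0.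
have D0 : 0 <= D := nB_ge0 _.
have pQ := gprimB (gprimN (gprim_Q EX)) (gprimN (gprim_Q EY)).
have pU := gprimB (E_pU EX) (E_pU EY).
have nuX := L1per_nu_t EX; have nuY := L1per_nu_t EY.
have ni := integB (L1per_integ 0 1 nuX) (L1per_integ 0 1 nuY).
have ri : integ 0 1 (fun x : R => 0 - 0 : R) by exact: integ_cst.
have DE := nBE pU pQ ni ri.
rewrite /rhs_L (DE : nB (rhs X - rhs Y) = _).
have HP (x : R) : 0 <= x <= 1 -> `|P X x - P Y x| <= cL M * D.
  move=> x01; rewrite (P01E EX x01) (P01E EY x01).
  by have [] := kPQ_cL bX bY Dy DU Dp Dn x01.
have HQ (x : R) : 0 <= x <= 1 -> `|Q X x - Q Y x| <= cL M * D.
  move=> x01; rewrite (Q01E EX x01) (Q01E EY x01).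
  by have [] := kPQ_cL bX bY Dy DU Dp Dn x01.
have BP (x : R) : 0 <= x <= 1 -> `|P Y x| <= cB M.
  by move=> x01; rewrite (P01E EY x01); have [] := kPQ_cB bY x01.
have BQ (x : R) : 0 <= x <= 1 -> `|Q Y x| <= cB M.
  by move=> x01; rewrite (Q01E EY x01); have [] := kPQ_cB bY x01.
have s1 : supn (fun x => sU X x - sU Y x) <= 1 * D.
  by rewrite mul1r; apply: supn_le; [exact: gprim_cont pU|exact: DU].
have s2 : supn (fun x => - Q X x - - Q Y x) <= cL M * D.
  apply: supn_le; first exact: gprim_cont pQ.
  by move=> x x01; rewrite -opprD normrN HQ.
have ip := (E_py EX); have ip' := (E_py EY).
have i1 : itg 0 1 (fun x => `|- (P X x * wderiv (sy X) x -
      2^-1 * dens (sU X) (wderiv (sy X)) (snu X) x)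
    - - (P Y x * wderiv (sy Y) x - 2^-1 * dens (sU Y) (wderiv (sy Y)) (snu Y) x)|)
    <= (cL M * M + cB M + 2^-1 * (3 * M ^+ 2 + 1)) * D.
  have iPp := gprim_integ_cM 0 1 (gprim_cont (gprim_P EX)) ip.
  have iPp' := gprim_integ_cM 0 1 (gprim_cont (gprim_P EY)) ip'.
  have H1 := itg_mul_diff (gprim_integ 0 1 ip) (gprim_integ 0 1 ip') iPp iPp' HP BP.
  have id := b_d bX; have id' := b_d bY.
  have H2 := dens_lip bX bY DU Dp Dn.
  have H3 := itg_absD (integB iPp iPp') (integZ (- 2^-1) (integB id id')).
  have -> : itg 0 1 (fun x => `|- (P X x * wderiv (sy X) x -
      2^-1 * dens (sU X) (wderiv (sy X)) (snu X) x)
    - - (P Y x * wderiv (sy Y) x - 2^-1 * dens (sU Y) (wderiv (sy Y)) (snu Y) x)|) =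
    itg 0 1 (fun x => `|P X x * wderiv (sy X) x - P Y x * wderiv (sy Y) x +
       - 2^-1 * (dens (sU X) (wderiv (sy X)) (snu X) x - dens (sU Y) (wderiv (sy Y)) (snu Y) x)|).
    by apply: eq_itg => x _; rewrite -normrN; congr (`| _ |); ring.
  apply: (le_trans H3).
  have H4 : itg 0 1 (fun x => `|- 2^-1 * (dens (sU X) (wderiv (sy X)) (snu X) x -
       dens (sU Y) (wderiv (sy Y)) (snu Y) x)|) <= 2^-1 * ((3 * M ^+ 2 + 1) * D).
    have B2 (x : R) : 0 <= x <= 1 -> `|- 2^-1 : R| <= 2^-1.
      by move=> _; rewrite normrN ger0_norm.
    apply: (le_trans (itg_abs_mul (integB id id') (integZ _ (integB id id')) B2)).
    by rewrite ler_wpM2l.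
  have H5 : cL M * D * itg 0 1 (fun x => `|wderiv (sy X) x|) <= cL M * D * M.
    exact: (ler_wpM2l (mulr_ge0 cL0 D0) (b_pM bX)).
  have H6 : cB M * itg 0 1 (fun x => `|wderiv (sy X) x - wderiv (sy Y) x|) <= cB M * D.
    exact: (ler_wpM2l cB0 Dp).
  apply: (le_trans (lerD (le_trans H1 (lerD H5 H6)) H4)).
  by rewrite le_eqVlt; apply/orP; left; apply/eqP; ring.
have i2 : itg 0 1 (fun x => `|nu_t X x - nu_t Y x|) <=
   ((2 * (cL M * M + cB M) * M + 2 * cB M * M) +
   ((6 * M + 2 * cL M) * M + (3 * M ^+ 2 + 2 * cB M))) * D.
  have [cX1 cX2] := nu_t_coef EX; have [cY1 cY2] := nu_t_coef EY.
  have j1 := gprim_integ_cM 0 1 cX1 ip; have j1' := gprim_integ_cM 0 1 cY1 ip'.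
  have j2 := gprim_integ_cM 0 1 cX2 (E_pU EX); have j2' := gprim_integ_cM 0 1 cY2 (E_pU EY).
  have D1 (x : R) : 0 <= x <= 1 -> `|- 2 * Q X x * sU X x - - 2 * Q Y x * sU Y x| <=
      2 * (cL M * M + cB M) * D.
    move=> x01; have := mul_diff_le (sU X x) (sU Y x) (HQ x x01) (BQ x x01).
    have := b_UM bX x01; have := DU x x01.
    have -> : - 2 * Q X x * sU X x - - 2 * Q Y x * sU Y x =
       - 2 * (Q X x * sU X x - Q Y x * sU Y x) by ring.
    move=> h1 h2 h3; rewrite normrM normrN (ger0_norm (ler0n _ 2)) -[leRHS]mulrA.
    rewrite ler_wpM2l//; apply: (le_trans h3).
    rewrite mulrDl; apply: lerD; last by rewrite ler_wpM2l.
    by rewrite [leRHS]mulrAC; exact: (ler_wpM2l (mulr_ge0 cL0 D0) h2).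
  have B1 (x : R) : 0 <= x <= 1 -> `|- 2 * Q Y x * sU Y x| <= 2 * cB M * M.
    move=> x01; rewrite !normrM normrN (ger0_norm (ler0n _ 2)) ler_pM ?mulr_ge0//.
      by rewrite ler_wpM2l// BQ.
    exact: b_UM bY x x01.
  have D2 (x : R) : 0 <= x <= 1 ->
     `|3 * sU X x ^+ 2 - 2 * P X x - (3 * sU Y x ^+ 2 - 2 * P Y x)| <= (6 * M + 2 * cL M) * D.
    move=> x01; have h1 := sqr_diff (b_UM bX x01) (b_UM bY x01) (DU x x01).
    have h2 := HP x x01.
    have -> : 3 * sU X x ^+ 2 - 2 * P X x - (3 * sU Y x ^+ 2 - 2 * P Y x) =
      3 * (sU X x ^+ 2 - sU Y x ^+ 2) - 2 * (P X x - P Y x) by ring.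
    apply: (le_trans (ler_normB _ _)).
    rewrite !(normrM 3) !(normrM 2) (ger0_norm (ler0n _ 3)) (ger0_norm (ler0n _ 2)).
    apply: (le_trans (lerD (ler_wpM2l (ler0n R 3) h1) (ler_wpM2l (ler0n R 2) h2))).
    by rewrite le_eqVlt; apply/orP; left; apply/eqP; ring.
  have B2 (x : R) : 0 <= x <= 1 -> `|3 * sU Y x ^+ 2 - 2 * P Y x| <= 3 * M ^+ 2 + 2 * cB M.
    move=> x01; apply: (le_trans (ler_normB _ _)).
    rewrite !(normrM 3) !(normrM 2) (ger0_norm (ler0n _ 3)) (ger0_norm (ler0n _ 2)).
    apply: lerD; last by rewrite ler_wpM2l// BP.
    by rewrite ler_wpM2l// normrX lerXn2r ?nnegrE// (b_UM bY x01).
  have H1 := itg_mul_diff (gprim_integ 0 1 ip) (gprim_integ 0 1 ip') j1 j1' D1 B1.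
  have H2 := itg_mul_diff (gprim_integ 0 1 (E_pU EX)) (gprim_integ 0 1 (E_pU EY)) j2 j2' D2 B2.
  have H3 := itg_absD (integB j1 j1') (integB j2 j2').
  have -> : itg 0 1 (fun x => `|nu_t X x - nu_t Y x|) = itg 0 1 (fun x =>
     `|- 2 * Q X x * sU X x * wderiv (sy X) x - - 2 * Q Y x * sU Y x * wderiv (sy Y) x +
     ((3 * sU X x ^+ 2 - 2 * P X x) * wderiv (sU X) x
        - (3 * sU Y x ^+ 2 - 2 * P Y x) * wderiv (sU Y) x)|).
    by apply: eq_itg => x _; congr (`| _ |); rewrite /nu_t; ring.
  have cLM := mulr_ge0 cL0 M0; have t2 := ler0n R 2; have t3 := ler0n R 3.
  have t6 := ler0n R 6.
  have K1 := mulr_ge0 (mulr_ge0 t2 (addr_ge0 cLM cB0)) D0.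
  have K2 := mulr_ge0 (mulr_ge0 t2 cB0) M0.
  have K3 := mulr_ge0 (addr_ge0 (mulr_ge0 t6 M0) (mulr_ge0 t2 cL0)) D0.
  have K4 := addr_ge0 (mulr_ge0 t3 (sqr_ge0 M)) (mulr_ge0 t2 cB0).
  have G1 := lerD (ler_wpM2l K1 (b_pM bX)) (ler_wpM2l K2 Dp).
  have G2 := lerD (ler_wpM2l K3 (b_wM bX)) (ler_wpM2l K4 Dw).
  apply: (le_trans H3 (le_trans (lerD (le_trans H1 G1) (le_trans H2 G2)) _)).
  by rewrite le_eqVlt; apply/orP; left; apply/eqP; ring.
have i0 : itg 0 1 (fun x => `|wderiv (sU X) x - wderiv (sU Y) x|) <= 1 * D.
  by rewrite mul1r.
have i3 : itg 0 1 (fun x : R => `|0 - 0 : R|) = 0.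
  by rewrite subrr normr0; have := itg_cst (0 : R) ler01; rewrite mul0r.
rewrite i3 addr0.
have AD (a b a' b' : R) : a <= b * D -> a' <= b' * D -> a + a' <= (b + b') * D.
  by move=> h h'; rewrite mulrDl lerD.
exact: AD (AD _ _ _ _ (AD _ _ _ _ s1 i0) (AD _ _ _ _ s2 i1)) i2.
Qed.

End RhsLipschitz.

(** * Continuous dependence and uniqueness for curves in E *)

Section Dependence.
Variable R : realType.
Local Notation mu := (@lebesgue_measure R).
Local Notation quad := ((R -> R) * (R -> R) * (R -> R) * (R -> R))%type.

(* Differentiability in E without requiring the derivative to be continuous;
   two-sided except at t = 0. *)
Definition sol_on (T : R) (X : R -> state R) := forall t : R, 0 <= t < T ->
  in_E (X t) /\ forall e : R, 0 < e -> exists2 d : R, 0 < d &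
    forall s : R, 0 <= s < T -> `|s - t| < d ->
      nB (coordE (X s) - coordE (X t) - (s - t) *: rhs (X t)) <= e * `|s - t|.

Lemma sol_onS (T T' : R) X : T' <= T -> sol_on T X -> sol_on T' X.
Proof.
move=> TT H t /andP[t0 tT]; have [|EX HX] := H t; first by rewrite t0 (lt_le_trans tT).
split => // e e0; have [d d0 Hd] := HX e e0; exists d => // s /andP[s0 sT].
by apply: Hd; rewrite s0 (lt_le_trans sT).
Qed.

Lemma sol_on_E T X t : sol_on T X -> 0 <= t < T -> in_E (X t).
Proof. by move=> H /H[]. Qed.

Lemma nB_dist (v w : quad) : in_B v -> in_B w -> `|nB v - nB w| <= nB (v - w).
Proof.
move=> hv hw.
have h1 := nBD (in_BB hv hw) hw; rewrite subrK in h1.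
have hwv : in_B (w - v) by exact: in_BB.
have h2 := nBD hwv hv; rewrite subrK in h2.
have h3 : nB (w - v) <= nB (v - w).
  rewrite -opprB -scaleN1r; apply: le_trans (nBZ (-1) (in_BB hv hw)) _.
  by rewrite normrN normr1 mul1r.
by rewrite ler_norml; move: h1 h2 h3;
  move: (nB v) (nB w) (nB (v - w)) (nB (w - v)) => a b c d; lra.
Qed.

Lemma subr_rearrange (G : zmodType) (xs ys x y hx hy : G) :
  xs - ys - (x - y) = hx - hy + (xs - x - hx - (ys - y - hy)).
Proof.
have E (a b : G) : hx - hy + (a - hx - (b - hy)) = a - b.
  rewrite opprB [hy - b]addrC addrACA [hx + _]addrCA subrr addr0.
  by rewrite [- hy + _]addrCA addNr addr0.
by rewrite E !opprB [y - x]addrC [y - ys]addrC addrACA.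
Qed.

Lemma nB_step (x y xs ys rx ry : quad) (h e L : R) : in_B x -> in_B y -> in_B xs ->
  in_B ys -> in_B rx -> in_B ry ->
  nB (xs - x - h *: rx) <= e * `|h| -> nB (ys - y - h *: ry) <= e * `|h| ->
  nB (rx - ry) <= L ->
  `|nB (xs - ys) - nB (x - y)| <= (L + 2 * e) * `|h|.
Proof.
move=> Bx By Bxs Bys Brx Bry h1 h2 h3.
apply: (le_trans (nB_dist (in_BB Bxs Bys) (in_BB Bx By))).
set a := xs - x - h *: rx in h1; set b := ys - y - h *: ry in h2.
have Ba : in_B a by exact: in_BB (in_BB Bxs Bx) (in_BZ h Brx).
have Bb : in_B b by exact: in_BB (in_BB Bys By) (in_BZ h Bry).
have -> : xs - ys - (x - y) = h *: (rx - ry) + (a - b).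
  by rewrite scalerBr; exact: subr_rearrange.
have Br := in_BB Brx Bry.
apply: (le_trans (nBD (in_BZ h Br) (in_BB Ba Bb))).
have g1 := le_trans (nBZ h Br) (ler_wpM2l (normr_ge0 h) h3).
have g2 := le_trans (nBB Ba Bb) (lerD h1 h2).
apply: (le_trans (lerD g1 g2)).
by rewrite le_eqVlt; apply/orP; left; apply/eqP; ring.
Qed.

Lemma sol_dependence (T M : R) (X Y : R -> state R) : sol_on T X -> sol_on T Y ->
  (forall t, 0 <= t < T -> E_bounded M (X t) /\ E_bounded M (Y t)) ->
  forall t, 0 <= t < T -> nB (coordE (X t) - coordE (Y t)) <=
    nB (coordE (X 0) - coordE (Y 0)) * expR (rhs_L M * t).
Proof.
move=> SX SY bXY t tT; have /andP[t0 tT'] := tT.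
have T0 : 0 < T := le_lt_trans t0 tT'.
have M0 : 0 <= M by have [b _] := bXY t tT; exact: b_M0 b.
pose L := rhs_L M.
have L0 : 0 <= L.
  have h1 := cB_ge0 M0; have h2 := cL_ge0 M0.
  rewrite /L /rhs_L; move: h1 h2; move: (cB M) (cL M) => B C h1 h2.
  have h3 := sqr_ge0 M; have h4 := mulr_ge0 h2 M0; have h5 := mulr_ge0 h1 M0.
  have h6 := mulr_ge0 h4 M0.
  nra.
pose D s := nB (coordE (X s) - coordE (Y s)).
apply: (gronwall_dini (f := D) (L := L) (T := t)) => //; first exact: nB_ge0.
  move=> s e /andP[s0 st] e0.
  have sT : 0 <= s < T by rewrite s0 (le_lt_trans st).
  have [EX HX] := SX s sT; have [EY HY] := SY s sT.
  have e20 : 0 < e / 2 by rewrite divr_gt0.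
  have [d1 d10 H1] := HX _ e20; have [d2 d20 H2] := HY _ e20.
  have D0 : 0 <= D s := nB_ge0 _.
  (* [K] bounds the local rate of change of the distance, so [|s' - s| < e / K] keeps the change
     below [e]; each curve contributes [e / 2] twice to this rate. *)
  pose K := L * D s + e; have K0 : 0 < K by rewrite ltr_wpDl// mulr_ge0.
  exists (Num.min (Num.min d1 d2) (e / K)).
    by rewrite !lt_min d10 d20 divr_gt0.
  move=> s' /andP[s'0 s't]; rewrite !lt_min => /andP[/andP[sd1 sd2] sd3].
  have s'T : 0 <= s' < T by rewrite s'0 (le_lt_trans s't).
  have [bX bY] := bXY s sT.
  have EX' := sol_on_E SX s'T; have EY' := sol_on_E SY s'T.
  have := nB_step EX EY EX' EY' (in_B_rhs EX) (in_B_rhs EY) (H1 _ s'T sd1)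
    (H2 _ s'T sd2) (rhs_lip EX EY bX bY).
  rewrite (_ : 2 * (e / 2) = e); last by field.
  rewrite -/(D s) -/(D s') -/L -/K => H.
  split.
    apply: (le_trans H); move: sd3; rewrite ltr_pdivlMr// mulrC => /ltW; exact.
  move=> ss'; have ds0 : 0 <= s' - s by rewrite subr_ge0.
  rewrite (ger0_norm ds0) in H; move: H; rewrite ler_norml => /andP[_].
  by rewrite /K; lra.
by rewrite t0 lexx.
Qed.

(** The norm of E controls [y_xi - 1] rather than [y_xi], which accounts for the added 1. *)
Lemma state_bounded X (N : R) : in_E X -> nB (coordE X) <= N -> E_bounded (1 + N) X.
Proof.
move=> EX HN.
have pz := E_pzeta EX; have pU := E_pU EX.
have ni := L1per_integ 0 1 (E_n EX); have ri := L1per_integ 0 1 (E_r EX).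
have DE := nBE pz pU ni ri.
rewrite (DE : nB (coordE X) = _) in HN.
have [py pU01] := E_prims EX.
have HU (x : R) : 0 <= x <= 1 -> `|sU X x| <= supn (sU X).
  by move=> x01; exact: (supn_ub (gprim_cont pU) x01).
have Hp : itg 0 1 (fun x => `|wderiv (sy X) x|) <=
    itg 0 1 (fun x => `|wderiv (sy X) x - 1|) + 1.
  have := itg_absD (gprim_integ 0 1 pz) (integ_cst 0 1 (1 : R)).
  have -> : itg 0 1 (fun x => `|wderiv (sy X) x - 1 + 1|) =
      itg 0 1 (fun x => `|wderiv (sy X) x|).
    by apply: eq_itg => x _; rewrite subrK.
  by rewrite normr1 itg_cst// subr0 mulr1.
have := itg_abs_ge0 (fun x => wderiv (sy X) x - 1).
have := itg_abs_ge0 (wderiv (sU X)).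
have := itg_abs_ge0 (snu X).
have := itg_abs_ge0 (sr X).
have := supn_ge0 (fun x => sy X x - x).
have := supn_ge0 (sU X).
move: HN HU Hp.
set s1 := supn _; set i1 := itg 0 1 _; set s2 := supn _; set i2 := itg 0 1 _.
set i3 := itg 0 1 _; set i4 := itg 0 1 _; set i5 := itg 0 1 _.
move=> HN HU Hp h1 h2 h3 h4 h5 h6.
have [k1 k2 k3 k4] : [/\ s2 <= 1 + N, i5 <= 1 + N, i2 <= 1 + N & i3 <= 1 + N].
  by clear -HN Hp h1 h2 h3 h4 h5 h6; split; lra.
exact: (Bounded01 py pU01 ni (fun x x01 => le_trans (HU x x01) k1) k2 k3 k4).
Qed.

Lemma within_cont_eps (f : R -> R) (a b : R) :
  (forall t e, a <= t <= b -> 0 < e -> exists2 d : R, 0 < d &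
    forall s, a <= s <= b -> `|s - t| < d -> `|f s - f t| <= e) ->
  {within `[a, b], continuous f}.
Proof.
move=> H; apply/subspace_continuousP => t /=; rewrite in_itv/= => tab.
apply/cvgrPdist_le => e e0; have [d d0 Hd] := H t e tab e0.
exists d => //= s /= st sab; rewrite distrC; apply: Hd; last by rewrite distrC.
by move: sab; rewrite in_itv.
Qed.

(** A competing solution comes with no a priori bound and need not be known to stay in F. Continuity
    of its norm on a compact time interval supplies the bound that uniqueness needs. *)
Lemma sol_bounded (T t0 : R) X : sol_on T X -> 0 <= t0 < T ->
  exists M, forall t, 0 <= t <= t0 -> E_bounded M (X t).
Proof.
move=> SX /andP[t00 t0T].
have inT t : 0 <= t <= t0 -> 0 <= t < T.
  by move=> /andP[-> h]; rewrite (le_lt_trans h).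
have cN : {within `[0, t0], continuous (fun t => nB (coordE (X t)))}.
  apply: within_cont_eps => t e /inT tT e0.
  have [EX HX] := SX t tT; have [d d0 Hd] := HX 1 ltr01.
  pose K := nB (rhs (X t)) + 1; have K0 : 0 < K by rewrite ltr_wpDl// nB_ge0.
  exists (Num.min d (e / K)); first by rewrite lt_min d0 divr_gt0.
  move=> s /inT sT; rewrite lt_min => /andP[sd sK].
  have EX' := sol_on_E SX sT.
  apply: (le_trans (nB_dist EX' EX)).
  have Br := in_B_rhs EX.
  have := nBD (in_BB (in_BB EX' EX) (in_BZ (s - t) Br)) (in_BZ (s - t) Br).
  rewrite subrK => h1; apply: (le_trans h1).
  apply: (le_trans (lerD (Hd s sT sd) (nBZ (s - t) Br))).
  move: sK; rewrite ltr_pdivlMr// /K mulrDr mulr1 mul1r => /ltW; rewrite addrC; exact.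
have [N HN] := within_cont_bnd t00 cN.
exists (1 + N) => t tt0; apply: state_bounded; first exact: sol_on_E SX (inT _ tt0).
exact: le_trans (ler_norm _) (HN t tt0).
Qed.

Lemma bounded01_le (M M' : R) (y p U w n : R -> R) : M <= M' ->
  bounded01 M y p U w n -> bounded01 M' y p U w n.
Proof.
move=> MM [h1 h2 h3 h4 h5 h6 h7]; split => //; try exact: le_trans MM.
by move=> x x01; exact: le_trans (h4 x x01) MM.
Qed.

Lemma eq_state_in_B (v : quad) : in_B v -> eqB v v.
Proof. by case: v => [[[z U] n] r] _; split => //; exact: aeW. Qed.

Lemma eqB_sub (v w : quad) : eqB v w <-> eqB (v - w) 0.
Proof.
case: v => [[[z U] n] r]; case: w => [[[z' U'] n'] r']; split => -[h1 h2 h3 h4].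
  split.
  - by rewrite h1; apply/funext => x; exact: subrr.
  - by rewrite h2; apply/funext => x; exact: subrr.
  - by apply: (ae_imp h3) => x e; apply/eqP; rewrite subr_eq0; exact/eqP.
  - by apply: (ae_imp h4) => x e; apply/eqP; rewrite subr_eq0; exact/eqP.
split.
- by apply/funext => x; apply/eqP; rewrite -subr_eq0; apply/eqP; exact: (congr1 (@^~ x) h1).
- by apply/funext => x; apply/eqP; rewrite -subr_eq0; apply/eqP; exact: (congr1 (@^~ x) h2).
- by apply: (ae_imp h3) => x e; apply/eqP; rewrite -subr_eq0; exact/eqP.
- by apply: (ae_imp h4) => x e; apply/eqP; rewrite -subr_eq0; exact/eqP.
Qed.

Lemma in_B0 : in_B (0 : quad).
Proof.
have W0 : W11per (0 : R -> R).
  apply/W11perP; split => //; exists (fun=> 0); split => // a b _; exact: prim_cst.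
have L0 : L1per (0 : R -> R).
  apply: (L1perP (measurable_cst (0 : R))); last exact: aeW.
  by move=> a b; exact: (integ_cst a b (0 : R)).
by split.
Qed.

Lemma nB0 : nB (0 : quad) = 0.
Proof.
apply/eqP; rewrite eq_le nB_ge0 andbT.
by have := nBZ 0 in_B0; rewrite scale0r normr0 mul0r.
Qed.

Lemma sol_unique (T : R) (X Y : R -> state R) : sol_on T X -> sol_on T Y ->
  eq_state (X 0) (Y 0) -> forall t, 0 <= t < T -> eq_state (X t) (Y t).
Proof.
move=> SX SY XY0 t tT; have /andP[t0 tT'] := tT.
(* An intermediate time: bounds are available on compact subintervals of [[0, T)], whereas the
   dependence estimate wants them on a half-open interval containing [t]. *)
pose t1 := (t + T) / 2.
have tt1 : t < t1 by rewrite /t1; lra.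
have t1T : t1 < T by rewrite /t1; lra.
have t10 : 0 <= t1 by rewrite ltW// (le_lt_trans t0).
have t1T' : 0 <= t1 < T by rewrite t10.
have [M1 H1] := sol_bounded SX t1T'; have [M2 H2] := sol_bounded SY t1T'.
have T0 : (0 : R) <= 0 < T by rewrite (le_lt_trans t0 tT') andbT.
have EX0 := sol_on_E SX T0; have EY0 := sol_on_E SY T0.
have EX := sol_on_E SX tT; have EY := sol_on_E SY tT.
have := sol_dependence (M := Num.max M1 M2) (sol_onS (ltW t1T) SX) (sol_onS (ltW t1T) SY).
move=> /(_ _ t) H; apply/eqB_sub; apply: nB_eq0; first exact: in_BB.
apply: (le_trans (H _ _)).
- move=> s /andP[s0 /ltW st1]; have s01 : 0 <= s <= t1 by rewrite s0.
  have mx1 : M1 <= Num.max M1 M2 by rewrite le_max lexx.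
  have mx2 : M2 <= Num.max M1 M2 by rewrite le_max lexx orbT.
  by split; [exact: bounded01_le mx1 (H1 s s01)|exact: bounded01_le mx2 (H2 s s01)].
- by rewrite t0.
have -> : nB (coordE (X 0) - coordE (Y 0)) = 0.
  have /eqB_sub E := XY0.
  by rewrite /nB (eqB_normB (in_BB EX0 EY0) in_B0 E); exact: nB0.
by rewrite mul0r.
Qed.

End Dependence.

(** * The pointwise vector field and its cut-off *)

Section Field.
Variable R : realType.
Local Notation mu := (@lebesgue_measure R).

Lemma mfun_itv (a b : R) (f : R -> R) : measurable_fun [set: R] f ->
  measurable_fun (`[a, b] : set R) f.
Proof. by move=> mf; apply: (@measurable_funS _ _ _ _ [set: R]). Qed.

(* Index set of the coordinates of (y, U, y_xi, U_xi, nu). *)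
Inductive comp := Cy | CU | Cp | Cw | Cn.
(** Singles out [y], the only coordinate that is neither periodic nor bounded. *)
Definition ncy (c : comp) := if c is Cy then false else true.

Local Notation V := (comp * R -> R).
Implicit Types (v : comp * R -> R) (x M : R).

Definition at_ v c : R -> R := fun x => v (c, x).
Definition vd v : R -> R := dens (at_ v CU) (at_ v Cp) (at_ v Cn).
Definition vP v x : R := kP (at_ v Cy) (vd v) (frac x).
Definition vQ v x : R := kQ (at_ v Cy) (vd v) (frac x).

Definition field v (i : comp * R) : R :=
  let: (c, x) := i in
  match c with
  | Cy => v (CU, x)
  | CU => - vQ v x
  | Cp => v (Cw, x)
  | Cw => 2^-1 * vd v x - vP v x * v (Cp, x)
  | Cn => - 2 * vQ v x * v (CU, x) * v (Cp, x)
          + (3 * v (CU, x) ^+ 2 - 2 * vP v x) * v (Cw, x)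
  end.

(** What an Euler step and a uniform limit both preserve. The quadratic relation is absent because
    in general an Euler step breaks it at second order; it is recovered for the limit flow in
    [flow_constraint]. *)
Record adm v : Prop := Adm {
  a_yper : forall x, v (Cy, x + 1) = v (Cy, x) + 1;
  a_per : forall c x, ncy c -> v (c, x + 1) = v (c, x);
  a_bd : exists M, forall c x, ncy c -> `|v (c, x)| <= M;
  a_m : forall c, ncy c -> measurable_fun [set: R] (at_ v c);
  a_y : prim 0 1 (at_ v Cy) (at_ v Cp);
  a_U : prim 0 1 (at_ v CU) (at_ v Cw) }.

Definition vN v : R := sup [set r | exists c x, ncy c /\ r = `|v (c, x)|].

Let vN_nonempty v : [set r | exists c x, ncy c /\ r = `|v (c, x)|] !=set0.
Proof. by exists `|v (CU, 0)|, CU, 0. Qed.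

Lemma vN_le v M : (forall c x, ncy c -> `|v (c, x)| <= M) -> vN v <= M.
Proof. by move=> H; apply: ge_sup => // _ [c [x [nc ->]]]; exact: H. Qed.

Lemma vN_ub v c x : adm v -> ncy c -> `|v (c, x)| <= vN v.
Proof.
move=> av nc; apply: ub_le_sup; last by exists c, x.
by have [M HM] := a_bd av; exists M => _ [c' [x' [nc' ->]]]; exact: HM.
Qed.

Lemma vN_lip v w (d : R) : adm v -> adm w -> (forall i, `|v i - w i| <= d) ->
  `|vN v - vN w| <= d.
Proof.
move=> av aw H.
have K v' w' : adm v' -> adm w' -> (forall i, `|v' i - w' i| <= d) -> vN v' <= vN w' + d.
  move=> av' aw' H'; apply: vN_le => c x nc.
  have := ler_normD (v' (c, x) - w' (c, x)) (w' (c, x)); rewrite subrK.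
  have := H' (c, x); have := vN_ub x aw' nc; lra.
have h1 := K _ _ av aw H.
have h2 : vN w <= vN v + d by apply: K => // i; rewrite distrC.
by rewrite ler_norml; lra.
Qed.

Lemma vN_ge0 v : adm v -> 0 <= vN v.
Proof. by move=> av; apply: le_trans (vN_ub 0 av (isT : ncy CU)). Qed.

Lemma integ_bounded v c M : adm v -> ncy c -> (forall x, `|v (c, x)| <= M) ->
  integ 0 1 (at_ v c) /\ itg 0 1 (fun x => `|at_ v c x|) <= M.
Proof.
move=> av nc H.
have i1 : integ 0 1 (at_ v c).
  by apply: (integ_bnd (M := M)) => [|x _]; [exact: mfun_itv (a_m av nc)|exact: H].
split => //; have := itg_cst M (@ler01 R); rewrite subr0 mulr1 => <-.
by apply: itg_le; [exact: integ_norm|exact: integ_cst|move=> x _; exact: H].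
Qed.

Lemma adm_bounded v M : adm v -> vN v <= M ->
  bounded01 M (at_ v Cy) (at_ v Cp) (at_ v CU) (at_ v Cw) (at_ v Cn).
Proof.
move=> av vM.
have H c x : ncy c -> `|v (c, x)| <= M by move=> nc; exact: le_trans (vN_ub x av nc) vM.
have [ip pM] := integ_bounded av (isT : ncy Cp) (fun x => H Cp x isT).
have [iw wM] := integ_bounded av (isT : ncy Cw) (fun x => H Cw x isT).
have [in_ nM] := integ_bounded av (isT : ncy Cn) (fun x => H Cn x isT).
exact: (Bounded01 (a_y av) (a_U av) in_ (fun x _ => H CU x isT) pM wM nM).
Qed.

Lemma adm_id v : adm v -> integ 0 1 (vd v).
Proof. by move=> av; exact: b_d (adm_bounded av (lexx _)). Qed.

Lemma adm_cy v : adm v -> {within `[0, 1], continuous (at_ v Cy)}.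
Proof. by move=> av; exact: prim_cont ler01 (a_y av). Qed.

Lemma adm_y1 v : adm v -> at_ v Cy 1 = at_ v Cy 0 + 1.
Proof. by move=> av; rewrite /at_ -a_yper// add0r. Qed.

Lemma vP01 v x : adm v -> 0 <= x <= 1 -> vP v x = kP (at_ v Cy) (vd v) x.
Proof.
by move=> av x01; rewrite /vP (ext01 (kP_per (adm_cy av) (adm_id av) (adm_y1 av)) x01).
Qed.

Lemma vQ01 v x : adm v -> 0 <= x <= 1 -> vQ v x = kQ (at_ v Cy) (vd v) x.
Proof.
by move=> av x01; rewrite /vQ (ext01 (kQ_per (adm_cy av) (adm_id av) (adm_y1 av)) x01).
Qed.

Lemma prim_vP_vQ v : adm v ->
  prim 0 1 (vP v) (fun x => vQ v x * at_ v Cp x) /\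
  prim 0 1 (vQ v) (fun x => vP v x * at_ v Cp x - 2^-1 * vd v x).
Proof.
move=> av; have [h1 h2] := prim_kP_kQ (adm_cy av) (adm_id av) (a_y av).
split; [apply: eq_prim h1|apply: eq_prim h2] => x x01; by rewrite ?vP01 ?vQ01.
Qed.

Lemma measurable_vP v : adm v -> measurable_fun [set: R] (vP v).
Proof.
move=> av; apply: measurable_ext; apply: within_cont_mfun.
exact: prim_cont ler01 (prim_kP_kQ (adm_cy av) (adm_id av) (a_y av)).1.
Qed.

Lemma measurable_vQ v : adm v -> measurable_fun [set: R] (vQ v).
Proof.
move=> av; apply: measurable_ext; apply: within_cont_mfun.
exact: prim_cont ler01 (prim_kP_kQ (adm_cy av) (adm_id av) (a_y av)).2.
Qed.

Lemma vPQ_bnd v M x : adm v -> vN v <= M -> `|vP v x| <= cB M /\ `|vQ v x| <= cB M.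
Proof. by move=> av vM; exact: kPQ_cB (adm_bounded av vM) (frac01 x). Qed.

(** The sum of the bounds of the components, [M] serving both [Cy] and [Cp]; as all summands are
    nonnegative, it dominates each of them. [cFL] is built in the same way from the Lipschitz
    constants. *)
Definition cF (M : R) : R := M + cB M + (2^-1 * (M ^+ 3 + M) + cB M * M) +
  (2 * cB M * M * M + (3 * M ^+ 2 + 2 * cB M) * M).

Lemma vd_bnd v M x : adm v -> vN v <= M -> `|vd v x| <= M ^+ 3 + M.
Proof.
move=> av vM.
have H c : ncy c -> `|v (c, x)| <= M by move=> nc; exact: le_trans (vN_ub x av nc) vM.
apply: (le_trans (ler_normD _ _)); apply: lerD; last exact: H.
have M0 := le_trans (vN_ge0 av) vM.
rewrite normrM normrX [leRHS]exprSr; apply: ler_pM;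
  [by rewrite exprn_ge0|by []| |exact: (H Cp isT)].
by rewrite lerXn2r ?nnegrE// (H CU isT).
Qed.

Lemma coef_bnd v M x : adm v -> vN v <= M ->
  `|- 2 * vQ v x * v (CU, x)| <= 2 * cB M * M /\
  `|3 * v (CU, x) ^+ 2 - 2 * vP v x| <= 3 * M ^+ 2 + 2 * cB M.
Proof.
move=> av vM; have [bP bQ] := vPQ_bnd x av vM.
have M0 := le_trans (vN_ge0 av) vM.
have UM : `|v (CU, x)| <= M by exact: le_trans (vN_ub x av (isT : ncy CU)) vM.
split.
  rewrite !normrM normrN (ger0_norm (ler0n _ 2)); apply: ler_pM => //.
  by rewrite ler_wpM2l.
apply: (le_trans (ler_normB _ _)).
rewrite !(normrM 3) !(normrM 2) (ger0_norm (ler0n _ 3)) (ger0_norm (ler0n _ 2)).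
apply: lerD; last by rewrite ler_wpM2l.
by rewrite ler_wpM2l// normrX lerXn2r ?nnegrE.
Qed.

Lemma field_bnd v M i : adm v -> vN v <= M -> `|field v i| <= cF M.
Proof.
move=> av vM; have M0 := le_trans (vN_ge0 av) vM.
have cB0 := cB_ge0 M0.
case: i => c x; have [bP bQ] := vPQ_bnd x av vM.
have [c1 c2] := coef_bnd x av vM.
have H c' : ncy c' -> `|v (c', x)| <= M by move=> nc; exact: le_trans (vN_ub x av nc) vM.
have a1 : 0 <= 2^-1 * (M ^+ 3 + M) + cB M * M.
  by rewrite addr_ge0// mulr_ge0// addr_ge0// exprn_ge0.
have k1 := mulr_ge0 (mulr_ge0 (ler0n R 2) cB0) M0.
have k2 := addr_ge0 (mulr_ge0 (ler0n R 3) (sqr_ge0 M)) (mulr_ge0 (ler0n R 2) cB0).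
have a2 := addr_ge0 (mulr_ge0 k1 M0) (mulr_ge0 k2 M0).
have w0 : `|field v (Cw, x)| <= 2^-1 * (M ^+ 3 + M) + cB M * M.
  apply: (le_trans (ler_normB _ _)); rewrite !normrM ger0_norm ?invr_ge0//.
  apply: lerD; first by rewrite ler_wpM2l// vd_bnd.
  by apply: ler_pM => //; exact: H.
have n0 : `|field v (Cn, x)| <= 2 * cB M * M * M + (3 * M ^+ 2 + 2 * cB M) * M.
  apply: (le_trans (ler_normD _ _)).
  rewrite [X in X + _ <= _]normrM [X in _ + X <= _]normrM.
  by apply: lerD; apply: ler_pM => //; exact: H.
have hU := H CU isT; have hw := H Cw isT.
have hQ : `|- vQ v x| <= cB M by rewrite normrN.
rewrite /cF; move: a1 a2 w0 n0 hU hw hQ.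
set A := 2^-1 * (M ^+ 3 + M) + cB M * M.
set B := 2 * cB M * M * M + (3 * M ^+ 2 + 2 * cB M) * M.
move: cB0; move: (cB M) => b b0 a1 a2 w0 n0 hU hw hQ.
by case: c => //; [apply: (le_trans hU)|apply: (le_trans hQ)|apply: (le_trans hw)
  |apply: (le_trans w0)|apply: (le_trans n0)]; clear -M0 b0 a1 a2; lra.
Qed.

Definition cFL (M : R) : R := 1 + cL M +
  (2^-1 * (3 * M ^+ 2 + 1) + (cL M * M + cB M)) +
  (2 * (cL M * M + cB M) * M + 2 * cB M * M +
   ((6 * M + 2 * cL M) * M + (3 * M ^+ 2 + 2 * cB M))).

Lemma field_lip v w (M d : R) i : adm v -> adm w -> vN v <= M -> vN w <= M -> 0 <= d ->
  (forall i, `|v i - w i| <= d) -> `|field v i - field w i| <= cFL M * d.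
Proof.
move=> av aw vM wM d0 H.
have M0 := le_trans (vN_ge0 av) vM.
have cB0 := cB_ge0 M0; have cL0 := cL_ge0 M0.
have bv := adm_bounded av vM; have bw := adm_bounded aw wM.
have itgd c : ncy c -> itg 0 1 (fun x => `|at_ v c x - at_ w c x|) <= d.
  move=> nc; have [i1 _] := integ_bounded av nc (fun x => vN_ub x av nc).
  have [i2 _] := integ_bounded aw nc (fun x => vN_ub x aw nc).
  have := itg_cst d (@ler01 R); rewrite subr0 mulr1 => <-.
  apply: itg_le; [exact/integ_norm/integB|exact: integ_cst|].
  by move=> x _; exact: H.
have PQ x := kPQ_cL bv bw (fun x _ => H (Cy, x)) (fun x _ => H (CU, x))
  (itgd Cp isT) (itgd Cn isT) (frac01 x).
case: i => c x; have [dP dQ] := PQ x.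
rewrite -/(vP v x) -/(vP w x) -/(vQ v x) -/(vQ w x) in dP dQ.
have [bP bQ] := vPQ_bnd x aw wM.
have HM v' c' : adm v' -> vN v' <= M -> ncy c' -> `|v' (c', x)| <= M.
  by move=> av' v'M nc; exact: le_trans (vN_ub x av' nc) v'M.
have [c1 c2] := coef_bnd x aw wM.
have dU2 := sqr_diff (HM v CU av vM isT) (HM w CU aw wM isT) (H (CU, x)).
have U2 : `|w (CU, x) ^+ 2| <= M ^+ 2.
  by rewrite normrX lerXn2r ?nnegrE// (HM w CU aw wM isT).
have dd : `|vd v x - vd w x| <= (3 * M ^+ 2 + 1) * d.
  have := mul_diff_le (v (Cp, x)) (w (Cp, x)) dU2 U2.
  have := ler_wpM2l (mulr_ge0 (mulr_ge0 (ler0n R 2) M0) d0) (HM v Cp av vM isT).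
  have := ler_wpM2l (sqr_ge0 M) (H (Cp, x)).
  rewrite (_ : vd v x - vd w x = (v (CU, x) ^+ 2 * v (Cp, x) - w (CU, x) ^+ 2 * w (Cp, x))
    + (v (Cn, x) - w (Cn, x))); last by rewrite /vd /dens /at_; ring.
  move=> g1 g2 g3.
  apply: (le_trans (ler_normD _ _)).
  apply: (le_trans (lerD (le_trans g3 (lerD g2 g1)) (H (Cn, x)))).
  by rewrite le_eqVlt; apply/orP; left; apply/eqP; ring.
have e1 : `|2^-1 * (vd v x - vd w x)| <= 2^-1 * ((3 * M ^+ 2 + 1) * d).
  by rewrite normrM ger0_norm ?invr_ge0// ler_wpM2l.
have dL : 0 <= cL M * d by exact: mulr_ge0.
have e2 : `|vP v x * v (Cp, x) - vP w x * w (Cp, x)| <= (cL M * M + cB M) * d.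
  apply: (le_trans (mul_diff_le _ _ dP bP)).
  rewrite [leRHS]mulrDl; apply: lerD; last exact: (ler_wpM2l cB0 (H (Cp, x))).
  by rewrite [leRHS]mulrAC; exact: (ler_wpM2l dL (HM v Cp av vM isT)).
have e3 : `|- 2 * vQ v x * v (CU, x) - - 2 * vQ w x * w (CU, x)| <= 2 * (cL M * M + cB M) * d.
  have -> : - 2 * vQ v x * v (CU, x) - - 2 * vQ w x * w (CU, x) =
     - 2 * (vQ v x * v (CU, x) - vQ w x * w (CU, x)) by ring.
  rewrite normrM normrN (ger0_norm (ler0n _ 2)) -[leRHS]mulrA.
  rewrite ler_wpM2l//; apply: (le_trans (mul_diff_le _ _ dQ bQ)).
  rewrite [leRHS]mulrDl; apply: lerD; last exact: (ler_wpM2l cB0 (H (CU, x))).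
  by rewrite [leRHS]mulrAC; exact: (ler_wpM2l dL (HM v CU av vM isT)).
have e4 : `|3 * v (CU, x) ^+ 2 - 2 * vP v x - (3 * w (CU, x) ^+ 2 - 2 * vP w x)|
    <= (6 * M + 2 * cL M) * d.
  have -> : 3 * v (CU, x) ^+ 2 - 2 * vP v x - (3 * w (CU, x) ^+ 2 - 2 * vP w x) =
    3 * (v (CU, x) ^+ 2 - w (CU, x) ^+ 2) - 2 * (vP v x - vP w x) by ring.
  apply: (le_trans (ler_normB _ _)).
  rewrite !(normrM 3) !(normrM 2) (ger0_norm (ler0n _ 3)) (ger0_norm (ler0n _ 2)).
  apply: (le_trans (lerD (ler_wpM2l (ler0n R 3) dU2) (ler_wpM2l (ler0n R 2) dP))).
  by rewrite le_eqVlt; apply/orP; left; apply/eqP; ring.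
have cLM := mulr_ge0 cL0 M0; have t2 := ler0n R 2; have t3 := ler0n R 3.
have t6 := ler0n R 6.
have k1 := addr_ge0 (mulr_ge0 t6 M0) (mulr_ge0 t2 cL0).
have k2 := addr_ge0 (mulr_ge0 t3 (sqr_ge0 M)) (mulr_ge0 t2 cB0).
have k3 := mulr_ge0 t2 (addr_ge0 cLM cB0).
have k4 := mulr_ge0 (mulr_ge0 t2 cB0) M0.
have k5 : 0 <= 2^-1 * (3 * M ^+ 2 + 1).
  exact: mulr_ge0 (ltW (ltac:(by rewrite invr_gt0) : 0 < 2^-1 :> R))
    (addr_ge0 (mulr_ge0 t3 (sqr_ge0 M)) ler01).
have e5 : `|- 2 * vQ v x * v (CU, x) * v (Cp, x) - - 2 * vQ w x * w (CU, x) * w (Cp, x)|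
    <= (2 * (cL M * M + cB M) * M + 2 * cB M * M) * d.
  apply: (le_trans (mul_diff_le _ _ e3 c1)); rewrite [leRHS]mulrDl; apply: lerD.
    by rewrite [leRHS]mulrAC; exact: (ler_wpM2l (mulr_ge0 k3 d0) (HM v Cp av vM isT)).
  exact: (ler_wpM2l k4 (H (Cp, x))).
have e6 : `|(3 * v (CU, x) ^+ 2 - 2 * vP v x) * v (Cw, x) -
     (3 * w (CU, x) ^+ 2 - 2 * vP w x) * w (Cw, x)|
    <= ((6 * M + 2 * cL M) * M + (3 * M ^+ 2 + 2 * cB M)) * d.
  apply: (le_trans (mul_diff_le _ _ e4 c2)); rewrite [leRHS]mulrDl; apply: lerD.
    by rewrite [leRHS]mulrAC; exact: (ler_wpM2l (mulr_ge0 k1 d0) (HM v Cw av vM isT)).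
  exact: (ler_wpM2l k2 (H (Cw, x))).
have k6 := addr_ge0 k5 (addr_ge0 cLM cB0).
have k7 := addr_ge0 (addr_ge0 (mulr_ge0 k3 M0) k4) (addr_ge0 (mulr_ge0 k1 M0) k2).
have fw : `|field v (Cw, x) - field w (Cw, x)| <=
    (2^-1 * (3 * M ^+ 2 + 1) + (cL M * M + cB M)) * d.
  rewrite (_ : _ - _ = 2^-1 * (vd v x - vd w x) - (vP v x * v (Cp, x) - vP w x * w (Cp, x)));
    last by rewrite /field; ring.
  by apply: (le_trans (ler_normB _ _)); rewrite [leRHS]mulrDl;
    apply: lerD; rewrite // -[leRHS]mulrA.
have fn : `|field v (Cn, x) - field w (Cn, x)| <=
    (2 * (cL M * M + cB M) * M + 2 * cB M * M +
   ((6 * M + 2 * cL M) * M + (3 * M ^+ 2 + 2 * cB M))) * d.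
  rewrite (_ : _ - _ = (- 2 * vQ v x * v (CU, x) * v (Cp, x) -
       - 2 * vQ w x * w (CU, x) * w (Cp, x)) +
    ((3 * v (CU, x) ^+ 2 - 2 * vP v x) * v (Cw, x) -
     (3 * w (CU, x) ^+ 2 - 2 * vP w x) * w (Cw, x))); last by rewrite /field; ring.
  by apply: (le_trans (ler_normD _ _)); rewrite [leRHS]mulrDl; apply: lerD.
have fQ : `|field v (CU, x) - field w (CU, x)| <= cL M * d.
  by rewrite /= -opprD normrN.
have fy : `|field v (Cy, x) - field w (Cy, x)| <= 1 * d by rewrite mul1r; exact: (H (CU, x)).
have fp : `|field v (Cp, x) - field w (Cp, x)| <= 1 * d by rewrite mul1r; exact: (H (Cw, x)).
rewrite /cFL; move: k6 k7 fw fn fQ fy fp.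
set A := 2^-1 * (3 * M ^+ 2 + 1) + (cL M * M + cB M).
set B := 2 * (cL M * M + cB M) * M + _ + _.
move: cL0; move: (cL M) => l l0 A0 B0 fw fn fQ fy fp.
by case: c; [apply: (le_trans fy)|apply: (le_trans fQ)|apply: (le_trans fp)
  |apply: (le_trans fw)|apply: (le_trans fn)]; rewrite ler_wpM2r//;
  clear -l0 A0 B0; lra.
Qed.

End Field.

(** * The globally Lipschitz cut-off field and its flow *)

Section CutoffFlow.
Variable R : realType.
Local Notation mu := (@lebesgue_measure R).
Implicit Types (v w : comp * R -> R) (M r s : R).

Definition chi (r : R) : R := Num.max 0 (Num.min 1 r).

Lemma chi_itv r : 0 <= chi r <= 1.
Proof. by rewrite /chi le_max lexx/= ge_max ler01 ge_min lexx. Qed.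

Lemma chi_ge1 r : 1 <= r -> chi r = 1.
Proof. by move=> r1; rewrite /chi (min_idPl r1) (max_idPr _) ?ler01. Qed.

Lemma chi_le0 r : r <= 0 -> chi r = 0.
Proof.
move=> r0; rewrite /chi (min_idPr _); last by rewrite (le_trans r0).
by rewrite (max_idPl _).
Qed.

Lemma chi_lip r s : `|chi r - chi s| <= `|r - s|.
Proof.
have key a b : a <= b -> 0 <= chi b - chi a <= b - a.
  move=> ab; rewrite /chi.
  case: (leP 1 a) => a1; case: (leP 1 b) => b1; case: (leP 0 a) => a0;
  case: (leP 0 b) => b0; rewrite ?(max_idPr (ler01 : 0 <= 1 :> R)) ?(max_l (ltW _))//;
  lra.
wlog sr : r s / s <= r => [H|].
  by have [/H//|/ltW /H] := leP s r; rewrite distrC (distrC r).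
have /andP[h1 h2] := key _ _ sr.
by rewrite !ger0_norm// subr_ge0.
Qed.

(** The factor is 1 for [vN v <= M] and 0 from [M + 1] on. Being independent of [i], it respects the
    identities linking [Cp] to [Cy] and [Cw] to [CU], and it multiplies the time derivative of every
    conserved quantity, hence preserves conservation laws. *)
Definition fieldM M v (i : comp * R) : R := chi (M + 1 - vN v) * field v i.

Lemma fieldM_bnd M v i : 0 <= M -> adm v -> `|fieldM M v i| <= cF (M + 1).
Proof.
move=> M0 av; have /andP[c0 c1] := chi_itv (M + 1 - vN v).
have [vM|vM] := leP (vN v) (M + 1).
  rewrite normrM ger0_norm// (le_trans _ (field_bnd i av vM))//.
  by rewrite ler_piMl.
rewrite /fieldM chi_le0 ?mul0r ?normr0; last by rewrite subr_le0 ltW.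
have M10 : 0 <= M + 1 by rewrite addr_ge0.
have B := cB_ge0 M10; rewrite /cF.
have t := mulr_ge0 (mulr_ge0 (ler0n R 2) B) M10.
have t2 := addr_ge0 (mulr_ge0 (ler0n R 3) (sqr_ge0 (M + 1))) (mulr_ge0 (ler0n R 2) B).
rewrite !addr_ge0 ?(mulr_ge0 t M10) ?(mulr_ge0 t2 M10) ?(mulr_ge0 B M10)//.
by rewrite mulr_ge0// addr_ge0// exprn_ge0.
Qed.

Lemma fieldM_lip M v w (d : R) i : 0 <= M -> adm v -> adm w -> 0 <= d ->
  (forall i, `|v i - w i| <= d) ->
  `|fieldM M v i - fieldM M w i| <= (cFL (M + 1) + cF (M + 1)) * d.
Proof.
move=> M0 av aw d0 H.
have M10 : 0 <= M + 1 by rewrite addr_ge0.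
have dN := vN_lip av aw H.
have dchi : `|chi (M + 1 - vN v) - chi (M + 1 - vN w)| <= d.
  apply: (le_trans (chi_lip _ _)).
  by rewrite (_ : _ - _ = - (vN v - vN w)) ?normrN//; ring.
have cF0 : 0 <= cF (M + 1) by exact: le_trans (normr_ge0 _) (fieldM_bnd (CU, 0) M0 av).
have cFL0 : 0 <= cFL (M + 1).
  have B := cB_ge0 M10; have L := cL_ge0 M10; rewrite /cFL.
  have cLM := mulr_ge0 L M10; have t2 := ler0n R 2; have t3 := ler0n R 3.
  have t6 := ler0n R 6.
  have k1 := mulr_ge0 (addr_ge0 (mulr_ge0 t6 M10) (mulr_ge0 t2 L)) M10.
  have k2 := addr_ge0 (mulr_ge0 t3 (sqr_ge0 (M + 1))) (mulr_ge0 t2 B).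
  have k3 := mulr_ge0 (mulr_ge0 t2 (addr_ge0 cLM B)) M10.
  have k4 := mulr_ge0 (mulr_ge0 t2 B) M10.
  have h2 : 0 <= 2^-1 :> R by rewrite invr_ge0.
  have k5 := mulr_ge0 h2 (addr_ge0 (mulr_ge0 t3 (sqr_ge0 (M + 1))) (@ler01 R)).
  exact: addr_ge0 (addr_ge0 (addr_ge0 ler01 L) (addr_ge0 k5 (addr_ge0 cLM B)))
    (addr_ge0 (addr_ge0 k3 k4) (addr_ge0 k1 k2)).
(* If [w'] lies beyond the level [M + 1], its cut-off field is 0 and the factor at [v'] is at most
   [d], so the bound [cF] of the field takes the place of a Lipschitz constant. *)
have out v' w' : adm v' -> adm w' -> M + 1 < vN w' ->
    `|chi (M + 1 - vN v') - chi (M + 1 - vN w')| <= d ->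
    `|fieldM M v' i - fieldM M w' i| <= (cFL (M + 1) + cF (M + 1)) * d.
  move=> av' aw' w'M dc.
  have cw : chi (M + 1 - vN w') = 0 by rewrite chi_le0// subr_le0 ltW.
  rewrite cw subr0 in dc; rewrite /fieldM cw mul0r subr0 normrM.
  have [v'M|v'M] := leP (vN v') (M + 1); last first.
    rewrite chi_le0 ?normr0 ?mul0r; last by rewrite subr_le0 ltW.
    exact: mulr_ge0 (addr_ge0 cFL0 cF0) d0.
  apply: (@le_trans _ _ (cF (M + 1) * d)); last by rewrite ler_wpM2r// lerDr.
  by rewrite mulrC ler_pM// field_bnd.
have [vM|vM] := leP (vN v) (M + 1); last first.
  by rewrite distrC; apply: out => //; rewrite distrC.
have [wM|wM] := leP (vN w) (M + 1); last exact: out.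
rewrite /fieldM distrC [chi (M + 1 - vN w) * _]mulrC [chi (M + 1 - vN v) * _]mulrC.
have /andP[c0 c1] := chi_itv (M + 1 - vN w).
have fl := field_lip i av aw vM wM d0 H; rewrite distrC in fl.
have fb := field_bnd i av vM.
apply: (le_trans (mul_diff_le _ _ fl fb)).
rewrite [leRHS]mulrDl; apply: lerD.
  by rewrite (ger0_norm c0); exact: ler_piMr (mulr_ge0 cFL0 d0) c1.
by rewrite ler_wpM2l// distrC.
Qed.

Lemma adm_step M v (h : R) : 0 <= M -> adm v -> 0 <= h ->
  adm (fun i => v i + h * fieldM M v i).
Proof.
move=> M0 av h0; set c := chi (M + 1 - vN v).
have perP x : vP v (x + 1) = vP v x by rewrite /vP fracD1.
have perQ x : vQ v (x + 1) = vQ v x by rewrite /vQ fracD1.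
have per := a_per av.
have pU x : v (CU, x + 1) = v (CU, x) := per CU x isT.
have pp x : v (Cp, x + 1) = v (Cp, x) := per Cp x isT.
have pw x : v (Cw, x + 1) = v (Cw, x) := per Cw x isT.
have pn x : v (Cn, x + 1) = v (Cn, x) := per Cn x isT.
have perd x : vd v (x + 1) = vd v x by rewrite /vd /dens /at_ pU pp pn.
have perF c' x : field v (c', x + 1) = field v (c', x).
  by case: c' => /=; rewrite ?perP ?perQ ?perd ?pU ?pp ?pw.
have mc c' : ncy c' -> measurable_fun [set: R] (fun x => v (c', x)) := @a_m _ _ av c'.
have mP := measurable_vP av; have mQ := measurable_vQ av.
have mU2 : measurable_fun [set: R] (fun x => v (CU, x) ^+ 2).
  by apply: measurable_funX; exact: mc.
have md : measurable_fun [set: R] (vd v).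
  apply: measurable_funD; last exact: (mc Cn).
  by apply: measurable_funM; [exact: mU2|exact: (mc Cp)].
have mf c' : ncy c' -> measurable_fun [set: R] (fun x => field v (c', x)).
  case: c' => //= _.
  - exact: measurableT_comp.
  - exact: (mc Cw).
  - apply: measurable_funB; first by apply: measurable_funM.
    by apply: measurable_funM => //; exact: (mc Cp).
  - apply: measurable_funD; apply: measurable_funM; last exact: (mc Cw).
    + apply: measurable_funM; last exact: (mc CU).
      by apply: measurable_funM.
    + exact: (mc Cp).
    + by apply: measurable_funB; apply: measurable_funM.
have [pP pQ] := prim_vP_vQ av.
split.
- by move=> x; rewrite /fieldM perF (a_yper av); ring.
- by move=> c' x nc; rewrite /fieldM perF per.
- have [B HB] := a_bd av; exists (B + h * cF (M + 1)) => c' x nc.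
  apply: (le_trans (ler_normD _ _)); apply: lerD; first exact: HB.
  by rewrite normrM ger0_norm// ler_wpM2l// fieldM_bnd.
- move=> c' nc; apply: measurable_funD; first exact: mc.
  by apply: measurable_funM => //; apply: measurable_funM => //; exact: mf.
- exact: primD (a_y av) (primZ h (primZ c (a_U av))).
- apply: eq_prim (primD (a_U av) (primZ h (primZ c (primN pQ)))) => x _ //.
  by rewrite /at_ /fieldM /= -/c opprB.
Qed.

Lemma hstep_small (C e : R) : 0 < e -> exists N : nat, forall n, (N <= n)%N ->
  C * hstep R n <= e.
Proof.
move=> e0; have [N HN] : exists N, C * hstep R N < e.
  apply/not_existsP => H; move: e0; apply/negP; rewrite -leNgt.
  apply: (@le_hstep R _ _ C) => n; rewrite add0r leNgt; apply/negP; exact: H.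
exists N => n Nn; have [C0|C0] := leP 0 C.
  by apply: le_trans (ltW HN); rewrite ler_wpM2l// hstep_decr.
by apply: le_trans (ltW e0); rewrite nmulr_rle0// ltW// hstep_gt0.
Qed.

Lemma prim_lim (fn gn : nat -> R -> R) (f g : R -> R) (C : R) :
  measurable_fun (`[0, 1] : set R) g -> (exists M, forall x, `|g x| <= M) ->
  (forall n, prim 0 1 (fn n) (gn n)) ->
  (forall n x, `|fn n x - f x| <= C * hstep R n) ->
  (forall n x, `|gn n x - g x| <= C * hstep R n) -> prim 0 1 f g.
Proof.
move=> mg [M gM] pn Hf Hg.
have ig : integ 0 1 g by apply: integ_bnd mg (fun x _ => gM x).
apply: primP => // x y x0 xy y1; apply/eqP; rewrite -subr_eq0 -normr_le0.
apply: (@le_hstep R _ _ (3 * C)) => n; rewrite add0r.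
have igx := integS x0 y1 ig; have ign := integS x0 y1 (pn n).1.
have e1 : `|itg x y (gn n) - itg x y g| <= C * hstep R n.
  rewrite -itgB//.
  apply: (@le_trans _ _ (itg x y (fun=> C * hstep R n))).
    apply: itg_norm_le; [exact: integB|exact: integ_cst|].
    by move=> t _; exact: Hg.
  have Ch : 0 <= C * hstep R n := le_trans (normr_ge0 _) (Hf n 0).
  by rewrite itg_cst// ler_piMr//; lra.
have pnE := prim_diff (pn n) x0 xy y1.
have -> : f y - f x - itg x y g = - (fn n y - f y) + (fn n x - f x) +
   (itg x y (gn n) - itg x y g) by rewrite -pnE; ring.
apply: (le_trans (ler_normD _ _)).
have := ler_normD (- (fn n y - f y)) (fn n x - f x).
have := Hf n y; have := Hf n x; rewrite normrN; move: e1.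
set a := `|_ - _|; set b := `|_ - _|; set c := `|_ - _|; set d := `|_ + _|; lra.
Qed.

Lemma adm_lim (vn : nat -> comp * R -> R) v (C : R) : (forall n, adm (vn n)) ->
  (forall n i, `|vn n i - v i| <= C * hstep R n) -> adm v.
Proof.
move=> an H.
have mv c : ncy c -> measurable_fun [set: R] (at_ v c).
  move=> nc.
  have mn n : measurable_fun [set: R] (at_ (vn n) c) by exact: a_m (an n) _ nc.
  apply: (measurable_fun_cvg mn) => x _; apply/cvgrPdist_le => e e0.
  have [N HN] := hstep_small C e0; exists N => // n /= Nn.
  by rewrite distrC (le_trans (H n (c, x)))// HN.
have bv : exists M, forall c x, ncy c -> `|v (c, x)| <= M.
  have [B HB] := a_bd (an 0%N); exists (B + C * hstep R 0) => c x nc.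
  have := ler_normB (vn 0%N (c, x)) (vn 0%N (c, x) - v (c, x)).
  rewrite subKr; have := HB c x nc; have := H 0%N (c, x); lra.
have eqz (a : R) (B : R) : (forall n, `|a| <= B * hstep R n) -> a = 0.
  move=> Ha; apply/eqP; rewrite -normr_le0.
  by apply: (@le_hstep R _ _ B) => n; rewrite add0r.
have [B HB] := bv.
split => //.
- move=> x; apply/eqP; rewrite -subr_eq0; apply/eqP; apply: (@eqz _ (2 * C)) => n.
  have -> : v (Cy, x + 1) - (v (Cy, x) + 1) =
    (vn n (Cy, x) - v (Cy, x)) - (vn n (Cy, x + 1) - v (Cy, x + 1)).
    by rewrite (a_yper (an n)); ring.
  apply: (le_trans (ler_normB _ _)).
  by have := H n (Cy, x); have := H n (Cy, x + 1); lra.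
- move=> c x nc; apply/eqP; rewrite -subr_eq0; apply/eqP; apply: (@eqz _ (2 * C)) => n.
  have -> : v (c, x + 1) - v (c, x) =
    (vn n (c, x) - v (c, x)) - (vn n (c, x + 1) - v (c, x + 1)).
    by rewrite (a_per (an n))//; ring.
  apply: (le_trans (ler_normB _ _)).
  by have := H n (c, x); have := H n (c, x + 1); lra.
- apply: (prim_lim (fn := fun n => at_ (vn n) Cy) (gn := fun n => at_ (vn n) Cp) (C := C)).
  + exact: mfun_itv (mv Cp isT).
  + by exists B => x; exact: HB.
  + by move=> n; exact: a_y (an n).
  + by move=> n x; exact: H.
  + by move=> n x; exact: H.
- apply: (prim_lim (fn := fun n => at_ (vn n) CU) (gn := fun n => at_ (vn n) Cw) (C := C)).
  + exact: mfun_itv (mv Cw isT).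
  + by exists B => x; exact: HB.
  + by move=> n; exact: a_U (an n).
  + by move=> n x; exact: H.
  + by move=> n x; exact: H.
Qed.

Lemma cutoff_flow M (T : R) v0 : 0 <= M -> 0 <= T -> adm v0 ->
  exists (u : R -> comp * R -> R) (C1 C2 : R),
  [/\ u 0 = v0, forall t, 0 <= t <= T -> adm (u t),
      forall t s i, 0 <= t <= T -> 0 <= s <= T -> `|u s i - u t i| <= C1 * `|s - t|
    & forall t s i, 0 <= t <= T -> 0 <= s <= T ->
        `|u s i - u t i - (s - t) * fieldM M (u t) i| <= C2 * (s - t) ^+ 2].
Proof.
move=> M0 T0 a0; set K := cF (M + 1); set L := cFL (M + 1) + cF (M + 1).
have K0 : 0 <= K by exact: le_trans (normr_ge0 _) (fieldM_bnd (CU, 0) M0 a0).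
have L0 : 0 <= L.
  have := fieldM_lip (CU, 0) M0 a0 a0 ler01; rewrite mulr1 => H.
  by apply: le_trans (normr_ge0 _) (H _) => i; rewrite subrr normr0.
have [u [h1 h2 h3 h4]] := euler (W := @adm R) K0 L0 (fun v av i => fieldM_bnd i M0 av)
  (fun v w d av aw d0 H i => fieldM_lip i M0 av aw d0 H)
  (fun v h av h0 => adm_step M0 av h0) adm_lim a0 T0.
by exists u, (K + L * K * T), ((2 + L * T) * L * K).
Qed.

End CutoffFlow.

(** * Invariants and a priori bounds *)

Section QuadraticDerivative.
Variables (R : realType) (T : R).
Implicit Types (f g : R -> R).

(* Bounded Lipschitz functions on [0, T] with derivative f' and a remainder
   of order two, which makes the two-sided derivative at the end points and
   products elementary. *)
Definition qd f f' := exists C : R, forall t s : R, 0 <= t <= T -> 0 <= s <= T ->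
  [/\ `|f t| <= C, `|f s - f t| <= C * `|s - t| &
      `|f s - f t - (s - t) * f' t| <= C * (s - t) ^+ 2].

Lemma qdD f f' g g' : qd f f' -> qd g g' ->
  qd (fun t => f t + g t) (fun t => f' t + g' t).
Proof.
move=> [C Hf] [D Hg]; exists (C + D) => t s tT sT.
have [f1 f2 f3] := Hf t s tT sT; have [g1 g2 g3] := Hg t s tT sT.
split; first exact: le_trans (ler_normD _ _) (lerD f1 g1).
  rewrite (_ : _ - _ = (f s - f t) + (g s - g t)); last by ring.
  by rewrite [leRHS]mulrDl; exact: le_trans (ler_normD _ _) (lerD f2 g2).
rewrite (_ : _ - _ - _ = (f s - f t - (s - t) * f' t) + (g s - g t - (s - t) * g' t));
  last by ring.
by rewrite [leRHS]mulrDl; exact: le_trans (ler_normD _ _) (lerD f3 g3).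
Qed.

Lemma qdM f f' g g' : qd f f' -> qd g g' ->
  qd (fun t => f t * g t) (fun t => f' t * g t + f t * g' t).
Proof.
move=> [C Hf] [D Hg]; exists (3 * (C * D)) => t s tT sT.
have [f1 f2 f3] := Hf t s tT sT; have [g1 g2 g3] := Hg t s tT sT.
have [fs1 _ _] := Hf s t sT tT.
have C0 := le_trans (normr_ge0 _) f1; have D0 := le_trans (normr_ge0 _) g1.
have CD := mulr_ge0 C0 D0.
have h0 := normr_ge0 (s - t); have h2 := sqr_ge0 (s - t).
split.
- rewrite normrM; apply: (le_trans (ler_pM (normr_ge0 _) (normr_ge0 _) f1 g1)); lra.
- rewrite (_ : _ - _ = f s * (g s - g t) + (f s - f t) * g t); last by ring.
  apply: (le_trans (ler_normD _ _)); rewrite !normrM.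
  have k1 : `|f s| * `|g s - g t| <= C * (D * `|s - t|) by rewrite ler_pM.
  have k2 : `|f s - f t| * `|g t| <= C * `|s - t| * D by rewrite ler_pM.
  have k3 := mulr_ge0 CD h0.
  by apply: (le_trans (lerD k1 k2)); lra.
- rewrite (_ : _ - _ - _ = (f s - f t - (s - t) * f' t) * g t +
    f t * (g s - g t - (s - t) * g' t) + (f s - f t) * (g s - g t)); last by ring.
  have k1 : `|(f s - f t - (s - t) * f' t) * g t| <= C * (s - t) ^+ 2 * D.
    by rewrite normrM ler_pM.
  have k2 : `|f t * (g s - g t - (s - t) * g' t)| <= C * (D * (s - t) ^+ 2).
    by rewrite normrM ler_pM.
  have k3 : `|(f s - f t) * (g s - g t)| <= C * `|s - t| * (D * `|s - t|).
    by rewrite normrM ler_pM.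
  have k4 : C * `|s - t| * (D * `|s - t|) = C * D * (s - t) ^+ 2.
    by rewrite -[in RHS](real_normK (num_real (s - t))); ring.
  rewrite k4 in k3.
  apply: (le_trans (ler_normD _ _)).
  apply: (le_trans (lerD (le_trans (ler_normD _ _) (lerD k1 k2)) k3)).
  by rewrite le_eqVlt; apply/orP; left; apply/eqP; ring.
Qed.

Lemma qd_cst (k : R) : qd (fun=> k) (fun=> 0).
Proof.
exists `|k| => t s _ _; rewrite mulr0 !subrr normr0.
split; [by []|exact: mulr_ge0|exact: (mulr_ge0 (normr_ge0 k) (sqr_ge0 (s - t)))].
Qed.

Lemma eq_qd f f' g' : (forall t : R, 0 <= t <= T -> f' t = g' t) -> qd f f' -> qd f g'.
Proof.
move=> e [C H]; exists C => t s tT sT; have [h1 h2 h3] := H t s tT sT.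
by rewrite -e.
Qed.

Lemma qd_growth f f' (L : R) : 0 <= L -> qd f f' ->
  (forall t : R, 0 <= t <= T -> `|f' t| <= L * `|f t|) ->
  forall t : R, 0 <= t <= T -> `|f t| <= `|f 0| * expR (L * t).
Proof.
move=> L0 [C H] HL.
apply: (gronwall_dini (f := fun t => `|f t|)) => // t e tT e0.
have C0 : 0 <= C.
  by have [+ _ _] := H t t tT tT; apply: le_trans.
exists (e / (C + 1)); first by rewrite divr_gt0// ltr_wpDl.
move=> s sT; rewrite ltr_pdivlMr ?ltr_wpDl// => /ltW hs.
have [_ h2 h3] := H t s tT sT.
have hC : C * `|s - t| <= e.
  by apply: le_trans hs; rewrite mulrC ler_wpM2l// lerDl.
split; first exact: le_trans (ler_dist_dist _ _) (le_trans h2 hC).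
move=> ts; have st0 : 0 <= s - t by rewrite subr_ge0.
have -> : f s = f t + (s - t) * f' t + (f s - f t - (s - t) * f' t) by ring.
apply: (le_trans (ler_normD _ _)); apply: (le_trans (lerD (ler_normD _ _) h3)).
rewrite normrM (ger0_norm st0) -addrA lerD2l [leRHS]mulrDl.
apply: lerD; first by rewrite mulrC ler_wpM2r// HL.
rewrite expr2 mulrA ler_wpM2r//.
by rewrite (ger0_norm st0) in hC.
Qed.

(** Gronwall run backwards from time [t]: the function [f (t - s)] of [s] has derivative [- f'],
    subject to the same bound. *)
Lemma qd_lower f f' (L : R) : 0 <= L -> qd f f' ->
  (forall t : R, 0 <= t <= T -> `|f' t| <= L * `|f t|) ->
  forall t : R, 0 <= t <= T -> `|f 0| <= `|f t| * expR (L * t).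
Proof.
move=> L0 [C H] HL t /andP[t0 tT].
have inT s : 0 <= s <= t -> 0 <= t - s <= T by lra.
have [Cf Hf] : exists C : R, forall x s : R, 0 <= x <= t -> 0 <= s <= t ->
  [/\ `|f (t - x)| <= C, `|f (t - s) - f (t - x)| <= C * `|s - x| &
   `|f (t - s) - f (t - x) - (s - x) * - f' (t - x)| <= C * (s - x) ^+ 2].
  exists C => x s /inT xT /inT sT; have [h1 h2 h3] := H _ _ xT sT.
  rewrite (_ : t - s - (t - x) = - (s - x)) ?normrN in h2 h3; last by ring.
  by split => //; move: h3; rewrite sqrrN mulrN mulNr.
have C0 : 0 <= C.
  have t01 : 0 <= t <= T by rewrite t0.
  by have [+ _ _] := H t t t01 t01; apply: le_trans.
have := @gronwall_dini R (fun s => `|f (t - s)|) L t L0 (normr_ge0 _).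
rewrite subr0 => /(_ _ t); rewrite subrr; apply; last by rewrite t0 lexx.
move=> x e xt e0.
have Cf0 : 0 <= Cf.
  by have [+ _ _] := Hf x x xt xt; apply: le_trans.
exists (e / (Cf + 1)); first by rewrite divr_gt0// ltr_wpDl.
move=> s st; rewrite ltr_pdivlMr ?ltr_wpDl// => /ltW hs.
have [_ h2 h3] := Hf x s xt st.
have hC : Cf * `|s - x| <= e.
  by apply: le_trans hs; rewrite mulrC ler_wpM2l// lerDl.
split; first exact: le_trans (ler_dist_dist _ _) (le_trans h2 hC).
move=> xs; have sx0 : 0 <= s - x by rewrite subr_ge0.
have -> : f (t - s) = f (t - x) + (s - x) * - f' (t - x) +
   (f (t - s) - f (t - x) - (s - x) * - f' (t - x)) by ring.
apply: (le_trans (ler_normD _ _)); apply: (le_trans (lerD (ler_normD _ _) h3)).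
rewrite normrM normrN (ger0_norm sx0) -addrA lerD2l [leRHS]mulrDl.
apply: lerD; first by rewrite mulrC ler_wpM2r// HL// inT.
rewrite expr2 mulrA ler_wpM2r//.
by rewrite (ger0_norm sx0) in hC.
Qed.

Lemma qd_const f : qd f (fun=> 0) -> forall t : R, 0 <= t <= T -> f t = f 0.
Proof.
move=> qf t tT.
have q0 := qdD qf (qd_cst (- f 0)).
have := qd_growth (lexx 0) q0 _ tT.
rewrite subrr normr0 mul0r => H; apply/eqP; rewrite -subr_eq0 -normr_le0.
by apply: H => s _; rewrite addr0 normr0 mul0r.
Qed.

Lemma qd_cont f f' : qd f f' -> {within `[0, T], continuous f}.
Proof.
move=> [C H]; apply: within_cont_eps => t e tT e0.
have C0 : 0 <= C by have [+ _ _] := H t t tT tT; apply: le_trans.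
exists (e / (C + 1)); first by rewrite divr_gt0// ltr_wpDl.
move=> s sT; rewrite ltr_pdivlMr ?ltr_wpDl// => /ltW hs.
have [_ h2 _] := H t s tT sT; apply: (le_trans h2); apply: le_trans hs.
by rewrite mulrC ler_wpM2l// lerDl.
Qed.

(** The lower bound on [|f|] forbids zeros, so by the intermediate value theorem [f] keeps its
    initial sign. *)
Lemma qd_pos f f' (L : R) : 0 <= L -> qd f f' ->
  (forall t : R, 0 <= t <= T -> `|f' t| <= L * `|f t|) -> 0 < f 0 ->
  forall t : R, 0 <= t <= T -> f 0 <= f t * expR (L * t).
Proof.
move=> L0 qf HL f0 t tT; have /andP[t0 tT'] := tT.
have lo s : 0 <= s <= T -> f 0 <= `|f s| * expR (L * s).
  by move=> sT; have := qd_lower L0 qf HL sT; rewrite (gtr0_norm f0).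
have [ft|ft] := leP 0 (f t); first by have := lo t tT; rewrite ger0_norm.
have cf : {within `[0, t], continuous f}.
  apply: continuous_subspaceW (qd_cont qf) => s /=; rewrite !in_itv/=.
  by move=> /andP[-> st]; rewrite (le_trans st).
have [|s] := @IVT R f 0 t 0 t0 cf.
  by rewrite ge_min le_max (ltW f0) (ltW ft) orbT.
rewrite in_itv/= => /andP[s0 st] fs; have sT : 0 <= s <= T by rewrite s0 (le_trans st).
by have := lo s sT; rewrite fs normr0 mul0r leNgt f0.
Qed.

End QuadraticDerivative.

Section Invariants.
Variable R : realType.
Local Notation mu := (@lebesgue_measure R).
Implicit Types (v w : comp * R -> R) (x M : R) (r : R -> R).

Definition constraint v r x := v (Cp, x) * v (Cn, x) =
  v (Cp, x) ^+ 2 * v (CU, x) ^+ 2 + v (Cw, x) ^+ 2 + r x ^+ 2.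

(** The conditions of F imposed at every point instead of almost everywhere. The fourth component
    [r] is a separate parameter because it does not evolve. *)
Record good v r (c : R) : Prop := Good {
  g_adm : adm v;
  g_c : 0 < c;
  g_p : forall x, 0 <= v (Cp, x);
  g_n : forall x, 0 <= v (Cn, x);
  g_pn : forall x, c <= v (Cp, x) + v (Cn, x);
  g_constraint : forall x, constraint v r x }.

Definition energy v : R := itg 0 1 (at_ v Cn).

(** The relation gives [w ^ 2 <= p n], and the arithmetic-geometric mean inequality yields the first
    bound. For the second, [2 p |U| |w| <= p ^ 2 U ^ 2 + w ^ 2 <= p n] is divided by [p]; the third
    is a division as well. If [p = 0], the relation forces [w = 0]. *)
Lemma constraint_bounds (p n U w r : R) : 0 <= p -> 0 <= n ->
  p * n = p ^+ 2 * U ^+ 2 + w ^+ 2 + r ^+ 2 ->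
  [/\ `|w| <= 2^-1 * (p + n), `|2 * U * w| <= n & U ^+ 2 * p <= n].
Proof.
move=> p0 n0 e.
have w2 : `|w| ^+ 2 <= p * n by rewrite real_normK ?num_real// e; nra.
have h1 : `|w| <= 2^-1 * (p + n).
  have := normr_ge0 w; move: w2; move: `|w| => a a2 a0.
  rewrite leNgt; apply/negP => h.
  have : (2^-1 * (p + n)) ^+ 2 < a ^+ 2 by rewrite ltr_pXn2r// nnegrE; lra.
  have := sqr_ge0 (p - n); nra.
move: p0; rewrite le_eqVlt => /predU1P[p0|p0].
  rewrite -p0 expr0n mul0r mul0r add0r in e.
  have w0 : w = 0.
    have : w ^+ 2 = 0 by have := sqr_ge0 w; have := sqr_ge0 r; lra.
    by move/eqP; rewrite sqrf_eq0 => /eqP.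
  by split => //; rewrite ?w0 -?p0 ?mulr0 ?normr0.
split => //.
  rewrite -(ler_pM2l p0).
  have -> : p * `|2 * U * w| = 2 * (p * `|U|) * `|w|.
    by rewrite !normrM (ger0_norm (ler0n _ 2)); ring.
  have := sqr_ge0 (p * `|U| - `|w|); have := real_normK (num_real U).
  have := real_normK (num_real w); have := sqr_ge0 r.
  move: `|U| `|w| => a b h0 hb ha h2; rewrite -hb -ha in e; nra.
rewrite -(ler_pM2l p0); have := sqr_ge0 w; have := sqr_ge0 r; nra.
Qed.

(** Since [p >= 0] has mass 1 and [n >= 0] has mass H, only [w] and [U] need work. The bound
    [|w| <= (p + n) / 2] gives the mass of [w]. As [(U ^ 2)_xi = 2 U w] is at most [n] in absolute
    value, [U ^ 2] oscillates by at most H. *)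
Lemma good_bounds v r c : good v r c ->
  0 <= energy v /\ bounded01 (1 + energy v) (at_ v Cy) (at_ v Cp) (at_ v CU)
    (at_ v Cw) (at_ v Cn).
Proof.
move=> g; have av := g_adm g.
have K x := constraint_bounds (g_p g x) (g_n g x) (g_constraint g x).
have ipn : forall c', ncy c' -> integ 0 1 (at_ v c').
  by move=> c' nc; have [] := integ_bounded av nc (fun x => vN_ub x av nc).
have ip := ipn Cp isT; have iw := ipn Cw isT; have in_ := ipn Cn isT.
set H := energy v.
have H0 : 0 <= H by apply: itg_ge0 => x _; exact: g_n g x.
have p1 : itg 0 1 (at_ v Cp) = 1.
  rewrite -(prim_diff (a_y av))// (adm_y1 av); ring.
have ap : itg 0 1 (fun x => `|at_ v Cp x|) = 1.
  by rewrite -[RHS]p1; apply: eq_itg => x _; rewrite ger0_norm// (g_p g).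
have an : itg 0 1 (fun x => `|at_ v Cn x|) = H.
  by apply: eq_itg => x _; rewrite ger0_norm// (g_n g).
have aw : itg 0 1 (fun x => `|at_ v Cw x|) <= 1 + H.
  apply: (@le_trans _ _ (itg 0 1 (fun x => 2^-1 * (at_ v Cp x + at_ v Cn x)))).
    apply: itg_le; [exact: integ_norm|exact: integZ (integD ip in_)|].
    by move=> x _; have [] := K x.
  rewrite itgZ; last exact: integD.
  by rewrite itgD// p1 -/(energy v) -/H; lra.
have pU2 := primM ler01 (a_U av) (a_U av).
have iUw := pU2.1.
have osc x t : 0 <= x <= 1 -> 0 <= t <= 1 -> at_ v CU x ^+ 2 <= at_ v CU t ^+ 2 + H.
  have key x' t' : 0 <= x' -> x' <= t' -> t' <= 1 ->
      `|at_ v CU t' ^+ 2 - at_ v CU x' ^+ 2| <= H.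
    move=> x0 xt t1; have := prim_norm_le pU2 x0 xt t1; rewrite -!expr2 => /le_trans; apply.
    apply: (@le_trans _ _ (itg 0 1 (fun y =>
      `|at_ v Cw y * at_ v CU y + at_ v CU y * at_ v Cw y|))).
      by apply: itg_sub_le (integ_norm iUw) _.
    apply: itg_le; [exact: integ_norm|exact: in_|].
    move=> y _; rewrite (_ : _ + _ = 2 * v (CU, y) * v (Cw, y)); last by rewrite /at_; ring.
    by have [] := K y.
  move=> /andP[x0 x1] /andP[t0 t1]; have [xt|/ltW tx] := leP x t.
    by have := key _ _ x0 xt t1; rewrite ler_norml; lra.
  by have := key _ _ t0 tx x1; rewrite ler_norml; lra.
(* Averaging against the probability density [p]: [U ^ 2] exceeds its mean by at most H, and the
   mean is at most H because [U ^ 2 p <= n]. Then [2 H < (1 + H) ^ 2] turns this into the bound on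
   [U]. *)
have U2 x : 0 <= x <= 1 -> at_ v CU x ^+ 2 <= 2 * H.
  move=> x01; have iU2p := integ_sqrM (a_U av) ip.
  have -> : at_ v CU x ^+ 2 = itg 0 1 (fun t => at_ v CU x ^+ 2 * at_ v Cp t).
    by rewrite itgZ// p1 mulr1.
  apply: (@le_trans _ _ (itg 0 1 (fun t => at_ v CU t ^+ 2 * at_ v Cp t + H * at_ v Cp t))).
    apply: itg_le; [exact: integZ|exact: integD iU2p (integZ H ip)|].
    by move=> t t01; rewrite -mulrDl ler_wpM2r ?(g_p g)// osc.
  rewrite itgD ?itgZ//; last exact: integZ.
  rewrite p1 mulr1 (_ : 2 * H = H + H); last by ring.
  rewrite lerD2r; apply: itg_le => // t _.
  by have [] := K t.
have UH x : 0 <= x <= 1 -> `|at_ v CU x| <= 1 + H.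
  move=> x01; have := U2 x x01; rewrite -real_normK ?num_real//.
  have := normr_ge0 (at_ v CU x); move: `|at_ v CU x| => a a0 a2.
  rewrite leNgt; apply/negP => h.
  have : (1 + H) ^+ 2 < a ^+ 2 by rewrite ltr_pXn2r// nnegrE; lra.
  nra.
split => //; apply: Bounded01 (a_y av) (a_U av) in_ UH _ aw _.
  by rewrite ap; lra.
by rewrite an; lra.
Qed.

Lemma adm_frac v c x : adm v -> ncy c -> v (c, x) = v (c, frac x).
Proof.
move=> av nc; have pf : periodic (at_ v c) 1 by move=> t; exact: a_per av _ _ nc.
exact: periodic_frac pf x.
Qed.

Lemma good_coef v r c x : good v r c -> let K := 1 + energy v in
  `|2 * vQ v x * v (CU, x)| <= 2 * cB K * K /\
  `|3 * v (CU, x) ^+ 2 - 2 * vP v x| <= 3 * K ^+ 2 + 2 * cB K.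
Proof.
move=> g K; have [E0 b] := good_bounds g; rewrite -/K in b.
have K0 := b_M0 b.
have [bP bQ] := kPQ_cB b (frac01 x); rewrite -/(vP v x) -/(vQ v x) in bP bQ.
have UM : `|v (CU, x)| <= K.
  by rewrite (adm_frac x (g_adm g) (isT : ncy CU)); exact: (b_UM b (frac01 x)).
split.
  rewrite !normrM (ger0_norm (ler0n _ 2)); apply: ler_pM => //.
  by rewrite ler_wpM2l.
apply: (le_trans (ler_normB _ _)).
rewrite !(normrM 3) !(normrM 2) (ger0_norm (ler0n _ 3)) (ger0_norm (ler0n _ 2)).
apply: lerD; last by rewrite ler_wpM2l.
by rewrite ler_wpM2l// normrX lerXn2r ?nnegrE.
Qed.

Section Flow.
Variables (M T : R) (v0 : comp * R -> R) (r : R -> R) (c0 : R).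
Variables (u : R -> comp * R -> R) (C1 C2 : R).
Hypotheses (M0 : 0 <= M) (T0 : 0 <= T) (gv0 : good v0 r c0) (u0 : u 0 = v0).
Hypothesis u_adm : forall t : R, 0 <= t <= T -> adm (u t).
Hypothesis u_lip : forall (t s : R) i, 0 <= t <= T -> 0 <= s <= T ->
  `|u s i - u t i| <= C1 * `|s - t|.
Hypothesis u_quad : forall (t s : R) i, 0 <= t <= T -> 0 <= s <= T ->
  `|u s i - u t i - (s - t) * fieldM M (u t) i| <= C2 * (s - t) ^+ 2.

Let chit (t : R) := chi (M + 1 - vN (u t)).

Let u_qd i : qd T (fun t => u t i) (fun t => chit t * field (u t) i).
Proof.
have z0 : 0 <= (0 : R) <= T by rewrite lexx T0.
have zT : 0 <= T <= T by rewrite lexx T0.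
exists (`|C1| + `|C2| + (`|v0 i| + `|C1| * T)) => t s tT sT.
have a0 : 0 <= `|v0 i| + `|C1| * T by rewrite addr_ge0// mulr_ge0.
have n1 := normr_ge0 C1; have n2 := normr_ge0 C2.
split.
- have := u_lip i z0 tT; rewrite u0 subr0 => h.
  have /andP[t0 tT'] := tT.
  have h2 : C1 * `|t| <= `|C1| * T.
    rewrite (ger0_norm t0); exact: le_trans (ler_wpM2r t0 (ler_norm C1)) (ler_wpM2l n1 tT').
  have := ler_normD (u t i - v0 i) (v0 i); rewrite subrK; lra.
- apply: (le_trans (u_lip i tT sT)); rewrite ler_wpM2r//.
  by have := ler_norm C1; lra.
- apply: (le_trans (u_quad i tT sT)); rewrite ler_wpM2r ?sqr_ge0//.
  by have := ler_norm C2; lra.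
Qed.

(** Along the field the derivative of [p n - p ^ 2 U ^ 2 - w ^ 2] vanishes identically, whatever
    values [P] and [Q] take; the cut-off merely multiplies it by a scalar. *)
Lemma flow_constraint t x : 0 <= t <= T -> constraint (u t) r x.
Proof.
move=> tT.
have qp := u_qd (Cp, x); have qn := u_qd (Cn, x); have qU := u_qd (CU, x).
have qw := u_qd (Cw, x).
have q := qdD (qdD (qdM qp qn) (qdM (qd_cst T (-1)) (qdM (qdM qp qp) (qdM qU qU))))
  (qdM (qd_cst T (-1)) (qdM qw qw)).
pose f t := u t (Cp, x) * u t (Cn, x) +
  -1 * (u t (Cp, x) * u t (Cp, x) * (u t (CU, x) * u t (CU, x))) +
  -1 * (u t (Cw, x) * u t (Cw, x)).
have q1 : qd T f (fun=> 0).
  by apply: eq_qd q => s sT /=; rewrite /vd /dens /at_; field.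
have := qd_const q1 tT; rewrite /f u0 => H.
have := g_constraint gv0 x; rewrite /constraint => e.
move: H; rewrite (_ : v0 (Cp, x) * v0 (Cn, x) + _ + _ = r x ^+ 2).
  by move=> H; rewrite -H; ring.
by rewrite e; ring.
Qed.

(** The field gives [g' = w - 2 Q U p + (3 U ^ 2 - 2 P) w], up to the cut-off factor. From
    [p n >= 0] and [w ^ 2 <= p n] one gets [|p| <= |g|] and [|w| <= |g|] with no sign assumption on
    [p] or [n], so the lemma can be used to establish the signs. *)
Lemma growth (K : R) x : 0 <= K ->
  (forall t, 0 <= t <= T -> `|2 * vQ (u t) x * u t (CU, x)| <= K /\
     `|3 * u t (CU, x) ^+ 2 - 2 * vP (u t) x| <= K) ->
  let g t := u t (Cp, x) + u t (Cn, x) in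
  (forall t, 0 <= t <= T -> g 0 <= g t * expR ((1 + 2 * K) * t)) /\
  (forall t, 0 <= t <= T -> `|g t| <= `|g 0| * expR ((1 + 2 * K) * t)).
Proof.
move=> K0 HK g.
have qg : qd T g (fun t => chit t * field (u t) (Cp, x) + chit t * field (u t) (Cn, x)).
  exact: qdD (u_qd (Cp, x)) (u_qd (Cn, x)).
have L0 : 0 <= 1 + 2 * K by rewrite addr_ge0// mulr_ge0.
have HL t : 0 <= t <= T ->
    `|chit t * field (u t) (Cp, x) + chit t * field (u t) (Cn, x)| <=
    (1 + 2 * K) * `|g t|.
  move=> tT; rewrite -mulrDr normrM.
  have /andP[c0' c1'] := chi_itv (M + 1 - vN (u t)).
  rewrite (ger0_norm c0'); apply: (le_trans (ler_piMl (normr_ge0 _) c1')).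
  have [k1 k2] := HK t tT; rewrite /=.
  have := flow_constraint x tT; rewrite /constraint /g.
  set p := u t (Cp, x); set n := u t (Cn, x); set w := u t (Cw, x).
  set U := u t (CU, x) in k1 k2 *; set Q := vQ _ _ in k1 *; set P := vP _ _ in k2 *.
  move=> e.
  have pn : 0 <= p * n.
    rewrite e.
    exact: addr_ge0 (addr_ge0 (mulr_ge0 (sqr_ge0 _) (sqr_ge0 _)) (sqr_ge0 _)) (sqr_ge0 _).
  have [hp hw] : `|p| <= `|p + n| /\ `|w| <= `|p + n|.
    have hp2 : p ^+ 2 <= (p + n) ^+ 2 by have := sqr_ge0 n; nra.
    have hw2 : w ^+ 2 <= (p + n) ^+ 2.
      have := mulr_ge0 (sqr_ge0 p) (sqr_ge0 U).
      have := sqr_ge0 (r x); have := sqr_ge0 p; have := sqr_ge0 n; nra.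
    by split; rewrite -ler_sqr ?nnegrE// !real_normK ?num_real.
  have -> : w + (- 2 * Q * U * p + (3 * U ^+ 2 - 2 * P) * w) =
    w - (2 * Q * U) * p + (3 * U ^+ 2 - 2 * P) * w by ring.
  apply: (le_trans (ler_normD _ _)).
  have h1 : `|2 * Q * U * p| <= K * `|p + n| by rewrite normrM ler_pM.
  have h2 : `|(3 * U ^+ 2 - 2 * P) * w| <= K * `|p + n| by rewrite normrM ler_pM.
  apply: (le_trans (lerD (le_trans (ler_normB _ _) (lerD hw h1)) h2)).
  by rewrite le_eqVlt; apply/orP; left; apply/eqP; ring.
have g0 : 0 < g 0.
  by rewrite /g u0; apply: lt_le_trans (g_pn gv0 x); exact: g_c gv0.
split => t tT; first exact: qd_pos L0 qg HL g0 t tT.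
exact: qd_growth L0 qg HL t tT.
Qed.

End Flow.
End Invariants.

(** * Conservation of energy and removal of the cut-off *)

Section SmoothFlow.
Variable R : realType.
Local Notation mu := (@lebesgue_measure R).
Implicit Types (v w : comp * R -> R) (x M T c : R) (r : R -> R).

Lemma itg_sup (f : R -> R) (C : R) : integ 0 1 f -> (forall x, `|f x| <= C) ->
  `|itg 0 1 f| <= C.
Proof.
move=> fi fC; have := itg_cst C (@ler01 R); rewrite subr0 mulr1 => <-.
by apply: itg_norm_le => //; exact: integ_cst.
Qed.

Lemma adm_integ v (k : comp) : adm v -> ncy k -> integ 0 1 (at_ v k).
Proof. by move=> av nc; have [] := integ_bounded av nc (fun x => vN_ub x av nc). Qed.

Lemma vP_per v x : vP v (x + 1) = vP v x. Proof. by rewrite /vP fracD1. Qed.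

(* d/dx (U ^ 3 - 2 P U) is the nu-component of the vector field. *)
Lemma energy_field v : adm v -> integ 0 1 (fun x => field v (Cn, x)) /\
  itg 0 1 (fun x => field v (Cn, x)) = 0.
Proof.
move=> av; have pU := a_U av; have [pP _] := prim_vP_vQ av.
have p1 := primM ler01 (primM ler01 pU pU) pU.
have p2 := primB p1 (primZ 2 (primM ler01 pP pU)).
have q : prim 0 1 (fun x => at_ v CU x * at_ v CU x * at_ v CU x - 2 * (vP v x * at_ v CU x))
    (fun x => field v (Cn, x)).
  by apply: eq_prim p2 => x _ //; rewrite /= /at_; ring.
split; first exact: q.1.
rewrite -(prim_diff q)//.
have -> : at_ v CU 1 = at_ v CU 0 by rewrite /at_ -[in LHS](add0r 1) (a_per av).
by rewrite -[in vP v 1](add0r 1) vP_per subrr.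
Qed.

Lemma sum_pos (a b : R) : 0 <= a * b -> 0 < a + b -> 0 <= a /\ 0 <= b.
Proof. by move=> h1 h2; split; rewrite leNgt; apply/negP => h; nra. Qed.

Lemma smooth_flow T v0 r c0 : 0 <= T -> good v0 r c0 ->
  exists (u : R -> comp * R -> R) (C1 C2 c : R),
  [/\ u 0 = v0,
      forall t : R, 0 <= t <= T -> good (u t) r c /\ energy (u t) = energy v0,
      forall (t s : R) i, 0 <= t <= T -> 0 <= s <= T -> `|u s i - u t i| <= C1 * `|s - t|
    & forall (t s : R) i, 0 <= t <= T -> 0 <= s <= T ->
        `|u s i - u t i - (s - t) * field (u t) i| <= C2 * (s - t) ^+ 2].
Proof.
move=> T0 gv; have a0 := g_adm gv; set H := energy v0.
have [H0 _] := good_bounds gv; rewrite -/H in H0.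
pose B := 1 + H; have B0 : 0 <= B by rewrite addr_ge0.
have cBB := cB_ge0 B0.
pose K1 := 2 * cB B * B; pose K2 := 3 * B ^+ 2 + 2 * cB B.
have K10 : 0 <= K1 by exact: mulr_ge0 (mulr_ge0 (ler0n R 2) cBB) B0.
have K20 : 0 <= K2.
  exact: addr_ge0 (mulr_ge0 (ler0n R 3) (sqr_ge0 B)) (mulr_ge0 (ler0n R 2) cBB).
pose L := 1 + 2 * (K1 + K2).
have v00 := vN_ge0 a0.
(* [B] is going to bound [U] and the other term [p + n]. Since [B] and [L] depend on the initial
   energy alone, the level can be fixed before the cut-off flow exists. *)
pose M := B + 2 * vN v0 * expR (L * T).
have L0 : 0 <= L by exact: addr_ge0 ler01 (mulr_ge0 (ler0n R 2) (addr_ge0 K10 K20)).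
have M0 : 0 <= M.
  exact: addr_ge0 B0 (mulr_ge0 (mulr_ge0 (ler0n R 2) v00) (expR_ge0 _)).
have [u [C1 [C2 [u0 u_adm u_lip u_quad]]]] := cutoff_flow M0 T0 a0.
have z0 : 0 <= (0 : R) <= T by rewrite lexx T0.
have cons := flow_constraint T0 gv u0 u_lip u_quad.
have grw := growth T0 gv u0 u_lip u_quad.
have n1 := normr_ge0 C1.
(* A crude bound that depends on the cut-off through the Lipschitz constant [C1]. It suffices for
   positivity and for the conservation of energy; afterwards the rates can be taken from the
   energy. *)
pose M' := vN v0 + `|C1| * T.
have M'0 : 0 <= M' by exact: addr_ge0 v00 (mulr_ge0 n1 T0).
have uM' t : 0 <= t <= T -> vN (u t) <= M'.
  move=> tT; have /andP[t0 tT'] := tT.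
  have := vN_lip (u_adm t tT) a0 (d := `|C1| * T).
  rewrite ler_norml => /(_ _)/andP[|_]; last by rewrite /M'; lra.
  move=> i; rewrite -u0; apply: (le_trans (u_lip 0 t i z0 tT)).
  rewrite subr0 (ger0_norm t0).
  exact: le_trans (ler_wpM2r t0 (ler_norm C1)) (ler_wpM2l n1 tT').
have cBM' := cB_ge0 M'0.
pose K1' := 2 * cB M' * M'; pose K2' := 3 * M' ^+ 2 + 2 * cB M'.
have K10' : 0 <= K1' by exact: mulr_ge0 (mulr_ge0 (ler0n R 2) cBM') M'0.
have K20' : 0 <= K2'.
  exact: addr_ge0 (mulr_ge0 (ler0n R 3) (sqr_ge0 M')) (mulr_ge0 (ler0n R 2) cBM').
pose L' := 1 + 2 * (K1' + K2').
have L'0 : 0 <= L' by exact: addr_ge0 ler01 (mulr_ge0 (ler0n R 2) (addr_ge0 K10' K20')).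
pose c := c0 * expR (- (L' * T)).
have c00 := g_c gv; have cgt0 : 0 < c by rewrite mulr_gt0 ?expR_gt0.
have low t x : 0 <= t <= T -> c <= u t (Cp, x) + u t (Cn, x).
  move=> tT; have /andP[t0 tT'] := tT.
  have [|G _] := grw (K1' + K2') x (addr_ge0 K10' K20').
    move=> s sT; have [k1 k2] := coef_bnd x (u_adm s sT) (uM' s sT).
    rewrite -/K1' -/K2' in k1 k2; split.
      by apply: (@le_trans _ _ K1'); [move: k1; rewrite !mulNr normrN|rewrite lerDl].
    by apply: (le_trans k2); rewrite lerDr.
  have := G t tT; rewrite u0 -/L' => h.
  have h2 := le_trans (g_pn gv x) h.
  rewrite /c -ler_pdivlMr ?expR_gt0// -expRN opprK.
  have [g0|g0] := leP 0 (u t (Cp, x) + u t (Cn, x)); last first.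
    by have := le_trans h2 (ltW (_ : _ < 0)); rewrite leNgt c00 nmulr_rlt0 ?expR_gt0// => /(_ isT).
  by apply: (le_trans h2); rewrite ler_wpM2l// ler_expR ler_wpM2l.
have gut t : 0 <= t <= T -> good (u t) r c.
  move=> tT.
  have sg x : 0 <= u t (Cp, x) /\ 0 <= u t (Cn, x).
    apply: sum_pos (lt_le_trans cgt0 (low t x tT)).
    rewrite (cons t x tT).
    exact: addr_ge0 (addr_ge0 (mulr_ge0 (sqr_ge0 _) (sqr_ge0 _)) (sqr_ge0 _)) (sqr_ge0 _).
  split => //; [exact: u_adm|by move=> x; have [] := sg x|by move=> x; have [] := sg x| |].
    by move=> x; exact: low.
  by move=> x; exact: cons.
have enE t : 0 <= t <= T -> energy (u t) = H.
  have qe : qd T (fun t => energy (u t)) (fun=> 0).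
    exists (M' + `|C1| + `|C2|) => t' s tT sT.
    have it := adm_integ (u_adm t' tT) (isT : ncy Cn).
    have is_ := adm_integ (u_adm s sT) (isT : ncy Cn).
    have [if_ f0] := energy_field (u_adm t' tT).
    have h0 := normr_ge0 (s - t'); have h1 := sqr_ge0 (s - t'); have n2 := normr_ge0 C2.
    split.
    - apply: (@le_trans _ _ M'); last by lra.
      apply: itg_sup it _ => x.
      exact: le_trans (vN_ub x (u_adm t' tT) (isT : ncy Cn)) (uM' t' tT).
    - apply: (@le_trans _ _ (C1 * `|s - t'|)).
        by rewrite -itgB//; apply: itg_sup (integB is_ it) _ => x; exact: u_lip.
      by rewrite ler_wpM2r//; have := ler_norm C1; lra.
    - rewrite mulr0 subr0; apply: (@le_trans _ _ (C2 * (s - t') ^+ 2)); last first.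
        by rewrite ler_wpM2r//; have := ler_norm C2; lra.
      (* The term subtracted under the integral has integral 0 by [energy_field], even with the
         cut-off factor, so only the quadratic remainder is left. *)
      pose k := (s - t') * chi (M + 1 - vN (u t')).
      have -> : energy (u s) - energy (u t') =
          itg 0 1 (fun x => u s (Cn, x) - u t' (Cn, x) - k * field (u t') (Cn, x)).
        have ik := integZ k if_; have id := integB is_ it.
        by rewrite (itgB id ik) (itgB is_ it) itgZ// f0 mulr0 subr0.
      apply: itg_sup; first exact: integB (integB is_ it) (integZ k if_).
      by move=> x; rewrite /k -mulrA; exact: u_quad.
  by move=> tT; rewrite (qd_const qe tT) u0.
(* The second pass, with the rate [L] coming from the conserved energy: [|U| <= B], [p] and [n] are
   at most [E], and [|w| <= E / 2]. So [M] is never exceeded and the cut-off factor is 1 along the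
   flow. *)
have uM t : 0 <= t <= T -> vN (u t) <= M.
  move=> tT; have /andP[t0 tT'] := tT; apply: vN_le => d x nd.
  have [_ b] := good_bounds (gut t tT); rewrite (enE t tT) -/B in b.
  pose E := 2 * vN v0 * expR (L * T).
  have E0 : 0 <= E := mulr_ge0 (mulr_ge0 (ler0n R 2) v00) (expR_ge0 _).
  have [|_ G] := grw (K1 + K2) x (addr_ge0 K10 K20).
    move=> s sT; have := good_coef x (gut s sT).
    rewrite (enE s sT) -/B -/K1 -/K2 => -[k1 k2].
    by split; [apply: (le_trans k1); rewrite lerDl|apply: (le_trans k2); rewrite lerDr].
  have gE : u t (Cp, x) + u t (Cn, x) <= E.
    apply: (le_trans (ler_norm _)); apply: (le_trans (G t tT)).
    rewrite u0 -/L; apply: ler_pM => //; [ |by rewrite ler_expR ler_wpM2l].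
    have := ler_normD (v0 (Cp, x)) (v0 (Cn, x)).
    have := vN_ub x a0 (isT : ncy Cp); have := vN_ub x a0 (isT : ncy Cn).
    by move: (vN v0) => V; lra.
  have p0 := g_p (gut t tT) x; have n0 := g_n (gut t tT) x.
  have [kw _ _] := constraint_bounds p0 n0 (cons t x tT).
  have UB : `|u t (CU, x)| <= B.
    by rewrite (adm_frac x (u_adm t tT) (isT : ncy CU)); exact: (b_UM b (frac01 x)).
  rewrite /M -/E; clearbody B E; clear -B0 E0 gE p0 n0 kw UB nd.
  by case: d nd => //= _; rewrite ?(ger0_norm p0) ?(ger0_norm n0); lra.
exists u, C1, C2, c; split => //; first by move=> t tT; split; [exact: gut|exact: enE].
move=> t s i tT sT; have := u_quad t s i tT sT.
by rewrite /fieldM chi_ge1 ?mul1r//; have := uM t tT; lra.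
Qed.

End SmoothFlow.

(** * Solutions in E *)

Section Representatives.
Variable R : realType.
Local Notation mu := (@lebesgue_measure R).
Implicit Types (f g : R -> R) (X : state R) (D : R).

Lemma measurable_indic_if (A : set R) (d : R) f : measurable A ->
  measurable_fun [set: R] f ->
  measurable_fun [set: R] (fun x => if x \in A then d else f x).
Proof.
move=> mA mf; apply: measurable_fun_ifT => //; apply: (measurable_fun_bool true).
rewrite setTI (_ : _ @^-1` _ = A)//.
by apply/seteqP; split => x /=; [move/set_mem|move/mem_set].
Qed.

Lemma integ_le_bnd f D : measurable_fun [set: R] f -> (forall x, `|f x| <= D) ->
  forall a b, integ a b f.
Proof. by move=> mf H a b; apply: (integ_bnd (M := D)) => //; exact: mfun_itv. Qed.

Lemma LnormIoo_finP f a b : (LnormI +oo%E a b f < +oo)%E ->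
  exists D, {ae mu, forall x, a <= x <= b -> `|f x| <= D}.
Proof.
move=> ff; exists (fine (LnormI +oo%E a b f)); apply/LnormIoo_leP.
  by rewrite fine_ge0// LnormIoo_ge0.
by rewrite fineK// ge0_fin_numE ?LnormIoo_ge0.
Qed.

Lemma Lnormoo_leP f D : 0 <= D ->
  ('N[mu]_+oo [EFin \o f] <= D%:E)%E <-> {ae mu, forall x, `|f x| <= D}.
Proof.
move=> D0; rewrite unlock mu_setT_gt0; split.
  by move=> /ess_supP H; apply: (ae_imp H) => x /=; rewrite lee_fin.
by move=> H; apply/ess_supP; apply: (ae_imp H) => x /=; rewrite lee_fin.
Qed.

Lemma LinftyP f : Linfty f <->
  measurable_fun [set: R] f /\ exists D, {ae mu, forall x, `|f x| <= D}.
Proof.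
split=> -[mf ff]; split => //.
  have f0 : (0 <= 'N[mu]_+oo [EFin \o f])%E by exact: Lnorm_ge0.
  exists (fine 'N[mu]_+oo [EFin \o f]); apply/Lnormoo_leP; first exact: fine_ge0.
  by rewrite fineK// ge0_fin_numE.
case: ff => D HD; apply: (@le_lt_trans _ _ `|D|%:E); last exact: ltry.
by apply/(Lnormoo_leP _ (normr_ge0 D)); apply: (ae_imp HD) => x h; exact: le_trans h (ler_norm D).
Qed.

Lemma ae_bnd_integ f D a b : measurable_fun [set: R] f ->
  {ae mu, forall x, a <= x <= b -> `|f x| <= D} -> integ a b f.
Proof.
move=> mf fD; have D0 := normr_ge0 D.
have mh : measurable_fun [set: R] (fun x => Num.max (- `|D|) (Num.min `|D| (f x))).
  by apply: measurable_maxr => //; exact: measurable_minr.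
apply: (integ_ae (mfun_itv mf) (integ_le_bnd (D := `|D|) mh _ a b)) => [x|].
  rewrite ler_norml le_max lexx/= ge_max ge_min lexx/= andbT.
  by apply: le_trans D0; rewrite oppr_le0.
apply: (ae_imp fD) => x H /H; rewrite ler_norml => /andP[h1 h2].
have h3 := ler_norm D.
by rewrite (min_idPr (le_trans h2 h3))// (max_idPr _)//; lra.
Qed.

Lemma W1oo_bnd f g : gprim f g -> W1ploc +oo%E f ->
  exists D, {ae mu, forall x, 0 <= x <= 1 -> `|g x| <= D}.
Proof.
move=> fg [_ [h [mh hb] wh]].
have h1 : Lploc 1%E h.
  apply/Lploc1P; split => // a b.
  by have [D HD] := LnormIoo_finP (hb a b); exact: ae_bnd_integ mh HD.
have gh := gprim_unique fg (weak_gprim (gprim_cont fg) h1 wh).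
have [D HD] := LnormIoo_finP (hb 0 1); exists D.
by apply: (ae_imp2 gh HD) => x ->.
Qed.

Lemma gprim_W1oo f g D : gprim f g -> (forall x, `|g x| <= D) -> W1ploc +oo%E f.
Proof.
move=> fg gD; have cf := gprim_cont fg; split.
  split; first exact: continuous_measurable_fun.
  move=> a b; have [ab|ba] := leP a b.
    have [M HM] := within_cont_bnd ab (continuous_subspaceT cf).
    apply: (@le_lt_trans _ _ `|M|%:E); last exact: ltry.
    apply/(LnormIoo_leP _ _ _ (normr_ge0 M)); apply: aeW => x h.
    exact: le_trans (HM x h) (ler_norm M).
  apply: (@le_lt_trans _ _ 0%E); last exact: ltry.
  apply/(LnormIoo_leP _ _ _ (lexx 0)); apply: aeW => x /andP[h1 h2].
  by move: ba; rewrite ltNge (le_trans h1 h2).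
exists g; last exact: gprim_weak.
split; first exact: fg.1.
move=> a b; apply: (@le_lt_trans _ _ `|D|%:E); last exact: ltry.
apply/(LnormIoo_leP _ _ _ (normr_ge0 D)); apply: aeW => x _.
exact: le_trans (gD x) (ler_norm D).
Qed.

Lemma L1per_ae_eq f g : L1per f -> L1per g ->
  {ae mu, forall x, 0 <= x <= 1 -> f x = g x} -> {ae mu, forall x, f x = g x}.
Proof.
move=> Lf Lg fg.
have Lfg : L1per (fun x => f x + -1 * g x) by exact: L1perD Lf (L1perZ (-1) Lg).
have fi := L1per_integ 0 1 Lfg.
have := L1per_eq0 Lfg; rewrite (itg_ae (g := fun=> 0)).
- rewrite itg_cst// mul0r => /(_ (lexx 0)) H.
  by apply: (ae_imp H) => x; rewrite mulN1r => /eqP; rewrite subr_eq0 => /eqP.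
- exact: integ_norm.
- exact: integ_cst.
- by apply: (ae_imp fg) => x h /h ->; rewrite mulN1r subrr normr0.
Qed.

(** Correction on a null set: integrals, and with them the states in E, do not change, while the
    conditions of F become true at every point, as the pointwise flow requires. *)
Lemma calF_good X : calF X -> exists (v : comp * R -> R) r c,
  [/\ good v r c, at_ v Cy = sy X, at_ v CU = sU X,
      {ae mu, forall x, at_ v Cn x = snu X x} & {ae mu, forall x, r x = sr X x}].
Proof.
move=> [EX [Wy WU] [/LinftyP[mn [Dn HDn]] /LinftyP[mr [Dr HDr]]] [p0 n0 [c c0 pnc]] con].
have py := E_py EX; have pU := E_pU EX.
have [Dp HDp] := W1oo_bnd py Wy; have [Dw HDw] := W1oo_bnd pU WU.
pose p := wderiv (sy X); pose w := wderiv (sU X); pose n := snu X; pose r := sr X.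
pose G x := [/\ p x * n x = p x ^+ 2 * sU X x ^+ 2 + w x ^+ 2 + r x ^+ 2,
  0 <= p x, 0 <= n x, c <= p x + n x &
  0 <= x <= 1 -> [/\ `|p x| <= Dp, `|w x| <= Dw, `|n x| <= Dn & `|r x| <= Dr]].
have [A [mA A0 HA]] : {ae mu, forall x, G x}.
  have H1 := ae_imp2 (Q := fun x => 0 <= p x /\ 0 <= n x) p0 n0 (fun x a b => conj a b).
  have H2 := ae_imp2 (Q := fun x => `|n x| <= Dn /\ `|r x| <= Dr) HDn HDr
    (fun x a b => conj a b).
  have H3 := ae_imp2 (Q := fun x => 0 <= x <= 1 -> `|p x| <= Dp /\ `|w x| <= Dw) HDp HDw
    (fun x a b h => conj (a h) (b h)).
  have H4 := ae_imp2 H2 H3 (Q := fun x => 0 <= x <= 1 ->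
    [/\ `|p x| <= Dp, `|w x| <= Dw, `|n x| <= Dn & `|r x| <= Dr]).
  have {}H4 := H4 (fun x '(conj a b) h x01 => let: conj c' d := h x01 in And4 c' d a b).
  have H5 := ae_imp2 (Q := fun x => _ /\ _) con pnc (fun x a b => conj a b).
  have H6 := ae_imp2 (Q := fun x => _ /\ _) H1 H4 (fun x a b => conj a b).
  by apply: (ae_imp2 H5 H6) => x [a b] [[e f] g].
have GA x : x \notin A -> G x.
  move=> xA; apply/not_notP => nG; move/negP: xA; apply; apply/mem_set; exact: HA.
(* On the exceptional set [A] the values are [p = w = r = 0] and [n = 1]: they satisfy the quadratic
   relation for every value of [U], and they keep [p + n] equal to 1, hence the constant
   [Num.min c 1] below. Composing with [frac] restores exact periodicity. *)
pose q (d : R) (f : R -> R) x : R := if x \in A then d else f x.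
pose e (d : R) (f : R -> R) x : R := q d f (frac x).
have me d f : measurable_fun [set: R] f -> measurable_fun [set: R] (e d f).
  by move=> mf; apply: measurable_ext; apply: mfun_itv; exact: measurable_indic_if.
have ee d f : {ae mu, forall x, 0 <= x <= 1 -> f x = e d f x}.
  have HA' : {ae mu, forall x, x \notin A}.
    by exists A; split => // x /= /negP; rewrite negbK => /set_mem.
  apply: (ae_imp2 HA' (ae_neq 1)) => x xA x1 /andP[h0 h1].
  have x01 : 0 <= x < 1 by rewrite h0 lt_neqAle h1 andbT.
  by rewrite /e frac_id// /q (negbTE xA).
have per d f x : e d f (x + 1) = e d f x by rewrite /e fracD1.
pose v (i : comp * R) := match i.1 with
  | Cy => sy X i.2 | CU => sU X i.2 | Cp => e 0 p i.2 | Cw => e 0 w i.2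
  | Cn => e 1 n i.2 end.
pose r' := e 0 r.
have Uper x : sU X x = sU X (frac x) by apply: periodic_frac x => x; exact: E_Uper.
have bnd d f D : (forall x : R, 0 <= x <= 1 -> x \notin A -> `|f x| <= D) ->
    forall x : R, `|e d f x| <= Num.max `|d| D.
  move=> H x; rewrite /e /q le_max; case: ifPn => xA; first by rewrite lexx.
  by rewrite H ?orbT// frac01.
have [B HB] := within_cont_bnd ler01 (continuous_subspaceT (gprim_cont pU)).
have bp : forall x : R, `|e 0 p x| <= Num.max `|0 : R| Dp.
  by apply: (bnd 0 p Dp) => x x01 /GA[_ _ _ _ /(_ x01)[]].
have bw : forall x : R, `|e 0 w x| <= Num.max `|0 : R| Dw.
  by apply: (bnd 0 w Dw) => x x01 /GA[_ _ _ _ /(_ x01)[]].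
have bn : forall x : R, `|e 1 n x| <= Num.max `|1 : R| Dn.
  by apply: (bnd 1 n Dn) => x x01 /GA[_ _ _ _ /(_ x01)[]].
have br : forall x : R, `|e 0 r x| <= Num.max `|0 : R| Dr.
  by apply: (bnd 0 r Dr) => x x01 /GA[_ _ _ _ /(_ x01)[]].
have [ppy ppU] := E_prims EX.
have av : adm v.
  split.
  - by move=> x; exact: E_yper.
  - by case=> //= x _; rewrite /v/= ?per//; exact: E_Uper.
  - exists (Num.max B (Num.max (Num.max `|0 : R| Dp)
      (Num.max (Num.max `|0 : R| Dw) (Num.max `|1 : R| Dn)))).
    case=> //= x _; rewrite /v/= le_max.
    + by rewrite Uper HB ?frac01.
    + by rewrite [X in _ || X]le_max bp !orbT.
    + by rewrite [X in _ || X]le_max [X in _ || (_ || X)]le_max bw !orbT.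
    + by rewrite [X in _ || X]le_max [X in _ || (_ || X)]le_max bn !orbT.
  - case=> //= _; [exact: continuous_measurable_fun (gprim_cont pU)|..]; apply: me => //.
    + exact: py.1.
    + exact: pU.1.
  - by apply: prim_ae (ee 0 p) ppy; apply: mfun_itv; apply: me; exact: py.1.
  - by apply: prim_ae (ee 0 w) ppU; apply: mfun_itv; apply: me; exact: pU.1.
have eper d f D : measurable_fun [set: R] f -> (forall x, `|e d f x| <= D) -> L1per (e d f).
  move=> mf H; apply: L1perP; [exact: me|exact: integ_le_bnd (me _ _ mf) H|].
  by apply: aeW => x; exact: per.
exists v, r', (Num.min c 1); split => //; last first.
- apply: L1per_ae_eq (eper _ _ _ mr br) (E_r EX) _.
  by apply: (ae_imp (ee 0 r)) => x h x01; exact/esym/h.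
- apply: L1per_ae_eq (eper _ _ _ mn bn) (E_n EX) _.
  by apply: (ae_imp (ee 1 n)) => x h x01; exact/esym/h.
have cases x : [/\ v (Cp, x) = 0, v (Cn, x) = 1, v (Cw, x) = 0 & r' x = 0] \/
  exists t, G t /\ [/\ v (Cp, x) = p t, v (Cn, x) = n t, v (Cw, x) = w t, r' x = r t
     & v (CU, x) = sU X t].
  rewrite /v/= /r' /e /q; case: ifPn => xA; first by left.
  by right; exists (frac x); split; [exact: GA|split].
split => //.
- by rewrite lt_min c0 ltr01.
- move=> x; case: (cases x) => [[-> _ _ _]//|[t [[_ + _ _ _] [-> _ _ _ _]]]]; exact.
- move=> x; case: (cases x) => [[_ -> _ _]//|[t [[_ _ + _ _] [_ -> _ _ _]]]]; exact.
- move=> x; rewrite ge_min; case: (cases x) => [[-> -> _ _]|[t [[_ _ _ + _] [-> -> _ _ _]]]].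
    by rewrite add0r lexx orbT.
  by move=> ->.
- move=> x; rewrite /constraint.
  case: (cases x) => [[-> -> -> ->]|[t [[+ _ _ _ _] [-> -> -> -> ->]]]]; last exact.
  by rewrite expr0n/= !mul0r !addr0.
Qed.

End Representatives.

(** * From pointwise representatives to states in E *)

Section GoodStates.
Variable R : realType.
Local Notation mu := (@lebesgue_measure R).
Local Notation quad := ((R -> R) * (R -> R) * (R -> R) * (R -> R))%type.
Implicit Types (v : comp * R -> R) (s r : R -> R) (c : R).

(** Here [s] is the fourth component of the original data, whereas [good] is stated for its
    corrected representative [r]; the two agree almost everywhere. *)
Definition state_of v s : state R := State (at_ v Cy) (at_ v CU) (at_ v Cn) s.

Section OneState.
Variables (v : comp * R -> R) (s : R -> R).
Hypotheses (av : adm v) (Ls : L1per s).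
Let X := state_of v s.

Lemma adm_bnd (k : comp) : ncy k -> forall x, `|at_ v k x| <= vN v.
Proof. by move=> nk x; exact: vN_ub. Qed.

Lemma adm_gprim_y : gprim (at_ v Cy) (at_ v Cp).
Proof.
apply: (periodic_gprim (k := 1)) (a_y av); first exact: (a_m av (isT : ncy Cp)).
  by move=> x; exact: a_yper.
by apply: aeW => x; exact: (a_per av x (isT : ncy Cp)).
Qed.

Lemma adm_gprim_U : gprim (at_ v CU) (at_ v Cw).
Proof.
apply: (periodic_gprim (k := 0)) (a_U av); first exact: (a_m av (isT : ncy Cw)).
  by move=> x; rewrite addr0; exact: (a_per av x (isT : ncy CU)).
by apply: aeW => x; exact: (a_per av x (isT : ncy Cw)).
Qed.

Lemma adm_L1per (k : comp) : ncy k -> L1per (at_ v k).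
Proof.
move=> nk; apply: L1perP (a_m av nk) _ _.
  exact: integ_le_bnd (a_m av nk) (adm_bnd nk).
by apply: aeW => x; exact: (a_per av x nk).
Qed.

Lemma in_E_state_of : in_E X.
Proof.
split => //=; last exact: adm_L1per (isT : ncy Cn).
  apply/W11perP; split; first by eexists; exact: gprimB adm_gprim_y (gprim_id R).
  by move=> x /=; rewrite /at_ (a_yper av); ring.
apply/W11perP; split; first by eexists; exact: adm_gprim_U.
by move=> x; exact: (a_per av x (isT : ncy CU)).
Qed.

Lemma state_of_p : {ae mu, forall x, wderiv (sy X) x = at_ v Cp x}.
Proof. exact: (wderiv_gprim adm_gprim_y).2. Qed.

Lemma state_of_w : {ae mu, forall x, wderiv (sU X) x = at_ v Cw x}.
Proof. exact: (wderiv_gprim adm_gprim_U).2. Qed.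

Lemma state_of_PQ x : P X x = vP v x /\ Q X x = vQ v x.
Proof.
have EX := in_E_state_of.
rewrite (PE EX) (QE EX); apply: eq_kPQ => //.
- exact: adm_cy.
- exact: E_id.
- exact: adm_id.
- by apply: (ae_imp state_of_p) => t e _; rewrite /vd /dens e.
- exact: frac01.
Qed.

(** The right-hand side with [Cp] and [Cw] in place of the chosen weak derivatives. It is equal to
    [rhs] in E by [eqB_rhs], but is explicit at every point. *)
Definition field_quad v : quad :=
  (at_ v CU, fun x => - vQ v x, fun x => field v (Cn, x), fun=> 0).

Lemma eqB_rhs : eqB (rhs X) (field_quad v).
Proof.
split => //; last exact: aeW.
  by apply/funext => x; rewrite (state_of_PQ x).2.
apply: (ae_imp2 state_of_p state_of_w) => x ep ew.
by rewrite ep ew (state_of_PQ x).1 (state_of_PQ x).2.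
Qed.

Lemma in_B_field_quad : in_B (field_quad v).
Proof.
have [pP pQ] := prim_vP_vQ av.
split.
- apply/W11perP; split; first by eexists; exact: adm_gprim_U.
  by move=> x; exact: (a_per av x (isT : ncy CU)).
- have gQ : gprim (vQ v) (fun x => vP v x * at_ v Cp x - 2^-1 * vd v x).
    apply: (periodic_gprim (k := 0)) pQ.
    + apply: measurable_funB; last apply: measurable_funM => //.
        by apply: measurable_funM; [exact: measurable_vP|exact: (a_m av (isT : ncy Cp))].
      apply: measurable_funD; last exact: (a_m av (isT : ncy Cn)).
      apply: measurable_funM; last exact: (a_m av (isT : ncy Cp)).
      by apply: measurable_funX; exact: (a_m av (isT : ncy CU)).
    + by move=> x; rewrite addr0 /vQ fracD1.
    + apply: aeW => x; rewrite vP_per /vd /dens /at_.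
      by rewrite !(a_per av x (isT : ncy Cp)) (a_per av x (isT : ncy CU))
        (a_per av x (isT : ncy Cn)).
  apply/W11perP; split; first by eexists; exact: gprimN gQ.
  by move=> x /=; rewrite /vQ fracD1.
- have bd x : `|field v (Cn, x)| <= cF (vN v) by exact: field_bnd.
  have mU := a_m av (isT : ncy CU); have mp := a_m av (isT : ncy Cp).
  have mw := a_m av (isT : ncy Cw).
  have mP := measurable_vP av; have mQ := measurable_vQ av.
  have mf : measurable_fun [set: R] (fun x => field v (Cn, x)).
    apply: measurable_funD; apply: measurable_funM => //.
      by apply: measurable_funM => //; apply: measurable_funM.
    apply: measurable_funB; apply: measurable_funM => //.
    by apply: measurable_funX.
  apply: L1perP mf (integ_le_bnd mf bd) _.
  apply: aeW => x; rewrite /= vP_per /vQ fracD1.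
  by rewrite !(a_per av x (isT : ncy Cp), a_per av x (isT : ncy CU),
    a_per av x (isT : ncy Cw)).
- apply: (L1perP (measurable_cst (0 : R))); last exact: aeW.
  by move=> a b; exact: (integ_cst a b (0 : R)).
Qed.

End OneState.

Lemma calF_state_of v s r c : good v r c -> L1per s -> Linfty s ->
  {ae mu, forall x, r x = s x} -> calF (state_of v s).
Proof.
move=> g Ls Bs rs; have av := g_adm g.
have ep := state_of_p s av; have ew := state_of_w s av.
split.
- exact: in_E_state_of.
- split; first exact: gprim_W1oo (adm_gprim_y av) (adm_bnd av (isT : ncy Cp)).
  exact: gprim_W1oo (adm_gprim_U av) (adm_bnd av (isT : ncy Cw)).
- split => //; apply/LinftyP; split; first exact: (a_m av (isT : ncy Cn)).
  by exists (vN v); apply: aeW; exact: (adm_bnd av (isT : ncy Cn)).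
- split.
  + by apply: (ae_imp ep) => x ->; exact: g_p g x.
  + by apply: aeW => x; exact: g_n g x.
  + exists c; first exact: g_c g.
    by apply: (ae_imp ep) => x ->; exact: g_pn g x.
- have H := ae_imp2 (Q := fun x => _ /\ _) ep ew (fun x a b => conj a b).
  apply: (ae_imp2 H rs) => x [-> ->] e.
  by have := g_constraint g x; rewrite /constraint e.
Qed.

Lemma state_of_bounded v s r c : good v r c -> L1per s ->
  E_bounded (1 + energy v) (state_of v s).
Proof.
move=> g Ls; have av := g_adm g; have [_ b] := good_bounds g.
have EX := in_E_state_of av Ls; have [py pU] := E_prims EX.
apply: Bounded01 py pU _ (b_UM b) _ _ (b_nM b); first exact: b_n b.
- rewrite (itg_ae_norm (gprim_integ 0 1 (E_py EX)) _ (state_of_p s av)); first exact: b_pM b.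
  exact: gprim_integ (adm_gprim_y av).
- rewrite (itg_ae_norm (gprim_integ 0 1 (E_pU EX)) _ (state_of_w s av)); first exact: b_wM b.
  exact: gprim_integ (adm_gprim_U av).
Qed.

Lemma itg_abs_sup (f : R -> R) (C : R) : integ 0 1 f -> (forall x, `|f x| <= C) ->
  itg 0 1 (fun x => `|f x|) <= C.
Proof.
move=> fi fC; apply: le_trans (ler_norm _) _; apply: itg_sup; first exact: integ_norm.
by move=> x; rewrite normr_id.
Qed.

(** The uniform estimate controls the five varying pieces of the norm, namely the suprema of [y] and
    [U] and the L^1 norms of [p], [w] and [n], by [e] each; the [r] piece is 0. *)
Lemma nB_flow_step v w s (h e : R) : adm v -> adm w -> L1per s ->
  (forall i, `|w i - v i - h * field v i| <= e) ->
  nB (coordE (state_of w s) - coordE (state_of v s) - h *: rhs (state_of v s)) <= 5 * e.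
Proof.
move=> av aw Ls H.
have Ev := in_E_state_of av Ls; have Ew := in_E_state_of aw Ls.
have Bf := in_B_field_quad av; have Br := in_B_rhs Ev.
have e0 : 0 <= e := le_trans (normr_ge0 _) (H (CU, 0)).
pose z x := w (Cy, x) - x - (v (Cy, x) - x) - h * v (CU, x).
pose z' x := w (Cp, x) - 1 - (v (Cp, x) - 1) - h * v (Cw, x).
pose q x := w (CU, x) - v (CU, x) - h * - vQ v x.
pose q' x := w (Cw, x) - v (Cw, x) - h * - (vP v x * v (Cp, x) - 2^-1 * vd v x).
pose n x := w (Cn, x) - v (Cn, x) - h * field v (Cn, x).
pose r x := s x - s x - h * 0.
have -> : nB (coordE (state_of w s) - coordE (state_of v s) - h *: rhs (state_of v s)) =
    nB (z, q, n, r).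
  rewrite /nB; congr fine; apply: eqB_normB.
  - exact: in_BB (in_BB Ew Ev) (in_BZ h Br).
  - exact: (in_BB (in_BB Ew Ev) (in_BZ h Bf)).
  have [f1 f2 f3 f4] := eqB_rhs av Ls.
  split.
  - by [].
  - by apply/funext => x; have := congr1 (fun f => f x) f2 => /= E; rewrite /q -E.
  - by apply: (ae_imp f3) => x E; rewrite /n -[field v (Cn, x)]E.
  - exact: aeW.
have gz : gprim z z'.
  have id1 := gprim_id R.
  exact: gprimB (gprimB (gprimB (adm_gprim_y aw) id1) (gprimB (adm_gprim_y av) id1))
    (gprimZ h (adm_gprim_U av)).
have W11q : W11per q.
  by have [_ + _ _] : in_B (coordE (state_of w s) - coordE (state_of v s) - h *: field_quad v);
    [exact: (in_BB (in_BB Ew Ev) (in_BZ h Bf))|].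
have pq : prim 0 1 q q'.
  exact: primB (primB (a_U aw) (a_U av)) (primZ h (primN (prim_vP_vQ av).2)).
have gq : gprim q q'.
  have mP := measurable_vP av; have mp := a_m av (isT : ncy Cp).
  have md : measurable_fun [set: R] (vd v).
    apply: measurable_funD; last exact: (a_m av (isT : ncy Cn)).
    by apply: measurable_funM => //; apply: measurable_funX; exact: (a_m av (isT : ncy CU)).
  apply: (periodic_gprim (k := 0)) pq.
  - apply: measurable_funB.
      by apply: measurable_funB; [exact: (a_m aw (isT : ncy Cw))|exact: (a_m av (isT : ncy Cw))].
    apply: measurable_funM => //; apply: measurableT_comp => //.
    by apply: measurable_funB; apply: measurable_funM.
  - by move=> x; rewrite addr0; case: W11q => _ _ /(_ x).
  - apply: aeW => x; rewrite /q' vP_per /vd /dens /at_.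
    by rewrite !(a_per av x (isT : ncy Cp), a_per av x (isT : ncy CU),
      a_per av x (isT : ncy Cw), a_per aw x (isT : ncy Cw), a_per av x (isT : ncy Cn)).
have [_ _ Ln Lr] : in_B (coordE (state_of w s) - coordE (state_of v s) - h *: field_quad v).
  exact: (in_BB (in_BB Ew Ev) (in_BZ h Bf)).
have in_ : integ 0 1 n := L1per_integ 0 1 Ln.
have ir : integ 0 1 r := L1per_integ 0 1 Lr.
have DE := nBE gz gq in_ ir; rewrite (DE : nB (z, q, n, r) = _).
have k1 : supn z <= e.
  apply: supn_le; first exact: gprim_cont gz.
  move=> x _; have := H (Cy, x).
  by rewrite (_ : z x = w (Cy, x) - v (Cy, x) - h * field v (Cy, x)) // /z /=; ring.
have k2 : supn q <= e.
  by apply: supn_le; [exact: gprim_cont gq|move=> x _; exact: H (CU, x)].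
have k3 : itg 0 1 (fun x => `|z' x|) <= e.
  apply: itg_abs_sup; first exact: gprim_integ gz.
  move=> x; have := H (Cp, x).
  by rewrite (_ : z' x = w (Cp, x) - v (Cp, x) - h * field v (Cp, x)) // /z' /=; ring.
have k4 : itg 0 1 (fun x => `|q' x|) <= e.
  apply: itg_abs_sup; first exact: gprim_integ gq.
  by move=> x; have := H (Cw, x); rewrite /= /q' opprB.
have k5 : itg 0 1 (fun x => `|n x|) <= e.
  by apply: itg_abs_sup in_ _ => x; exact: H (Cn, x).
have k6 : itg 0 1 (fun x => `|r x|) = 0.
  rewrite (_ : (fun x => _) = fun=> 0) ?itg_cst ?mul0r//.
  by apply/funext => x; rewrite /r mulr0 subrr subr0 normr0.
rewrite k6; move: k1 k2 k3 k4 k5.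
move: (supn z) (supn q) (itg 0 1 (fun x => `|z' x|)) (itg 0 1 (fun x => `|q' x|))
  (itg 0 1 (fun x => `|n x|)) => a1 a2 a3 a4 a5; clear; lra.
Qed.

End GoodStates.

Section Gluing.
Variable R : realType.
Local Notation mu := (@lebesgue_measure R).
Local Notation quad := ((R -> R) * (R -> R) * (R -> R) * (R -> R))%type.
Implicit Types (X Y : state R) (a b c d : quad).

Lemma eqB_sym a b : eqB a b -> eqB b a.
Proof.
case: a => [[[z U] n] r]; case: b => [[[z' U'] n'] r'] [h1 h2 h3 h4]; split => //.
- by apply: (ae_imp h3) => x ->.
- by apply: (ae_imp h4) => x ->.
Qed.

Lemma eqB_trans a b c : eqB a b -> eqB b c -> eqB a c.
Proof.
case: a => [[[z U] n] r]; case: b => [[[z' U'] n'] r']; case: c => [[[z2 U2] n2] r2].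
move=> [-> -> h3 h4] [-> -> k3 k4]; split => //.
- by apply: (ae_imp2 h3 k3) => x ->.
- by apply: (ae_imp2 h4 k4) => x ->.
Qed.

Lemma eqB_B a b c d : eqB a b -> eqB c d -> eqB (a - c) (b - d).
Proof.
case: a => [[[z U] n] r]; case: b => [[[z' U'] n'] r'].
case: c => [[[z2 U2] n2] r2]; case: d => [[[z3 U3] n3] r3].
move=> [-> -> h3 h4] [-> -> k3 k4]; split => //.
- apply: (ae_imp2 h3 k3) => x e1 e2; exact: (congr2 (fun p q : R => p - q) e1 e2).
- apply: (ae_imp2 h4 k4) => x e1 e2; exact: (congr2 (fun p q : R => p - q) e1 e2).
Qed.

Lemma eqB_Z (k : R) a b : eqB a b -> eqB (k *: a) (k *: b).
Proof.
case: a => [[[z U] n] r]; case: b => [[[z' U'] n'] r'] [-> -> h3 h4]; split => //.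
- apply: (ae_imp h3) => x e1; exact: (congr1 (fun p : R => k * p) e1).
- apply: (ae_imp h4) => x e1; exact: (congr1 (fun p : R => k * p) e1).
Qed.

Lemma eqB_nB a b : in_B a -> in_B b -> eqB a b -> nB a = nB b.
Proof. by move=> ha hb ab; rewrite /nB (eqB_normB ha hb ab). Qed.

(** Equality in E means distance 0, and the Lipschitz estimate carries distance 0 over to the
    right-hand sides. *)
Lemma eq_state_rhs X Y : in_E X -> in_E Y -> eq_state X Y -> eqB (rhs X) (rhs Y).
Proof.
move=> EX EY XY; apply/eqB_sub; apply: nB_eq0; first exact: in_BB (in_B_rhs EX) (in_B_rhs EY).
have bX := state_bounded EX (lexx _); have bY := state_bounded EY (lexx _).
rewrite -(eqB_nB EX EY XY) in bY.
apply: (le_trans (rhs_lip EX EY bX bY)).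
rewrite (eqB_nB (in_BB EX EY) (in_B0 R) ((eqB_sub _ _).1 XY)).
by rewrite nB0 mulr0.
Qed.

Lemma calF_r X : calF X -> L1per (sr X) /\ Linfty (sr X).
Proof. by move=> [EX _ [_ Lr] _ _]; split => //; exact: E_r. Qed.

Lemma local_solution X0 (T : R) : calF X0 -> 0 < T -> exists X : R -> state R,
  [/\ eq_state (X 0) X0, sol_on T X & forall t : R, 0 <= t < T -> calF (X t) /\
    E_bounded (1 + itg 0 1 (fun x => `|snu X0 x|)) (X t)].
Proof.
move=> F0 T0; have [Ls Bs] := calF_r F0; have EX0 : in_E X0 by case: F0.
have [v0 [r [c0 [g0 ey eU en er]]]] := calF_good F0.
have [u [C1 [C2 [c [u0 ug _ uq]]]]] := smooth_flow (ltW T0) g0.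
have sub t : 0 <= t < T -> 0 <= t <= T by move=> /andP[-> /ltW ->].
have gu t : 0 <= t < T -> good (u t) r c by move=> /sub /ug[].
have au t (h : 0 <= t < T) : adm (u t) := g_adm (gu t h).
have en0 : energy v0 = itg 0 1 (fun x => `|snu X0 x|).
  rewrite -(itg_ae_norm (adm_integ (g_adm g0) (isT : ncy Cn)) (L1per_integ 0 1 (E_n EX0)) en).
  by apply: eq_itg => x _; rewrite ger0_norm//; exact: g_n g0 x.
exists (fun t => state_of (u t) (sr X0)); split.
- rewrite u0; split => //; last exact: aeW.
  by rewrite /= ey.
- move=> t tT; split; first exact: in_E_state_of (au t tT) Ls.
  move=> e e0; have D0 : 0 < 5 * `|C2| + 1 by rewrite ltr_wpDl// mulr_ge0.
  exists (e / (5 * `|C2| + 1)); first by rewrite divr_gt0.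
  move=> s sT; rewrite ltr_pdivlMr// => /ltW hs.
  apply: (le_trans (nB_flow_step (e := C2 * (s - t) ^+ 2) (au t tT) (au s sT) Ls _)).
    by move=> i; exact: uq (sub t tT) (sub s sT).
  have n2 := normr_ge0 (s - t).
  have k1 : C2 * (s - t) ^+ 2 <= `|C2| * (s - t) ^+ 2.
    by rewrite ler_wpM2r ?sqr_ge0// ler_norm.
  have k2 : (s - t) ^+ 2 = `|s - t| * `|s - t| by rewrite -expr2 real_normK ?num_real.
  have k3 := ler_wpM2r n2 hs.
  have k4 := mulr_ge0 n2 n2.
  rewrite k2 in k1 *; move: k1 k3 k4; move: `|s - t| `|C2| => h C; clear; lra.
- move=> t tT; have [g E] := ug t (sub t tT); split.
    exact: calF_state_of g Ls Bs er.
  by rewrite -en0 -E; exact: state_of_bounded g Ls.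
Qed.

(** The cut-off level depends on the time horizon, so there is one solution for each integer
    horizon. Uniqueness makes them agree, and the value at [t] is read off from the solution with
    horizon [k t + 1]. *)
Lemma maximal_solution X0 : calF X0 -> exists X : R -> state R,
  [/\ eq_state (X 0) X0, forall T, sol_on T X & forall t : R, 0 <= t -> calF (X t) /\
    E_bounded (1 + itg 0 1 (fun x => `|snu X0 x|)) (X t)].
Proof.
move=> F0.
have /choice[Y HY] : forall n : nat, exists X : R -> state R,
  [/\ eq_state (X 0) X0, sol_on n.+1%:R X & forall t : R, 0 <= t < n.+1%:R -> calF (X t) /\
    E_bounded (1 + itg 0 1 (fun x => `|snu X0 x|)) (X t)].
  by move=> n; exact: local_solution.
pose k (t : R) := Num.truncn t.
have kt t : 0 <= t -> 0 <= t < (k t).+1%:R.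
  by move=> t0; rewrite t0 truncnS_gt.
have agree m n t : 0 <= t -> t < m.+1%:R -> t < n.+1%:R -> eq_state (Y m t) (Y n t).
  move=> t0 tm tn; have [e1 s1 _] := HY m; have [e2 s2 _] := HY n.
  wlog mn : m n tm tn e1 s1 e2 s2 / (m <= n)%N => [W|].
    by have [/W|/ltnW/W] := leqP m n; [exact|move=> h; apply: eqB_sym; exact: h].
  have s2' : sol_on m.+1%:R (Y n) by apply: sol_onS s2; rewrite ler_nat.
  by apply: (sol_unique s1 s2' (eqB_trans e1 (eqB_sym e2))); rewrite t0.
exists (fun t => Y (k t) t); split.
- by have [] := HY (k 0).
- move=> T t /andP[t0 tT]; have T0 := le_lt_trans t0 tT.
  pose N := k T.
  have TN : T < N.+1%:R by have /andP[] := kt T (ltW T0).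
  have [_ SN _] := HY N.
  have inN s : 0 <= s < T -> 0 <= s < N.+1%:R by move=> /andP[-> h]; exact: lt_trans TN.
  have tT' : 0 <= t < T by rewrite t0.
  have ag s : 0 <= s < T -> in_E (Y (k s) s) /\ eq_state (Y (k s) s) (Y N s).
    move=> sT; have /andP[s0 sN] := inN s sT; have sk := kt s s0.
    have [_ Ss _] := HY (k s); split; first exact: sol_on_E Ss sk.
    by apply: agree => //; case/andP: sk.
  have [Et et] := ag t tT'.
  split => // e e0; have [EN HN] := SN t (inN t tT'); have [d d0 Hd] := HN e e0.
  exists d => // s sT sd; have [Es es] := ag s sT.
  have EsN := sol_on_E SN (inN s sT).
  (* The glued curve and [Y N] agree only as elements of E, so the differentiability estimate is
     transported through [eqB]. *)
  have EQ := eqB_B (eqB_B es et) (eqB_Z (s - t) (eq_state_rhs Et EN et)).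
  rewrite (eqB_nB _ _ EQ).
  + exact: Hd (inN s sT) sd.
  + exact: in_BB (in_BB Es Et) (in_BZ _ (in_B_rhs Et)).
  + exact: in_BB (in_BB EsN EN) (in_BZ _ (in_B_rhs EN)).
- by move=> t t0; have [_ _ H] := HY (k t); exact: H (kt t t0).
Qed.

End Gluing.

(** * Comparison with C^1 curves, and the theorem *)

Section GlobalSolutions.
Variable R : realType.
Local Notation mu := (@lebesgue_measure R).
Local Notation quad := ((R -> R) * (R -> R) * (R -> R) * (R -> R))%type.
Implicit Types (X : R -> state R).

Lemma cvg_fin_within (T : Type) (F : set_system T) (f : T -> \bar R) (D : set T) (g : T -> R) :
  Filter F -> (forall x, D x -> f x = (g x)%:E) ->
  (f x @[x --> within D F] --> 0%E) <->
  (forall e : R, 0 < e -> F [set x | D x -> `|g x| <= e]).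
Proof.
move=> FF fg; split.
- move=> /fine_cvgP[_ /cvgrPdist_le H] e e0.
  have He : F [set x | D x -> `|0 - fine (f x)| <= e] := H e e0.
  by apply: filterS He => x /= h Dx; have := h Dx; rewrite fg//= sub0r normrN.
- move=> H; apply/fine_cvgP; split.
    have Ff : F [set x | D x -> f x \is a fin_num].
      by apply: filterE => x /= Dx; rewrite fg.
    exact: Ff.
  apply/cvgrPdist_le => e e0.
  have He : F [set x | D x -> `|0 - fine (f x)| <= e].
    by apply: filterS (H e e0) => x /= h Dx; rewrite fg//= sub0r normrN h.
  exact: He.
Qed.

(** The derivative is [rhs] along the curve; its continuity comes from the continuity of the curve
    and the Lipschitz estimate of [rhs], which the uniform bound makes available. *)
Lemma sol_on_global (X0 : state R) X : eq_state (X 0) X0 -> (forall T : R, sol_on T X) ->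
  (exists M, forall t : R, 0 <= t -> E_bounded M (X t)) -> global_solution X0 X.
Proof.
move=> e0 SX [M bM]; split => //; exists (fun t => rhs (X t)); last first.
  move=> t t0; apply: (eq_state_in_B (in_B_rhs _)).
  by apply: (sol_on_E (SX (t + 1))); rewrite t0 ltrDl ltr01.
have EX t : 0 <= t -> in_E (X t).
  by move=> t0; apply: (sol_on_E (SX (t + 1))); rewrite t0 ltrDl ltr01.
have lim t e : 0 <= t -> 0 < e -> exists2 d : R, 0 < d & forall s, 0 <= s -> `|s - t| < d ->
    nB (coordE (X s) - coordE (X t) - (s - t) *: rhs (X t)) <= e * `|s - t|.
  move=> t0 ep; have tT : 0 <= t < t + 1 by rewrite t0 ltrDl ltr01.
  have [_ H] := SX (t + 1) t tT; have [d d0 Hd] := H e ep.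
  exists (Num.min d 1); first by rewrite lt_min d0 ltr01.
  move=> s s0; rewrite lt_min => /andP[sd s1]; apply: Hd sd.
  by rewrite s0; move: s1; rewrite ltr_norml; lra.
split => [t t0|t t0|t t0]; first by split; [exact: EX|exact: in_B_rhs (EX t t0)].
- pose g h := nB (h^-1 *: (coordE (X (t + h)) - coordE (X t)) - rhs (X t)).
  apply/(cvg_fin_within (g := g)).
    move=> h th; apply: normB_fin.
    exact: in_BB (in_BZ _ (in_BB (EX _ th) (EX t t0))) (in_B_rhs (EX t t0)).
  move=> e ep; have [d d0 Hd] := lim t e t0 ep.
  exists d => //= h /=; rewrite sub0r normrN => hd hn th.
  have := Hd (t + h) th; rewrite addrAC subrr add0r => /(_ hd) H.
  rewrite ger0_norm ?nB_ge0// /g.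
  rewrite -[X in _ - X]scale1r -(mulVf hn) -scalerA -scalerBr.
  apply: (le_trans (nBZ _ (in_BB (in_BB (EX _ th) (EX t t0)) (in_BZ _ (in_B_rhs (EX t t0)))))).
  rewrite normfV mulrC ler_pdivrMr ?normr_gt0//.
- pose g s := nB (rhs (X s) - rhs (X t)).
  apply/(cvg_fin_within (g := g)).
    by move=> s s0; apply: normB_fin; exact: in_BB (in_B_rhs (EX s s0)) (in_B_rhs (EX t t0)).
  move=> e ep; pose L := `|rhs_L M|; pose K := (1 + nB (rhs (X t))).
  have Bt := in_B_rhs (EX t t0).
  have K0 : 0 <= K by rewrite addr_ge0 ?nB_ge0.
  have LK : 0 < L * K + 1 by rewrite ltr_wpDl// (mulr_ge0 (normr_ge0 _) K0).
  have [d d0 Hd] := lim t 1 t0 ltr01.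
  exists (Num.min d (e / (L * K + 1))) => /=; first by rewrite lt_min d0 divr_gt0.
  move=> s; rewrite /= lt_min => /andP[sd se] s0; rewrite distrC in sd se.
  rewrite ger0_norm ?nB_ge0// /g.
  have Es := EX s s0; have Et := EX t t0.
  apply: (le_trans (rhs_lip Es Et (bM s s0) (bM t t0))).
  have h1 : nB (coordE (X s) - coordE (X t)) <= K * `|s - t|.
    rewrite -[X in nB X](subrK ((s - t) *: rhs (X t))).
    apply: (le_trans (nBD (in_BB (in_BB Es Et) (in_BZ _ Bt)) (in_BZ _ Bt))).
    rewrite [leRHS]mulrDl [in leRHS]mulrC; apply: lerD; first by rewrite mulrC; exact: Hd.
    by rewrite [leRHS]mulrC; exact: nBZ.
  apply: (le_trans (ler_wpM2r (nB_ge0 _) (ler_norm _))); rewrite -/L.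
  apply: (le_trans (ler_wpM2l (normr_ge0 _) h1)); rewrite -/L mulrA.
  move: se; rewrite ltr_pdivlMr// => /ltW; apply: le_trans.
  by rewrite [leRHS]mulrDr mulr1 mulrC lerDl.
Qed.

(** The limit of difference quotients is multiplied by [s - t], and the given derivative is
    exchanged for [rhs], to which it is equal in E. This lets an arbitrary competitor enter the
    uniqueness argument. *)
Lemma global_sol_on (X0 : state R) X : global_solution X0 X -> forall T : R, sol_on T X.
Proof.
move=> [_ [dX [HB Hd _] HdX]] T t /andP[t0 tT].
have EX s : 0 <= s -> in_E (X s) by move=> /HB[].
have [Et Bt] := HB t t0; split => // e e0.
have EQ := HdX t t0.
pose g h := nB (h^-1 *: (coordE (X (t + h)) - coordE (X t)) - dX t).
have := Hd t t0; move/(cvg_fin_within (g := g)) => H.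
have {}H : forall e : R, 0 < e -> 0^' [set h | 0 <= t + h -> `|g h| <= e].
  apply: H => h th; apply: normB_fin.
  exact: in_BB (in_BZ _ (in_BB (EX _ th) Et)) Bt.
have [d /= d0 Hd'] := H e e0; exists d => // s /andP[s0 _] sd.
have [->|st] := eqVneq s t.
  by rewrite !subrr scale0r subr0 nB0 normr0 mulr0.
have hn : s - t != 0 by rewrite subr_eq0.
have := Hd' (s - t) _ hn; rewrite /= sub0r normrN => /(_ sd).
have ts : t + (s - t) = s by rewrite addrC subrK.
rewrite /g ts => /(_ s0); rewrite ger0_norm ?nB_ge0// => h.
have Br : in_B (rhs (X t)) by exact: in_B_rhs.
have Es := EX s s0; have Bst := in_BB Es Et.
have EQ2 := eqB_B (eq_state_in_B Bst) (eqB_Z (s - t) (eqB_sym EQ)).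
rewrite (eqB_nB (in_BB Bst (in_BZ _ Br)) (in_BB Bst (in_BZ _ Bt)) EQ2).
rewrite -[coordE (X s) - coordE (X t)]scale1r -(mulfV hn) -scalerA -scalerBr.
apply: (le_trans (nBZ _ (in_BB (in_BZ _ Bst) Bt))).
by rewrite mulrC ler_wpM2r.
Qed.

Lemma ball_B_nu M (Y : state R) : ball_B M Y -> itg 0 1 (fun x => `|snu Y x|) <= M.
Proof.
move=> [EY]; rewrite (normW11perE (E_pU EY)) /normL1per.
rewrite !LnormI1_itg; [|exact: L1per_integ (E_n EY)|exact: gprim_integ (E_py EY)].
rewrite -!EFinD lee_fin; apply: le_trans.
by rewrite lerDr addr_ge0 ?addr_ge0 ?supn_ge0 ?itg_abs_ge0.
Qed.

End GlobalSolutions.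

Theorem theorem2p3 (R : realType) :
  exists S : R -> state R -> state R,
    (forall Xbar : state R, calF Xbar ->
       [/\ global_solution Xbar (fun t => S t Xbar),
           forall X : R -> state R, global_solution Xbar X ->
             forall t : R, 0 <= t -> eq_state (X t) (S t Xbar)
         & forall t : R, 0 <= t -> calF (S t Xbar)])
    /\
    (forall M T : R, 0 < M -> 0 < T ->
       exists C : R, forall Xa Xb : state R,
         ball_B M Xa -> calF Xa -> ball_B M Xb -> calF Xb ->
         forall t : R, 0 <= t <= T ->
           (distE (S t Xa) (S t Xb) <= C%:E * distE Xa Xb)%E).
Proof.
have /choice[S HS] : forall X0 : state R, exists X : R -> state R, calF X0 ->
  [/\ eq_state (X 0) X0, forall T, sol_on T X & forall t : R, 0 <= t -> calF (X t) /\
    E_bounded (1 + itg 0 1 (fun x => `|snu X0 x|)) (X t)].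
  (* The flow map has to be total: outside F a constant curve is taken. *)
  move=> X0; have [F0|nF] := pselect (calF X0); last by exists (fun=> X0).
  by have [X HX] := maximal_solution F0; exists X.
exists (fun t X0 => S X0 t); split => [X0 F0|M T M0 T0].
  have [e0 SS HF] := HS X0 F0; split.
  - apply: sol_on_global => //; exists (1 + itg 0 1 (fun x => `|snu X0 x|)) => t t0.
    exact: (HF t t0).2.
  - move=> X gX t t0; have [e0' _] := gX.
    have e1 : eq_state (X 0) (S X0 0) by exact: eqB_trans e0' (eqB_sym e0).
    have t1 : 0 <= t < t + 1 by rewrite t0 ltrDl ltr01.
    exact: (sol_unique (global_sol_on gX (T := t + 1)) (SS (t + 1)) e1 t1).
  - by move=> t t0; exact: (HF t t0).1.
(* Along both solutions the bound [1 + int nu] of the data is at most [1 + M], which gives the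
   Gronwall rate. The absolute value makes the exponent monotone in time. *)
exists (expR (`|rhs_L (1 + M)| * T)) => Xa Xb ba Fa bb Fb t /andP[t0 tT].
have [ea Sa Ha] := HS Xa Fa; have [eb Sb Hb] := HS Xb Fb.
have tT1 : 0 <= t < t + 1 by rewrite t0 ltrDl ltr01.
have bnd (s : R) : 0 <= s < t + 1 -> E_bounded (1 + M) (S Xa s) /\ E_bounded (1 + M) (S Xb s).
  move=> /andP[s0 _]; split.
    by apply: bounded01_le (Ha s s0).2; rewrite lerD2l ball_B_nu.
  by apply: bounded01_le (Hb s s0).2; rewrite lerD2l ball_B_nu.
have EA : in_E Xa by case: Fa.
have EB : in_E Xb by case: Fb.
have EAt := sol_on_E (Sa (t + 1)) tT1; have EBt := sol_on_E (Sb (t + 1)) tT1.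
have T00 : 0 <= (0 : R) < t + 1 by rewrite lexx ltr_wpDl.
have EA0 := sol_on_E (Sa (t + 1)) T00; have EB0 := sol_on_E (Sb (t + 1)) T00.
rewrite /distE (normB_fin (in_BB EAt EBt)) (normB_fin (in_BB EA EB)) -EFinM lee_fin.
apply: (le_trans (sol_dependence (Sa (t + 1)) (Sb (t + 1)) bnd tT1)).
rewrite (eqB_nB (in_BB EA0 EB0) (in_BB EA EB) (eqB_B ea eb)) mulrC.
rewrite ler_wpM2r ?nB_ge0// ler_expR.
exact: le_trans (ler_wpM2r t0 (ler_norm _)) (ler_wpM2l (normr_ge0 _) tT).
Qed.
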